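(* Let $\mathcal{X}=\mathcal{U}=L^2[0,\pi]$ and consider the semilinear heat equation with non-instantaneous impulses, memory and delay $$ \begin{cases} \dfrac{\partial \omega}{\partial t}(t,x)-\dfrac{\partial^2\omega}{\partial x^2}(t,x)=\mathbf{1}_\theta(x) u(t,x)+\displaystyle\int_0^t M(t,s)\,g(\omega(s-r,x))\,ds+f(t,\omega(t-r,x),u(t,x)), & t\in\bigcup_{i=0}^N(s_i,t_{i+1}],\ x\in[0,\pi],\\ \omega(t,0)=\omega(t,\pi)=0, & t\in(0,T),\\ \omega(s,x)=h(s,x), & s\in[-r,0],\ x\in[0,\pi],\\ \omega(t,x)=G_i(t,\omega(t,x),u(t,x)), & t\in(t_i,s_i],\ x\in[0,\pi],\ i=1,\dots,N, \end{cases} $$ with data as described in the context, under the standing assumption that $M$ is essentially bounded and that $f,g,G_i$ are regular enough that for every $h\in\mathcal{PW}$ and every $u\in L^2([0,T];\mathcal{U})$ the system has exactly one mild solution on $[-r,T]$. For $z\in\mathcal{X}$, $v\in\mathcal{U}$, $t\in[0,T]$ put $f^1(t,z,v)(x)=f(t,z(x),v(x))$. Assume that there exists a continuous function $\rho:\mathbb{R}_+\to\mathbb{R}_+$ such that $$ \|f^1(t,z,v)\|_{\mathcal{X}}\le \rho(\|z\|_{\mathcal{X}})\qquad\text{for all } t\in[0,T],\ z\in\mathcal{X},\ v\in\mathcal{U}. $$ Then the system is approximately controllable on $[0,T]$: for every $h\in\mathcal{PW}$, every $\omega^1\in\mathcal{X}$ and every $\varepsilon>0$ there is a control $u\in L^2([0,T];\mathcal{U})$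 whose corresponding mild solution $\omega$ satisfies $\|\omega(T)-\omega^1\|_{\mathcal{X}}<\varepsilon$.
   Context: Data. $T>0$ and $r>0$ (the delay) are fixed; $0=s_0=t_0<t_1\le s_1<t_2\le s_2<\dots<t_N\le s_N<t_{N+1}=T$ are fixed real numbers; $\theta\subset[0,\pi]$ is a nonempty open set and $\mathbf{1}_\theta$ is its characteristic function. $f:[0,T]\times\mathbb{R}\times\mathbb{R}\to\mathbb{R}$, $g:\mathbb{R}\to\mathbb{R}$, $G_i:(t_i,s_i]\times\mathbb{R}\times\mathbb{R}\to\mathbb{R}$ for $i=1,\dots,N$ (if $t_i=s_i$, $G_i$ is understood to be given at time $s_i$), and $M=M(t,s)$ is a real-valued function in $L^\infty([0,T]\times[0,T])$. Operators. $\mathcal{X}=\mathcal{U}=L^2[0,\pi]$. $A\psi=-\psi_{xx}$ with domain $\mathcal{D}(A)=\{\psi\in\mathcal{X}:\psi,\psi_x \text{ absolutely continuous},\ \psi_{xx}\in\mathcal{X},\ \psi(0)=\psi(\pi)=0\}$. $(S(t))_{t\ge0}$ is the strongly continuous (analytic, compact) semigroup on $\mathcal{X}$ generated by $-A$; it satisfies $\|S(t)\|\le e^{-t}$. $\mathcal{X}^{1/2}=\mathcal{D}(A^{1/2})$. $B_\theta:\mathcal{U}\to\mathcal{X}$ is the bounded operator $B_\theta u=\mathbf{1}_\theta u$. Function spaces. $\mathcal{PW}$ is the set of piecewise continuous functions $h:[-r,0]\to\mathcal{X}^{1/2}$. $\mathcal{PC}(\mathcal{X})$ is the set of functions $\varphi:[-r,T]\to\mathcal{X}$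 that are piecewise continuous on $[-r,0]$ and continuous on $[0,T]$ except at the points $t_i$, $i=1,\dots,N$, where the one-sided limits exist and $\varphi(t_i^-)=\varphi(t_i)$. Substitution operators. For $z\in\mathcal{X}$, $v\in\mathcal{U}$: $g^1(z)(x)=g(z(x))$, $f^1(t,z,v)(x)=f(t,z(x),v(x))$, $G_i^1(t,z,v)(x)=G_i(t,z(x),v(x))$; these are assumed to take values in $\mathcal{X}$. For a function $\omega:[-r,T]\to\mathcal{X}$ and a control $u$, put $$F(t)=F_{\omega,u}(t)=\int_0^t M(t,s)\,g^1(\omega(s-r))\,ds+f^1(t,\omega(t-r),u(t)).$$ Mild solution. A control $u\in L^2([0,T];\mathcal{U})$ is taken as a fixed pointwise-defined representative. A function $\omega\in\mathcal{PC}(\mathcal{X})$ is a mild solution corresponding to $h\in\mathcal{PW}$ and $u\in L^2([0,T];\mathcal{U})$ if - $\omega(t)=h(t)$ for $t\in[-r,0]$; - $\omega(t)=S(t)h(0)+\int_0^t S(t-s)\big(B_\theta u(s)+F(s)\big)\,ds$ for $t\in[0,t_1]$; - $\omega(t)=G_i^1(t,\omega(t),u(t))$ for $t\in(t_i,s_i]$, $i=1,\dots,N$; - $\omega(t)=S(t-s_i)G_i^1(s_i,\omega(s_i),u(s_i))+\int_{s_i}^t S(t-s)\big(B_\theta u(s)+F(s)\big)\,ds$ for $t\in(s_i,t_{i+1}]$, $i=1,\dots,N$. Standing assumption. $f,g,G_i$ are smooth enough that the integrals in the mild-solution formula are meaningful and that, for every $h\in\mathcal{PW}$ and every $u\in L^2([0,T];\mathcal{U})$,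 there is exactly one mild solution on $[-r,T]$. *)

(* Defs.v *)
From HB Require Import structures.
From mathcomp Require Import all_boot all_order all_algebra.
From mathcomp Require Import generic_quotient ring_quotient.
From mathcomp Require Import all_classical all_reals all_analysis measurable_realfun.

Set Implicit Arguments.
Unset Strict Implicit.
Unset Printing Implicit Defensive.
Import Order.TTheory GRing.Theory Num.Theory.
Import numFieldNormedType.Exports.

Local Open Scope classical_set_scope.
Local Open Scope ring_scope.

(* L^2[0,pi]: Borel functions R -> R, square integrable for the restriction of
   Lebesgue measure to [0,pi], modulo equality almost everywhere; values outside
   [0,pi] are therefore irrelevant. The library has the functions (LfunType) and
   their seminorm, but no normed module structure on the quotient, so it is
   built here. *)
Section L2.
Context (R : realType).

Lemma measurable_0pi :
  measurable (`[0, pi]%classic : set (measurableTypeR R)).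
Proof. exact: measurable_itv. Qed.

Definition leb_0pi : {measure set (measurableTypeR R) -> \bar R} :=
  mrestr lebesgue_measure measurable_0pi.

Definition L2fun := LfunType leb_0pi (lee1n 2).
HB.instance Definition _ := GRing.Lmodule.on L2fun.

Definition null_fun : {pred L2fun} :=
  fun f => `[< {ae leb_0pi, forall x, f x = 0} >].

Lemma null_fun_zmod_closed : zmod_closed null_fun.
Proof.
split; first by apply/asboolP; exact: aeW.
move=> f g /asboolP f0 /asboolP g0; apply/asboolP.
apply: filterS2 f0 g0 => x fx gx.
by have -> : (f - g) x = f x - g x by []; rewrite fx gx subrr.
Qed.

HB.instance Definition _ :=
  GRing.isZmodClosed.Build L2fun null_fun null_fun_zmod_closed.

Definition L2 : Type := Quotient.quot null_fun.
HB.instance Definition _ := GRing.Zmodule.on L2.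
HB.instance Definition _ := EqQuotient.on L2.

Definition L2_repr (z : L2) : L2fun := repr z.
Definition L2_fun (z : L2) : R -> R := L2_repr z.
Coercion L2_fun : L2 >-> Funclass.

Definition L2_norm (z : L2) : R :=
  fine ('N[leb_0pi]_2%:E[EFin \o L2_fun z]).

Definition L2_pi (f : L2fun) : L2 := (\pi f)%qT.
Definition L2_scale (a : R) (z : L2) : L2 := L2_pi (a *: L2_repr z).

Lemma L2_eqP (f g : L2fun) :
  (L2_pi f = L2_pi g) <-> {ae leb_0pi, forall x, f x = g x}.
Proof.
split.
  move=> /eqP; rewrite -Quotient.idealrBE => /asboolP; apply: filterS => x.
  by have -> : (f - g) x = f x - g x by []; move=> /eqP; rewrite subr_eq0 => /eqP.
move=> fg; apply/eqP; rewrite -Quotient.idealrBE; apply/asboolP.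
apply: filterS fg => x fgx.
by have -> : (f - g) x = f x - g x by []; rewrite fgx subrr.
Qed.

Lemma L2_reprK z : L2_pi (L2_repr z) = z. Proof. exact: reprK. Qed.

Lemma L2_piK (f : L2fun) : {ae leb_0pi, forall x, L2_repr (L2_pi f) x = f x}.
Proof. by apply/L2_eqP; rewrite L2_reprK. Qed.

Lemma L2_piD f g : L2_pi (f + g) = L2_pi f + L2_pi g.
Proof. by rewrite /L2_pi !piE. Qed.

Lemma L2_scale_pi a f : L2_scale a (L2_pi f) = L2_pi (a *: f).
Proof.
apply/L2_eqP; apply: filterS (L2_piK f) => x fx.
by have E h : (a *: h : L2fun) x = a * h x by []; rewrite !E fx.
Qed.

Lemma L2_scaleA a b z : L2_scale a (L2_scale b z) = L2_scale (a * b) z.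
Proof. by rewrite -[z]L2_reprK !L2_scale_pi scalerA. Qed.

Lemma L2_scale1 : left_id 1 L2_scale.
Proof. by move=> z; rewrite -[z]L2_reprK L2_scale_pi scale1r. Qed.

Lemma L2_scaleDr : right_distributive L2_scale +%R.
Proof.
move=> a x y; rewrite -[x]L2_reprK -[y]L2_reprK -L2_piD !L2_scale_pi.
by rewrite scalerDr L2_piD.
Qed.

Lemma L2_scaleDl z : {morph L2_scale^~ z : a b / a + b}.
Proof.
by move=> a b; rewrite -[z]L2_reprK !L2_scale_pi scalerDl L2_piD.
Qed.

HB.instance Definition _ := GRing.Zmodule_isLmodule.Build R L2
  L2_scaleA L2_scale1 L2_scaleDr L2_scaleDl.

Lemma L2_norm_pi (f : L2fun) :
  L2_norm (L2_pi f) = fine ('N[leb_0pi]_2%:E[EFin \o f]).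
Proof.
congr fine; rewrite unlock /Lnorm; congr poweR.
have mE (h : L2fun) : measurable_fun [set: measurableTypeR R]
    (fun x => (`|h x| `^ 2)%:E).
  apply/measurable_EFinP; apply: (@measurableT_comp _ _ _ _ _ _ (@powR R ^~ 2)).
    exact: measurable_powR.
  exact: measurableT_comp.
apply: ae_eq_integral => //; [exact: mE | exact: mE |].
by apply: filterS (L2_piK f) => x fx _ /=; rewrite /L2_fun fx.
Qed.

Lemma L2_ler_normD x y : L2_norm (x + y) <= L2_norm x + L2_norm y.
Proof.
rewrite -[x]L2_reprK -[y]L2_reprK -L2_piD !L2_norm_pi; exact: ler_LnormD.
Qed.

Lemma L2_normrZ a x : L2_norm (a *: x) = `|a| * L2_norm x.
Proof.
rewrite -[x]L2_reprK; have -> : a *: L2_pi (L2_repr x) = L2_pi (a *: L2_repr x).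
  exact: L2_scale_pi.
rewrite !L2_norm_pi -[RHS]/(fine `|a|%:E * _) -fineM//; last first.
  by rewrite -finite_norm_fine.
by rewrite -LnormZ.
Qed.

Lemma L2_normr0_eq0 x : L2_norm x = 0 -> x = 0.
Proof.
rewrite -[x]L2_reprK L2_norm_pi => /fine_Lnormr_eq0 x0.
have -> : 0 = L2_pi 0 by rewrite /L2_pi !piE.
by apply/L2_eqP; apply: filterS x0 => t /(_ I).
Qed.

HB.instance Definition _ := Lmodule_isNormed.Build R L2
  L2_ler_normD L2_normrZ L2_normr0_eq0.

Definition in_L2 (phi : R -> R) : Prop :=
  exists z : L2, {ae leb_0pi, forall x, z x = phi x}.

(* the class of phi; junk value 0 when phi is not square integrable *)
Definition to_L2 (phi : R -> R) : L2 :=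
  xget 0 [set z : L2 | {ae leb_0pi, forall x, z x = phi x}].

End L2.

Section bochner.
Context (R : realType) (V : normedModType R).
Local Notation mu := (@lebesgue_measure R).
Implicit Types (D : set R) (f s : R -> V).

Definition simple_fun s : Prop :=
  finite_set (range s) /\ forall v, measurable (s @^-1` [set v]).

(* for v = 0 the level set may have infinite measure; fine then gives 0 *)
Definition simple_integral D s : V :=
  \sum_(v \in range s) fine (mu (D `&` s @^-1` [set v])) *: v.

Definition strongly_measurable D f : Prop :=
  exists s : nat -> R -> V, (forall n, simple_fun (s n)) /\
    {ae mu, forall t, D t -> s n t @[n --> \oo] --> f t}.

(* f is Bochner integrable over D with integral I: f is the a.e. limit of
   integrable simple functions that are Cauchy in mean, and I is the limit of
   their integrals. The Cauchy condition stands for the (equivalent)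
   convergence of the integrals of |f - s_n| to 0, because |f - s_n| is only
   Lebesgue measurable, whereas the measurable sets here are the Borel sets. *)
Definition bochner_integral D f (I : V) : Prop :=
  exists s : nat -> R -> V,
  [/\ forall n, simple_fun (s n) /\ mu.-integrable D (fun t => `|s n t|%:E),
      {ae mu, forall t, D t -> s n t @[n --> \oo] --> f t},
      forall e : R, 0 < e -> exists n0, forall m n, (n0 <= m)%N -> (n0 <= n)%N ->
        (\int[mu]_(t in D) `|s m t - s n t|%:E < e%:E)%E
    & simple_integral D (s n) @[n --> \oo] --> I].

Definition bochner_integrable D f : Prop := exists I, bochner_integral D f I.

Definition bint D f : V := xget 0 [set I | bochner_integral D f I].

(* f is a pointwise-defined representative of an element of L^2(D; V) *)
Definition L2_in_time D f : Prop :=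
  strongly_measurable D f /\
  (\int[mu]_(t in D) (`|f t| ^+ 2)%:E < +oo)%E.

Definition pw_continuous (a b : R) f : Prop :=
  exists d : seq R, forall t, t \in `[a, b] ->
  [/\ t \notin d -> f @ within `[a, b]%classic (nbhs t) --> f t,
      a < t -> cvg (f @ t^'-)
    & t < b -> cvg (f @ t^'+)].

Definition C0_semigroup (S : R -> V -> V) : Prop :=
  [/\ forall t, 0 <= t -> linear (S t) /\ continuous (S t),
      forall x, S 0 x = x,
      forall (s t : R) (x : V), 0 <= s -> 0 <= t -> S (s + t) x = S s (S t x)
    & forall x, S t x @[t --> 0^'+] --> x].

(* graph of the infinitesimal generator *)
Definition generator (S : R -> V -> V) (x y : V) : Prop :=
  t^-1 *: (S t x - x) @[t --> 0^'+] --> y.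

(* For an exponentially stable semigroup with generator -A,
     A^(-1/2) y = Gamma(1/2)^-1 * int_0^oo t^(-1/2) S(t) y dt,
   Gamma(1/2) = sqrt pi, and A^(1/2) is the inverse of A^(-1/2). half_power S
   is the graph of A^(1/2): z lies in D(A^(1/2)) and A^(1/2) z = y. *)
Definition half_power (S : R -> V -> V) (z y : V) : Prop :=
  bochner_integral `]0, +oo[%classic (fun t => (Num.sqrt t)^-1 *: S t y)
    (Num.sqrt pi *: z).

(* Piecewise continuous functions on [-r,0] with values in D(A^(1/2)) normed by
   |A^(1/2) z|; one-sided limits of A^(1/2) h are those of h in that norm since
   A^(1/2) is onto. *)
Definition PW (S : R -> V -> V) (r : R) (h : R -> V) : Prop :=
  exists Ah : R -> V, (forall t, t \in `[- r, 0] -> half_power S (h t) (Ah t)) /\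
    pw_continuous (- r) 0 Ah.

End bochner.

Section heat_operator.
Context (R : realType).

Definition abs_cont (a b : R) (p : R -> R) : Prop :=
  forall e : R, 0 < e -> exists2 d : R, 0 < d &
    forall (n : nat) (x y : 'I_n -> R),
      (forall i, a <= x i /\ x i <= y i /\ y i <= b) ->
      (forall i j, i != j -> y i <= x j \/ y j <= x i) ->
      \sum_(i < n) (y i - x i) < d -> \sum_(i < n) `|p (y i) - p (x i)| < e.

(* graph of A: z is in D(A) and A z = - z_xx = w *)
Definition heat_op (z w : L2 R) : Prop :=
  exists p q : R -> R,
  [/\ {ae leb_0pi R, forall x, z x = p x},
      abs_cont 0 pi p /\ {ae leb_0pi R, forall x : R, is_derive x (1 : R) p (q x)},
      abs_cont 0 pi q /\ {ae leb_0pi R, forall x : R, is_derive x (1 : R) q (- w x)}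
    & p 0 = 0 /\ p pi = 0].

End heat_operator.

Record heat_system (R : realType) := HeatSystem {
  hs_T : R;
  hs_r : R;
  hs_N : nat;
  hs_t : nat -> R;
  hs_s : nat -> R;
  hs_theta : set R;
  hs_M : R -> R -> R;
  hs_g : R -> R;
  hs_f : R -> R -> R -> R;
  hs_G : nat -> R -> R -> R -> R }.

Section system.
Context (R : realType) (P : heat_system R) (S : R -> L2 R -> L2 R).
Local Notation X := (L2 R).
Local Notation mu := (@lebesgue_measure R).
Local Notation T := (hs_T P).
Local Notation r := (hs_r P).
Local Notation N := (hs_N P).

Definition time_grid : Prop :=
  [/\ hs_t P 0 = 0 /\ hs_s P 0 = 0,
      forall i, (1 <= i <= N)%N -> hs_t P i <= hs_s P i,
      forall i, (i <= N)%N -> hs_s P i < hs_t P i.+1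
    & hs_t P N.+1 = T].

(* nonempty, open relatively to [0,pi] *)
Definition open_region : Prop :=
  hs_theta P !=set0 /\
  exists U : set R, open U /\ hs_theta P = `[0, pi]%classic `&` U.

Definition kernel_Linfty : Prop :=
  let Q := `[0, T]%classic `*` `[0, T]%classic in
  measurable_fun Q (fun p : R * R => hs_M P p.1 p.2) /\
  exists C : R, {ae (mu \x mu)%E,
    forall p : R * R, Q p -> `|hs_M P p.1 p.2| <= C}.

Definition control_op (v : X) : X := to_L2 (fun x => \1_(hs_theta P) x * v x).

Definition g1 (z : X) : X := to_L2 (fun x => hs_g P (z x)).
Definition f1 (t : R) (z v : X) : X := to_L2 (fun x => hs_f P t (z x) (v x)).
Definition G1 (i : nat) (t : R) (z v : X) : X :=
  to_L2 (fun x => hs_G P i t (z x) (v x)).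

Definition substitution_in_L2 : Prop :=
  [/\ forall z : X, in_L2 (fun x => hs_g P (z x)),
      forall t (z v : X), t \in `[0, T] -> in_L2 (fun x => hs_f P t (z x) (v x))
    & forall i t (z v : X), (1 <= i <= N)%N ->
        t \in `]hs_t P i, hs_s P i] \/ t = hs_s P i ->
        in_L2 (fun x => hs_G P i t (z x) (v x))].

Definition PC (w : R -> X) : Prop :=
  [/\ pw_continuous (- r) 0 w,
      forall t, t \in `[0, T] ->
        (forall i, (1 <= i <= N)%N -> t <> hs_t P i) ->
        w @ within `[0, T]%classic (nbhs t) --> w t
    & forall i, (1 <= i <= N)%N ->
        w @ (hs_t P i)^'- --> w (hs_t P i) /\ cvg (w @ (hs_t P i)^'+)].

Definition memory_term (w : R -> X) (t s : R) : X :=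
  hs_M P t s *: g1 (w (s - r)).

Definition forcing (w u : R -> X) (t : R) : X :=
  bint `[0, t]%classic (memory_term w t) + f1 t (w (t - r)) (u t).

Definition integrand (w u : R -> X) (t s : R) : X :=
  S (t - s) (control_op (u s) + forcing w u s).

Definition control (u : R -> X) : Prop := L2_in_time `[0, T]%classic u.

Definition mild_solution (h u w : R -> X) : Prop :=
  [/\ PC w,
      forall t, t \in `[- r, 0] -> w t = h t,
      forall t, t \in `[0, hs_t P 1] ->
        w t = S t (h 0) + bint `[0, t]%classic (integrand w u t),
      forall i t, (1 <= i <= N)%N -> t \in `]hs_t P i, hs_s P i] ->
        w t = G1 i t (w t) (u t)
    & forall i t, (1 <= i <= N)%N -> t \in `]hs_s P i, hs_t P i.+1] ->
        w t = S (t - hs_s P i) (G1 i (hs_s P i) (w (hs_s P i)) (u (hs_s P i)))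
              + bint `[hs_s P i, t]%classic (integrand w u t)].

(* the Bochner integrals that occur in mild_solution exist; the inner one only
   for almost every t, as M is a class of functions *)
Definition integrals_meaningful : Prop :=
  forall h u w : R -> X, PW S r h -> control u -> PC w ->
  (forall t, t \in `[- r, 0] -> w t = h t) ->
  {ae mu, forall t, t \in `[0, T] ->
     bochner_integrable `[0, t]%classic (memory_term w t)} /\
  (forall i t, (i <= N)%N -> t \in `]hs_s P i, hs_t P i.+1] ->
     bochner_integrable `[hs_s P i, t]%classic (integrand w u t)).

Definition unique_mild_solutions : Prop :=
  forall h u : R -> X, PW S r h -> control u ->
  exists w, mild_solution h u w /\
    forall w', mild_solution h u w' -> forall t, t \in `[- r, T] -> w' t = w t.

Definition approximately_controllable : Prop :=
  forall (h : R -> X) (w1 : X) (e : R), PW S r h -> 0 < e ->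
  exists u w, [/\ control u, mild_solution h u w & `|w T - w1| < e].

End system.

(* Main.v *)
(* Let [w0] be the mild solution for the control [0], and use a control [u]
   supported in [(T - delta, T]] with [delta < r].  Because of the delay, the
   nonlinear terms on this interval still see only [w0], so the solution for
   [u] is explicit: it is [w0] up to [T - delta], and at time [T] it exceeds
   [w0 T] by the integral of [S (T - s) (B (u s) + f1 _ _ (u s) - f1 _ _ 0)].
   The values of [f1] occurring here are bounded by a constant depending on
   [rho] and [w0] only, hence they contribute [O(delta)].

   The linear part reaches a dense set for every [delta]: the closed span [K] of
   the vectors [S t (B v)], [0 < t < delta], contains every [e_n x = sin (n x)].
   Indeed [S t (B e_n)] is a sum of terms [exp (- i^2 t) c_i e_i]; difference quotients
   in [t] bring in the factors [i^(2k)], the Taylor expansion then extends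
   membership in [K] to all [t > 0], and letting [t] tend to infinity peels off
   the modes one after the other, so that [c_n e_n] is in [K], where
   [c_n = (2 / pi) * \int_theta e_n ^ 2] is positive.  A finite sum of vectors
   [S p.1 (B p.2)] is approximated by feeding in the short pulses [eta^-1 *: p.2]
   around the times [T - p.1]. *)

Require Import Defs.
From HB Require Import structures.
From mathcomp Require Import all_boot all_order all_algebra.
From mathcomp Require Import all_classical all_reals all_analysis measurable_realfun.
From mathcomp Require Import lra ring zify.
Set Implicit Arguments.
Unset Strict Implicit.
Unset Printing Implicit Defensive.
Import Order.TTheory GRing.Theory Num.Theory.
Import numFieldNormedType.Exports.
Local Open Scope classical_set_scope.
Local Open Scope ring_scope.

(** * The space [L2] *)

(** The control is not kept small: its pulses have height of order [eta^-1], and [eta] is chosen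
    last. This is harmless because the bound on [f1] does not involve its control argument. The
    order of choices is therefore [K] (from [w0] to the left of [T - r]), then [delta], which makes
    the nonlinear contribution at most [e / 3], then a finite list [l] of times below [delta] and
    vectors reaching [w1 - w0 T] up to [e / 3], and finally [eta].

    The semigroup is known only through its generator, so its action on the sines and its sine
    expansion have to be derived. The density argument works inside the closed subspace itself,
    without duality: analytic continuation in time is replaced by Taylor expansions at [4 / 5 * t],
    whose errors are summable over the modes and each of which enlarges the time range by the factor
    [5 / 4]. Completeness of [L2] comes first, since Banach-Steinhaus, the mode series and the
    splitting of Bochner integrals rely on it. *)

Section almost_everywhere.
Context (R : realType) (mu : {measure set (measurableTypeR R) -> \bar R}).
Implicit Types P Q S : R -> Prop.

Lemma ae_imp1 P S : {ae mu, forall x, P x} -> (forall x, P x -> S x) ->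
  {ae mu, forall x, S x}.
Proof. by move=> aP PS; apply: (@filterS _ _ (ae_filter_ringOfSetsType mu) _ _ PS). Qed.

Lemma ae_imp2 P Q S : {ae mu, forall x, P x} -> {ae mu, forall x, Q x} ->
  (forall x, P x -> Q x -> S x) -> {ae mu, forall x, S x}.
Proof. by move=> aP aQ PQS; apply: (@filterS2 _ _ (ae_filter_ringOfSetsType mu) _ _ _ PQS). Qed.

Lemma ae_imp3 P Q Q' S : {ae mu, forall x, P x} -> {ae mu, forall x, Q x} ->
  {ae mu, forall x, Q' x} ->
  (forall x, P x -> Q x -> Q' x -> S x) -> {ae mu, forall x, S x}.
Proof. by move=> aP aQ aQ' PQS; apply: (@filterS3 _ _ (ae_filter_ringOfSetsType mu) _ _ _ _ PQS). Qed.

End almost_everywhere.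

Section L2_basics.
Context (R : realType).
Local Notation mu := (leb_0pi R).
Implicit Types (z y : L2 R) (f g : R -> R).

Lemma L2_measurable z : measurable_fun [set: measurableTypeR R] (z : R -> R).
Proof. by rewrite /L2_fun. Qed.

Lemma L2_normE z : (`|z| ^+ 2)%:E = (\int[mu]_x (z x ^+ 2)%:E)%E.
Proof.
have -> : (`|z| ^+ 2)%:E = ('N[mu]_2%:E[EFin \o L2_fun z] `^ 2)%E.
  rewrite -finite_norm_fine /= powR_mulrn//.
  by rewrite fine_ge0 // Lnorm_ge0.
rewrite powR_Lnorm ?pnatr_eq0//; apply: eq_integral => x _ /=.
by rewrite powR_mulrn// -normrX ger0_norm// sqr_ge0.
Qed.

Lemma L2_eq z y : {ae mu, forall x, z x = y x} -> z = y.
Proof. by move=> zy; rewrite -[z]L2_reprK -[y]L2_reprK; exact/L2_eqP. Qed.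

Lemma L2_ae0 : {ae mu, forall x, (0 : L2 R) x = 0}.
Proof.
have <- : L2_pi 0 = 0 :> L2 R by rewrite /L2_pi !piE.
exact: L2_piK.
Qed.

Lemma L2_aeD z y : {ae mu, forall x, (z + y : L2 R) x = z x + y x}.
Proof.
have E : L2_pi (L2_repr z + L2_repr y) = z + y.
  by rewrite L2_piD !L2_reprK.
by have := L2_piK (L2_repr z + L2_repr y); rewrite E.
Qed.

Lemma L2_aeZ (a : R) z : {ae mu, forall x, (a *: z : L2 R) x = a * z x}.
Proof.
exact: (L2_piK (a *: L2_repr z)).
Qed.

Lemma L2_aeB z y : {ae mu, forall x, (z - y : L2 R) x = z x - y x}.
Proof.
apply: (ae_imp2 (L2_aeD z (- y)) (L2_aeZ (-1) y)) => x.
by rewrite scaleN1r mulN1r => -> ->.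
Qed.

Lemma in_L2I f : measurable_fun [set: measurableTypeR R] f ->
  (\int[mu]_x (f x ^+ 2)%:E < +oo)%E -> in_L2 f.
Proof.
move=> mf If.
have fL : f \in (Lfun mu 2%:E).
  apply/andP; split; rewrite inE//= /finite_norm.
  rewrite unlock /=; apply: poweR_lty.
  under eq_integral => x _.
    rewrite powR_mulrn// -normrX ger0_norm ?sqr_ge0//; over.
  exact: If.
exists (L2_pi (Lfun_Sub (lee1n 2) fL)).
exact: L2_piK.
Qed.

Lemma to_L2E f : in_L2 f -> {ae mu, forall x, to_L2 f x = f x}.
Proof. by case=> z zf; rewrite /to_L2; case: xgetP => [y -> //|/(_ z)]. Qed.

Lemma to_L2_eq f z : {ae mu, forall x, z x = f x} -> to_L2 f = z.
Proof.
move=> zf; apply: L2_eq; have fL : in_L2 f by exists z.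
by apply: (ae_imp2 (to_L2E fL) zf) => x -> ->.
Qed.

Lemma mu_setT : mu setT = (pi : R)%:E.
Proof.
rewrite /leb_0pi /= /mrestr setTI lebesgue_measure_itv /= lte_fin pi_gt0.
by rewrite sube0.
Qed.

(** For nonnegative functions the complement of [[0, pi]] is null and both measures agree on subsets
    of the interval; the general case splits into positive and negative parts. This gives access to
    the fundamental theorem of calculus on [[0, pi]]. *)
Lemma integral_leb_0pi (f : R -> \bar R) :
  measurable_fun [set: measurableTypeR R] f ->
  (\int[mu]_x f x = \int[lebesgue_measure]_(x in `[0%R, pi]) f x)%E.
Proof.
move=> mf.
have ge0 (g : R -> \bar R) : measurable_fun [set: measurableTypeR R] g ->
    (forall x, (0 <= g x)%E) ->
    (\int[mu]_x g x = \int[lebesgue_measure]_(x in `[0%R, pi]) g x)%E.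
  move=> mg g0; transitivity (\int[mu]_(x in `[0%R, pi]) g x)%E; last first.
    apply: eq_measure_integral => A mA AD.
    by rewrite /leb_0pi /= /mrestr setIidl.
  rewrite (@ge0_negligible_integral _ _ _ mu setT (~` `[0%R, pi]%classic)) //.
  - by rewrite setTD setCK.
  - exact: measurableC.
  - by rewrite /leb_0pi /= /mrestr setICl measure0.
by rewrite integralE [RHS]integralE !ge0 //; [exact: measurable_funeneg|exact: measurable_funepos].
Qed.

Lemma measurable_sqr_EFin f : measurable_fun [set: measurableTypeR R] f ->
  measurable_fun [set: measurableTypeR R] (fun x => (f x ^+ 2)%:E).
Proof. by move=> mf; apply/measurable_EFinP; exact: measurable_funX. Qed.

Lemma L2_measurable_sqr z :
  measurable_fun [set: measurableTypeR R] (fun x => (z x ^+ 2)%:E).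
Proof. by apply: measurable_sqr_EFin; exact: L2_measurable. Qed.

Lemma le_integral_sqr_ae f g : measurable_fun [set: measurableTypeR R] f ->
  measurable_fun [set: measurableTypeR R] g ->
  {ae mu, forall x, `|f x| <= `|g x|} ->
  (\int[mu]_x (f x ^+ 2)%:E <= \int[mu]_x (g x ^+ 2)%:E)%E.
Proof.
move=> mf mg fg; apply: ae_ge0_le_integral => //.
- by move=> x _; rewrite lee_fin sqr_ge0.
- exact: measurable_sqr_EFin.
- by move=> x _; rewrite lee_fin sqr_ge0.
- exact: measurable_sqr_EFin.
- apply: (ae_imp1 fg) => x xy _; rewrite lee_fin.
  by rewrite -(real_normK (num_real (f x))) -(real_normK (num_real (g x))) ler_sqr ?nnegrE.
Qed.

Lemma L2_norm_ae z f : measurable_fun [set: measurableTypeR R] f ->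
  {ae mu, forall x, z x = f x} -> (`|z| ^+ 2)%:E = (\int[mu]_x (f x ^+ 2)%:E)%E.
Proof.
move=> mf zf; rewrite L2_normE; apply: ae_eq_integral => //.
- exact: L2_measurable_sqr.
- exact: measurable_sqr_EFin.
- by apply: (ae_imp1 zf) => x -> .
Qed.

Lemma L2_norm_le z (e : R) : 0 <= e ->
  (\int[mu]_x (z x ^+ 2)%:E <= (e ^+ 2)%:E)%E -> `|z| <= e.
Proof. by move=> e0; rewrite -L2_normE lee_fin ler_sqr ?nnegrE. Qed.

Lemma L2_norm_mono z y : {ae mu, forall x, `|z x| <= `|y x|} -> `|z| <= `|y|.
Proof.
move=> zy; apply: L2_norm_le => //; rewrite L2_normE.
by apply: le_integral_sqr_ae => //; exact: L2_measurable.
Qed.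

Lemma in_L2_bounded f (C : R) : measurable_fun [set: measurableTypeR R] f ->
  (forall x, `|f x| <= C) -> in_L2 f.
Proof.
move=> mf fC; apply: in_L2I => //.
apply: (@le_lt_trans _ _ (\int[mu]_x (C ^+ 2)%:E)%E).
  apply: ge0_le_integral => //.
  - by move=> x _; rewrite lee_fin sqr_ge0.
  - exact: measurable_sqr_EFin.
  - move=> x _; rewrite lee_fin -(real_normK (num_real (f x))) ler_sqr ?nnegrE//.
    exact: le_trans (fC x).
by rewrite integral_cst//= mu_setT -EFinM ltry.
Qed.

(** Scalar dominated convergence is applied to the squared differences, whose integrals are the
    squared distances in [L2]. *)
Lemma to_L2_dominated (f : nat -> R -> R) (g : R -> R) (G : R -> R) :
  (forall n, measurable_fun [set: measurableTypeR R] (f n)) ->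
  measurable_fun [set: measurableTypeR R] g -> in_L2 G ->
  {ae mu, forall x, f n x @[n --> \oo] --> g x} ->
  {ae mu, forall x, forall n, `|f n x| <= G x} ->
  (forall n, in_L2 (f n)) /\ in_L2 g /\ to_L2 (f n) @[n --> \oo] --> to_L2 g.
Proof.
move=> mf mg GL fg fG.
(* [G] is only almost everywhere equal to a measurable function, so its representative [z] serves as
   the majorant. *)
pose z := to_L2 G; have zG := to_L2E GL.
have z2 : (\int[mu]_x (z x ^+ 2)%:E < +oo)%E by rewrite -L2_normE ltry.
have gG : {ae mu, forall x, `|g x| <= `|z x|}.
  apply: (ae_imp3 fg fG zG) => x cfg fGx ->.
  have cn : `|f n x| @[n --> \oo] --> `|g x| by apply: cvg_norm.
  rewrite -(cvg_lim _ cn)//; apply: limr_le; first by apply/cvg_ex; exists `|g x|.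
  by apply: nearW => n; apply: le_trans (ler_norm _).
have fz : {ae mu, forall x, forall n, `|f n x| <= `|z x|}.
  by apply: (ae_imp2 fG zG) => x fGx -> n; apply: le_trans (ler_norm _).
have L2dom (h : R -> R) : measurable_fun [set: measurableTypeR R] h ->
    {ae mu, forall x, `|h x| <= `|z x|} -> in_L2 h.
  move=> mh hz; apply: in_L2I => //; apply: le_lt_trans z2.
  by apply: le_integral_sqr_ae => //; exact: L2_measurable.
have fL n : in_L2 (f n).
  by apply: L2dom => //; apply: (ae_imp1 fz) => x; exact.
have gL : in_L2 g by exact: L2dom.
split => //; split => //.
pose F n x := ((f n x - g x) ^+ 2)%:E.
(* Both [f n] and [g] are bounded by [|z|], hence the squared difference by [4 * z x ^+ 2]. *)
have [//| | | | | |_ _] := @dominated_convergence _ _ _ mu setT _ F (cst 0)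
  (fun x => (4 * (z x) ^+ 2)%:E).
- by move=> n; apply: measurable_sqr_EFin; exact: measurable_funB.
- exact: measurable_cst.
- apply: (ae_imp1 fg) => x cfg _.
  apply/cvg_EFin; first by exact: nearW.
  have -> : 0 = (g x - g x) ^+ 2 :> R by rewrite subrr expr0n.
  by rewrite /F /=; under eq_fun do rewrite /= expr2; rewrite expr2; apply: cvgM;
    apply: cvgB => //; exact: cvg_cst.
- apply/integrableP; split.
    apply/measurable_EFinP; apply: measurable_funM => //.
    apply: measurable_funX; exact: L2_measurable.
  have -> : (\int[mu]_x `|(4 * z x ^+ 2)%:E| = \int[mu]_x (4%:E * (z x ^+ 2)%:E))%E.
    by apply: eq_integral => x _; rewrite -EFinM gee0_abs // lee_fin mulr_ge0 ?sqr_ge0.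
  rewrite ge0_integralZl//; last 2 first.
  - exact: L2_measurable_sqr.
  - by move=> x _; rewrite lee_fin sqr_ge0.
  by rewrite lte_mul_pinfty.
- apply: (ae_imp2 gG fz) => x gz fz' n _.
  rewrite /F gee0_abs ?lee_fin ?sqr_ge0//.
  have -> : 4 * z x ^+ 2 = (`|z x| + `|z x|) ^+ 2.
    by rewrite -(real_normK (num_real (z x))); ring.
  rewrite -(real_normK (num_real (f n x - g x))) ler_sqr ?nnegrE ?addr_ge0//.
  by apply: le_trans (ler_normB _ _) _; exact: lerD.
have FE n : (\int[mu]_x F n x = (`|to_L2 (f n) - to_L2 g| ^+ 2)%:E)%E.
  rewrite (L2_norm_ae (f := fun x => f n x - g x))//.
    exact: measurable_funB.
  apply: (ae_imp3 (L2_aeB (to_L2 (f n)) (to_L2 g)) (to_L2E (fL n)) (to_L2E gL)).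
  by move=> x -> -> ->.
rewrite integral0 => c0.
have {}c0 : `|to_L2 (f n) - to_L2 g| ^+ 2 @[n --> \oo] --> (0 : R).
  move/fine_cvg : c0; apply: cvg_trans; apply: near_eq_cvg.
  by apply: nearW => n /=; rewrite FE.
apply/cvgrPdist_lt => e e0.
have : \forall n \near \oo, `|0 - `|to_L2 (f n) - to_L2 g| ^+ 2| < e ^+ 2.
  by move/cvgrPdist_lt : c0; apply; rewrite exprn_gt0.
apply: filterS => n; rewrite sub0r normrN ger0_norm ?sqr_ge0//.
by rewrite ltr_sqr ?nnegrE// ?ltW// distrC.
Qed.

End L2_basics.

(** * Completeness of [L2] *)

Section L2_complete.
Context (R : realType).
Local Notation mu := (leb_0pi R).

(* Riesz-Fischer: the increments are absolutely summable almost everywhere. *)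
Lemma L2_geometric_cvg (u : nat -> L2 R) :
  (forall k, `|u k.+1 - u k| <= 2^-1 ^+ k) -> exists z : L2 R, u k @[k --> \oo] --> z.
Proof.
move=> uk.
pose d k (x : R) := u k.+1 x - u k x.
pose S m (x : R) := \sum_(0 <= k < m) `|d k x|.
have md k : measurable_fun [set: measurableTypeR R] (d k).
  by apply: measurable_funB; exact: L2_measurable.
have mS m : measurable_fun [set: measurableTypeR R] (S m).
  by apply: measurable_sum => k; apply: measurableT_comp.
have S_ge0 m x : 0 <= S m x by exact: sumr_ge0.
have S_nd x : {homo S^~ x : n m / (n <= m)%N >-> n <= m}.
  move=> n m nm; rewrite /S [leRHS](big_cat_nat (leq0n n) nm)/= lerDl; exact: sumr_ge0.
have normS m : exists2 w : L2 R, {ae mu, forall x, w x = S m x} & `|w| <= 2.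
  (* The exact geometric partial sum is what makes the induction close. *)
  suff [w wS wle] : exists2 w : L2 R, {ae mu, forall x, w x = S m x} &
      `|w| <= 2 - 2 * 2^-1 ^+ m.
    by exists w => //; apply: le_trans wle _; rewrite gerBl mulr_ge0// exprn_ge0.
  elim: m => [|m [w wS wle]].
    exists 0; last by rewrite normr0 expr0 mulr1 subrr.
    by apply: (ae_imp1 (@L2_ae0 R)) => x ->; rewrite /S big_nil.
  have dm : {ae mu, forall x, (u m.+1 - u m : L2 R) x = d m x} by exact: L2_aeB.
  have [v vd] : in_L2 (fun x => `|d m x|).
    apply: in_L2I; first by apply: measurableT_comp.
    under eq_integral do rewrite real_normK ?num_real//.
    by rewrite -(L2_norm_ae (md m) dm) ltry.
  exists (w + v).
    apply: (ae_imp3 (L2_aeD w v) wS vd) => x -> -> ->.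
    by rewrite /S big_nat_recr.
  have vm : `|v| <= 2^-1 ^+ m.
    apply: le_trans (uk m); apply: L2_norm_mono.
    by apply: (ae_imp2 vd dm) => x -> ->; rewrite normr_id.
  apply: le_trans (ler_normD _ _) _; apply: le_trans (lerD wle vm) _.
  rewrite exprS; lra.
(* [H] is the square of the total sum of the [|d k x|]. Its integral is at most [2 ^+ 2], so it is
   finite almost everywhere, which is absolute convergence of the increments there. *)
pose H x := limn (fun m => (S m x ^+ 2)%:E).
have H_nd x : {homo (fun m => (S m x ^+ 2)%:E) : n m / (n <= m)%N >-> (n <= m)%E}.
  by move=> n m nm; rewrite lee_fin ler_sqr ?nnegrE//; exact: S_nd.
have S_le_H m x : ((S m x ^+ 2)%:E <= H x)%E.
  rewrite /H (cvg_lim _ (ereal_nondecreasing_cvgn (H_nd x)))//.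
  by apply: ereal_sup_ubound; exists m.
have mH : measurable_fun [set: measurableTypeR R] H.
  apply: (emeasurable_fun_cvg (fun m x => (S m x ^+ 2)%:E)).
    by move=> m; exact: measurable_sqr_EFin.
  by move=> x _; exact: ereal_nondecreasing_is_cvgn.
have H_ge0 x : (0 <= H x)%E.
  by apply: le_trans (S_le_H 0%N x); rewrite lee_fin sqr_ge0.
have intH : (\int[mu]_x H x <= 4%:E)%E.
  rewrite /H monotone_convergence//; last 2 first.
  - by move=> m; exact: measurable_sqr_EFin.
  - by move=> m x _; rewrite lee_fin sqr_ge0.
  apply: lime_le.
    apply: ereal_nondecreasing_is_cvgn => n m nm; apply: ge0_le_integral => //.
    - by move=> x _; rewrite lee_fin sqr_ge0.
    - exact: measurable_sqr_EFin.
    - exact: measurable_sqr_EFin.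
    - by move=> x _; exact: H_nd.
  apply: nearW => m; have [w wS w2] := normS m.
  rewrite -(L2_norm_ae (mS m) wS) lee_fin.
  have -> : 4 = 2 ^+ 2 :> R by rewrite -natrX.
  by rewrite ler_sqr ?nnegrE.
have H_fin : {ae mu, forall x, H x \is a fin_num}.
  have iH : mu.-integrable setT H.
    apply/integrableP; split => //; under eq_integral do rewrite gee0_abs//.
    exact: le_lt_trans intH (ltry _).
  by apply: (ae_imp1 (integrable_ae measurableT iH)) => x; exact.
have S_cvg x : H x \is a fin_num -> exists2 g : R, S m x @[m --> \oo] --> g &
    ((g ^+ 2)%:E <= H x)%E.
  move=> Hx; pose h := fine (H x).
  have Sh m : S m x ^+ 2 <= h by rewrite -lee_fin /h fineK.
  have cS : cvgn (S^~ x).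
    apply: nondecreasing_is_cvgn; first exact: S_nd.
    by exists (h + 1) => _ [m _ <-]; have := Sh m; have := S_ge0 m x; nra.
  exists (limn (S^~ x)) => //.
  rewrite -(fineK Hx) lee_fin.
  have c2 : S m x ^+ 2 @[m --> \oo] --> (limn (S^~ x)) ^+ 2.
    by under eq_fun do rewrite expr2; rewrite expr2; apply: cvgM.
  rewrite -(cvg_lim _ c2)//; apply: limr_le; first by apply/cvg_ex; eexists; exact: c2.
  exact: nearW.
(* The upper limit is defined and measurable everywhere and agrees with the limit wherever the
   latter exists, so no exceptional set has to be removed. *)
pose g x := fine (limn_esup (fun m => (u m x)%:E)).
pose G x := fine (limn_esup (fun m => (S m x)%:E)).
have mlim (f : nat -> R -> R) : (forall m, measurable_fun [set: measurableTypeR R] (f m)) ->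
    measurable_fun [set: measurableTypeR R] (fun x => fine (limn_esup (fun m => (f m x)%:E))).
  move=> mf; apply: measurableT_comp; first exact: fine_measurable.
  by apply: measurable_fun_limn_esup => m; exact/measurable_EFinP.
have limE (v : nat -> R) l : v m @[m --> \oo] --> l ->
    fine (limn_esup (fun m => (v m)%:E)) = l.
  move=> vl; have /cvg_limn_einf_sup[_ ->//] : (v m)%:E @[m --> \oo] --> l%:E.
  by apply/cvg_EFin => //; exact: nearW.
have GL : in_L2 G.
  apply: in_L2I; first exact: mlim.
  apply: le_lt_trans (le_lt_trans intH (ltry _)).
  apply: ae_ge0_le_integral => //.
  - by move=> x _; rewrite lee_fin sqr_ge0.
  - by apply: measurable_sqr_EFin; exact: mlim.
  - by apply: (ae_imp1 H_fin) => x /S_cvg[l Sl lH] _; rewrite /G (limE _ _ Sl).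
have [w0 w0E] : in_L2 (fun x => `|u 0%N x|).
  apply: in_L2I; first by apply: measurableT_comp => //; exact: L2_measurable.
  by under eq_integral do rewrite real_normK ?num_real//; rewrite -L2_normE ltry.
have [v vE] : in_L2 (fun x => G x + `|u 0%N x|).
  exists (to_L2 G + w0); apply: (ae_imp3 (L2_aeD (to_L2 G) w0) (to_L2E GL) w0E).
  by move=> x -> -> ->.
have uS x m : u m x = u 0%N x + \sum_(0 <= k < m) d k x.
  by rewrite telescope_sumr// addrC subrK.
have [|||||_ [_ cu]] := @to_L2_dominated R (fun m => u m : R -> R) g (fun x => G x + `|u 0%N x|).
- by move=> n; exact: L2_measurable.
- by apply: mlim => m; exact: L2_measurable.
- by exists v.
- apply: (ae_imp1 H_fin) => x /S_cvg[l Sl _].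
  have cd : cvgn (series (fun k => d k x)).
    apply: normed_cvg; apply/cvg_ex; exists l; exact: Sl.
  have /cvg_ex[/= t ut] : cvgn (fun m => u m x).
    under eq_fun do rewrite uS.
    by apply: is_cvgD => //; exact: is_cvg_cst.
  by rewrite /g (limE _ _ ut).
- apply: (ae_imp1 H_fin) => x /S_cvg[l Sl _] n.
  rewrite uS addrC; apply: le_trans (ler_normD _ _) _; rewrite lerD2r /G (limE _ _ Sl).
  apply: le_trans (ler_norm_sum _ _ _) _.
  have -> : l = limn (S^~ x) by apply/esym/cvg_lim.
  by apply: (nondecreasing_cvgn_le (S_nd x)); apply/cvg_ex; exists l.
exists (to_L2 g); have E : (fun n => to_L2 (u n : R -> R)) = u.
  by apply/funext => n; apply: to_L2_eq; exact: aeW.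
by rewrite E in cu.
Qed.

(** A Cauchy filter contains balls of radius [2^-1 ^+ k / 4]. Any two of them meet, so their centres
    satisfy the hypothesis of [L2_geometric_cvg], and their limit is the limit of the filter. *)
Lemma L2_complete (F : set_system (L2 R)) : ProperFilter F -> cauchy F -> cvg F.
Proof.
move=> FF /cauchyP Fc.
have Fx (k : nat) : exists x : L2 R, F (ball x (2^-1 ^+ k / 4)).
  by apply: Fc; rewrite divr_gt0// exprn_gt0.
have [u Fu] := choice Fx.
have near_u k m : (k <= m)%N -> `|u m - u k| <= 2^-1 ^+ k / 2.
  move=> km; have [y [yk ym]] := filter_ex (filterI (Fu k) (Fu m)).
  have mk : 2^-1 ^+ m <= 2^-1 ^+ k :> R.
    by apply: ler_wiXn2l => //; rewrite invf_le1// ler1n.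
  rewrite -(subrK y (u m)) -addrA; apply: le_trans (ler_normD _ _) _.
  move: yk ym; rewrite -ball_normE /= (distrC _ y) => yk ym.
  lra.
have [z uz] : exists z : L2 R, u k @[k --> \oo] --> z.
  apply: L2_geometric_cvg => k; apply: le_trans (near_u k k.+1 (leqnSn k)) _.
  by rewrite ler_pdivrMr// ler_peMr ?exprn_ge0// ler1n.
apply/cvg_ex; exists z; apply/cvgrPdist_lt => e e0.
have [k ke] : exists k, 2^-1 ^+ k < e :> R.
  have /cvgrPdist_lt/(_ e e0) : (2^-1 ^+ k : R) @[k --> \oo] --> (0 : R).
    by apply: cvg_expr; rewrite ger0_norm ?invr_ge0// invf_lt1 ?ltr1n.
  case=> k _ /(_ k (leqnn k)); rewrite sub0r normrN ger0_norm ?exprn_ge0// => ke.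
  by exists k.
have zk : `|z - u k| <= 2^-1 ^+ k / 2.
  have cn : `|u m - u k| @[m --> \oo] --> `|z - u k|.
    by apply: cvg_norm; apply: cvgB => //; exact: cvg_cst.
  rewrite -(cvg_lim _ cn)//; apply: limr_le; first by apply/cvg_ex; eexists; exact: cn.
  by near=> m; apply: near_u; near: m; exact: nbhs_infty_ge.
apply: filterS (Fu k) => y; rewrite -ball_normE /= => yk.
rewrite -(subrK (u k) z) -addrA; apply: le_lt_trans (ler_normD _ _) _.
lra.
Unshelve. all: by end_near. Qed.

HB.instance Definition _ := Uniform_isComplete.Build (L2 R) L2_complete.

End L2_complete.

(** * Bochner integral *)

Section finite_valued.
Context (R : realType).
Local Notation mu := (@lebesgue_measure R).
Local Notation mR := (measurableTypeR R).
Variables (D : set mR) (mD : measurable D) (Dfin : (mu D < +oo)%E).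

(** The value type is arbitrary, so that pairs of simple functions and boolean membership tests are
    instances; the list may contain values that are not attained. *)
Definition finite_valued (U : choiceType) (r : seq U) (s : mR -> U) : Prop :=
  [/\ uniq r, forall t, s t \in r & forall u, measurable (s @^-1` [set u])].

Definition weight (U : choiceType) (s : mR -> U) (u : U) : R :=
  fine (mu (D `&` s @^-1` [set u])).

Lemma mu_fiber (U : choiceType) r (s : mR -> U) u : finite_valued r s ->
  mu (D `&` s @^-1` [set u]) = (weight s u)%:E.
Proof.
move=> [_ _ ms]; rewrite fineK// ge0_fin_numE//.
apply: le_lt_trans Dfin; apply: le_measure; rewrite ?inE//.
exact: measurableI.
Qed.

Lemma integral_fiber (U : choiceType) r (s : mR -> U) u : finite_valued r s ->
  (\int[mu]_(t in D) (\1_(s @^-1` [set u]) t)%:E)%E = (weight s u)%:E.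
Proof.
move=> rs; have [_ _ ms] := rs.
by rewrite integral_indic// setIC; exact: mu_fiber rs.
Qed.

Lemma finite_valued_decomp (U : choiceType) r (s : mR -> U) (psi : U -> R) t :
  finite_valued r s ->
  psi (s t) = \sum_(u <- r) psi u * \1_(s @^-1` [set u]) t.
Proof.
move=> [ur rs _]; rewrite (bigD1_seq (s t))//= indicE mem_set//= mulr1.
rewrite big1 ?addr0// => u /eqP us; rewrite indicE memNset ?mulr0//=.
by move=> su; apply: us; rewrite su.
Qed.

Lemma finite_valued_measurable (U : choiceType) r (s : mR -> U) (psi : U -> R) :
  finite_valued r s -> measurable_fun [set: measurableTypeR R] (psi \o s).
Proof.
move=> rs; have [_ _ ms] := rs.
rewrite (_ : psi \o s = fun t => \sum_(u <- r) psi u * \1_(s @^-1` [set u]) t); last first.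
  by apply/funext => t /=; exact: finite_valued_decomp rs.
apply: measurable_sum => u; exact: measurable_funM.
Qed.

Lemma integral_finite_valued (U : choiceType) r (s : mR -> U) (psi : U -> R) :
  finite_valued r s ->
  (\int[mu]_(t in D) (psi (s t))%:E)%E = (\sum_(u <- r) weight s u * psi u)%:E.
Proof.
move=> rs; have [_ _ ms] := rs.
have mI u : measurable_fun D (fun t => (\1_(s @^-1` [set u]) t)%:E : \bar R).
  by apply/measurable_EFinP; apply: measurable_funS measurableT _ _ => //.
have iI u : mu.-integrable D (fun t => (\1_(s @^-1` [set u]) t)%:E : \bar R).
  apply/integrableP; split => //.
  under eq_integral do rewrite gee0_abs//.
  by rewrite (integral_fiber _ rs) ltry.
under eq_integral do rewrite (finite_valued_decomp _ _ rs) -sumEFin.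
rewrite integral_sum//; last first.
  by move=> u; under eq_fun do rewrite EFinM; exact: integrableZl.
rewrite -sumEFin; apply: eq_bigr => u _.
under eq_integral do rewrite EFinM.
by rewrite integralZl// (integral_fiber _ rs) -EFinM mulrC.
Qed.

Lemma finite_valued_integrable (U : choiceType) r (s : mR -> U) (psi : U -> R) :
  finite_valued r s -> mu.-integrable D (fun t => (psi (s t))%:E).
Proof.
move=> rs; apply/integrableP; split.
  apply/measurable_EFinP; apply: measurable_funS measurableT _ _ => //.
  exact: finite_valued_measurable rs.
have := integral_finite_valued (fun u => `|psi u|) rs.
by move=> /= E; under eq_integral do rewrite /=; rewrite E ltry.
Qed.

Lemma finite_valued_comp (U U' : choiceType) r (s : mR -> U) (phi : U -> U') :
  finite_valued r s -> finite_valued (undup (map phi r)) (phi \o s).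
Proof.
move=> [ur rs ms]; split; first exact: undup_uniq.
  by move=> t; rewrite mem_undup; exact: map_f.
move=> v; have -> : (phi \o s) @^-1` [set v] =
    \big[setU/set0]_(u <- r | phi u == v) (s @^-1` [set u]).
  apply/seteqP; split => t /=.
    by move=> stv; rewrite -bigcup_seq_cond; exists (s t) => //=; rewrite rs stv eqxx.
  by rewrite -bigcup_seq_cond => -[u /= /andP[_ /eqP <-] ->].
exact: bigsetU_measurable.
Qed.

Lemma finite_valued_pair (U U' : choiceType) r r' (s : mR -> U) (s' : mR -> U') :
  finite_valued r s -> finite_valued r' s' ->
  finite_valued [seq (u, u') | u <- r, u' <- r'] (fun t => (s t, s' t)).
Proof.
move=> [ur rs ms] [ur' rs' ms']; split; first by apply: allpairs_uniq => // -[? ?] [? ?] _ _ /= [-> ->].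
  by move=> t; apply/allpairsP; exists (s t, s' t); split => //=.
move=> [u u']; have -> : (fun t => (s t, s' t)) @^-1` [set (u, u')] =
    s @^-1` [set u] `&` s' @^-1` [set u'].
  by apply/seteqP; split => t /= [-> ->].
exact: measurableI.
Qed.

(** Both sides are the integral over [D] of the indicator of the event [phi (s t) = v]. *)
Lemma weight_comp (U U' : choiceType) r (s : mR -> U) (phi : U -> U') v :
  finite_valued r s ->
  weight (phi \o s) v = \sum_(u <- r | phi u == v) weight s u.
Proof.
move=> rs; apply: EFin_inj; rewrite -(integral_fiber v (finite_valued_comp phi rs)).
have := integral_finite_valued (fun u => (phi u == v)%:R) rs.
move=> /= E.
transitivity (\int[mu]_(t in D) ((phi (s t) == v)%:R : R)%:E)%E.
  apply: eq_integral => t _; rewrite indicE; congr (_%:R)%:E; congr nat_of_bool.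
  by apply/idP/eqP => [/set_mem|/mem_set].
rewrite E; congr EFin; rewrite [RHS]big_mkcond /=; apply: eq_bigr => u _.
by case: ifP; rewrite ?mulr1 ?mulr0.
Qed.

Section vector.
Variable V : normedModType R.

Lemma simple_funP (s : mR -> V) : simple_fun s <-> exists r, finite_valued r s.
Proof.
split=> [[fs ms]|[r [ur rs ms]]].
  exists (finmap.enum_fset (fset_set (range s))); split => // t.
  by rewrite in_fset_set// inE; exists t.
split=> //; apply: (sub_finite_set (B := [set` r])); last exact: finite_seq.
by move=> _ [t _ <-] /=; exact: rs.
Qed.

(** A listed value that is not attained has an empty fibre, hence weight [0]. *)
Lemma simple_integralE r (s : mR -> V) : finite_valued r s ->
  simple_integral D s = \sum_(v <- r) weight s v *: v.
Proof.
move=> [ur rs ms]; rewrite fsbig_seq//; apply: fsbig_widen.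
- by move=> _ [t _ <-] /=; exact: rs.
- move=> v /= [_ nv]; rewrite /weight (_ : s @^-1` [set v] = set0).
    by rewrite setI0 measure0 /= scale0r.
  by rewrite -subset0 => t /= st; apply: nv; exists t.
Qed.

(** The values of [s] are grouped by their image under [phi]. With [s] a pair of simple functions
    this yields additivity, with [phi] a linear map it yields commutation with that map. *)
Lemma simple_integral_comp (U : choiceType) r (s : mR -> U) (phi : U -> V) :
  finite_valued r s ->
  simple_integral D (phi \o s) = \sum_(u <- r) weight s u *: phi u.
Proof.
move=> rs; rewrite (simple_integralE (finite_valued_comp phi rs)).
under eq_bigr => v _ do rewrite (weight_comp _ _ rs) scaler_suml.
rewrite (exchange_big_dep xpredT)//=; rewrite big_seq [RHS]big_seq.
apply: eq_bigr => u ur.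
rewrite big_mkcond /= (bigD1_seq (phi u)) ?undup_uniq//=; last first.
  by rewrite mem_undup map_f.
by rewrite eqxx big1 ?addr0// => v; rewrite eq_sym => /negPf ->.
Qed.

End vector.
End finite_valued.

(** * Differences, norm bound and uniqueness of Bochner integrals *)

Section bochner_theory.
Context (R : realType) (V : normedModType R).
Local Notation mR := (measurableTypeR R).
Local Notation mu := (@lebesgue_measure R).
Implicit Types (D : set mR) (f g s : mR -> V).

Lemma simple_sub D s1 s2 : measurable D -> (mu D < +oo)%E ->
  simple_fun s1 -> simple_fun s2 -> simple_fun (fun t => s1 t - s2 t) /\
  simple_integral D (fun t => s1 t - s2 t) =
    simple_integral D s1 - simple_integral D s2.
Proof.
move=> mD Dfin /simple_funP[r1 rs1] /simple_funP[r2 rs2].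
have rs := finite_valued_pair rs1 rs2.
set s := fun t => (s1 t, s2 t) in rs; set r := [seq _ | _ <- _, _ <- _] in rs.
split.
  apply/simple_funP; eexists.
  exact: (finite_valued_comp (fun p : V * V => p.1 - p.2) rs).
rewrite -[LHS]/(simple_integral D ((fun p : V * V => p.1 - p.2) \o s)).
rewrite -[X in X - _]/(simple_integral D ((fun p : V * V => p.1) \o s)).
rewrite -[X in _ - X]/(simple_integral D ((fun p : V * V => p.2) \o s)).
rewrite !(simple_integral_comp mD Dfin _ rs) -sumrB.
by apply: eq_bigr => -[u v] _ /=; rewrite scalerBr.
Qed.

Lemma simple_norm_measurable s : simple_fun s ->
  measurable_fun [set: mR] (fun t => `|s t|).
Proof. by move=> /simple_funP[r rs]; exact: (finite_valued_measurable _ rs). Qed.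

Lemma simple_norm_measurable_EFin D s : simple_fun s ->
  measurable_fun D (fun t => `|s t|%:E).
Proof.
move=> ss; apply/measurable_EFinP; apply: measurable_funS measurableT _ _ => //.
exact: simple_norm_measurable.
Qed.

Lemma simple_norm_integrable D s : measurable D -> (mu D < +oo)%E ->
  simple_fun s -> mu.-integrable D (fun t => `|s t|%:E).
Proof. by move=> mD Dfin /simple_funP[r rs]; exact: (finite_valued_integrable mD Dfin (fun v => `|v|) rs). Qed.

Lemma norm_simple_integral D s : measurable D -> (mu D < +oo)%E ->
  simple_fun s -> (`|simple_integral D s|%:E <= \int[mu]_(t in D) `|s t|%:E)%E.
Proof.
move=> mD Dfin /simple_funP[r rs].
rewrite (integral_finite_valued mD Dfin (fun v => `|v|) rs) (simple_integralE D rs) lee_fin.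
apply: le_trans (ler_norm_sum _ _ _) _; apply: ler_sum => v _.
by rewrite normrZ ger0_norm// /weight fine_ge0.
Qed.

Lemma bochner_sub D f g I J : measurable D -> (mu D < +oo)%E ->
  bochner_integral D f I -> bochner_integral D g J ->
  bochner_integral D (fun t => f t - g t) (I - J).
Proof.
move=> mD Dfin [s [ss sf sc sI]] [s' [ss' sg sc' sJ]].
have S n := simple_sub mD Dfin (proj1 (ss n)) (proj1 (ss' n)).
exists (fun n t => s n t - s' n t); split.
- by move=> n; split; [exact: (S n).1|apply: simple_norm_integrable => //; exact: (S n).1].
- by apply: (ae_imp2 sf sg) => t cf cg Dt; apply: cvgB; [exact: cf|exact: cg].
- move=> e e0; have e2 : 0 < e / 2 by rewrite divr_gt0.
  have [n1 H1] := sc _ e2; have [n2 H2] := sc' _ e2.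
  exists (maxn n1 n2) => m n; rewrite !geq_max => /andP[m1 m2] /andP[n1' n2'].
  have M (h : nat -> mR -> V) m' n' (sh : forall n, simple_fun (h n)) :
      measurable_fun D (fun t => `|h m' t - h n' t : V|%:E).
    exact: (simple_norm_measurable_EFin (s := fun t => h m' t - h n' t) (simple_sub mD Dfin (sh m') (sh n')).1).
  have M1 := M s m n (fun k => proj1 (ss k)); have M2 := M s' m n (fun k => proj1 (ss' k)).
  have M3 := M (fun n t => s n t - s' n t) m n (fun n => (S n).1).
  apply: (@le_lt_trans _ _ (\int[mu]_(t in D) (`|s m t - s n t|%:E + `|s' m t - s' n t|%:E))%E).
    apply: ge0_le_integral => //.
      exact: emeasurable_funD.
    move=> t _; rewrite -EFinD lee_fin.
    by rewrite (_ : _ - _ = (s m t - s n t) - (s' m t - s' n t)) ?ler_normB// !opprD !opprK addrACA.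
  rewrite ge0_integralD// [X in (_ < X%:E)%E](splitr e) EFinD.
  by apply: lteD; [exact: H1|exact: H2].
- under eq_fun do rewrite (S _).2; exact: cvgB.
Qed.

Lemma limn_einf_le (u : nat -> \bar R) (a : \bar R) :
  (forall n, (u n <= a)%E) -> (limn_einf u <= a)%E.
Proof.
move=> ua; rewrite limn_einf_lim; apply: lime_le; first exact: is_cvg_einfs.
apply: nearW => n; apply: le_trans (ua n).
by apply: ereal_inf_lbound; exists n => /=.
Qed.

(** The norm of [f] is not known to be Borel, so [e] is compared with the approximants instead. The
    lower limit [L] of [|s n - s m|] in [m] is Borel and equals [|s n - f|] almost everywhere on
    [D]; hence [|s n| <= e + L] there, and Fatou together with the Cauchy property in mean bounds
    the integral of [L] by [eps]. *)
Lemma bochner_le D f I (e : mR -> R) : measurable D -> (mu D < +oo)%E ->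
  bochner_integral D f I -> measurable_fun D e -> (forall t, D t -> 0 <= e t) ->
  {ae mu, forall t, D t -> `|f t| <= e t} ->
  (`|I|%:E <= \int[mu]_(t in D) (e t)%:E)%E.
Proof.
move=> mD Dfin [s [ss sf sc sI]] me e0 fe.
apply/lee_addgt0Pr => eps eps0; have [n0 H0] := sc _ eps0.
suff sn n : (n0 <= n)%N ->
    (`|simple_integral D (s n)|%:E <= \int[mu]_(t in D) (e t)%:E + eps%:E)%E.
  have cn : `|simple_integral D (s n)|%:E @[n --> \oo] --> `|I|%:E.
    by apply/cvg_EFin; [exact: nearW|exact: cvg_norm].
  rewrite -(cvg_lim _ cn)//; apply: lime_le; first by apply/cvg_ex; eexists; exact: cn.
  by near=> n; apply: sn; near: n; exact: nbhs_infty_ge.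
move=> n0n; apply: le_trans (norm_simple_integral mD Dfin (proj1 (ss n))) _.
(* The shift by [n0] puts every index in the range where the mean distance is below [eps]. *)
pose u m t : \bar R := `|s n t - s (m + n0)%N t|%:E.
have mu_ m : measurable_fun D (u m).
  exact: (simple_norm_measurable_EFin (s := fun t => s n t - s (m + n0)%N t)
    (simple_sub mD Dfin (proj1 (ss n)) (proj1 (ss (m + n0)%N))).1).
pose L t := limn_einf (u^~ t).
have L0 t : (0 <= L t)%E.
  rewrite /L limn_einf_lim; apply: lime_ge; first exact: is_cvg_einfs.
  by apply: nearW => m; apply: le_ereal_inf_tmp => _ [k _ <-]; rewrite lee_fin.
have mL : measurable_fun D L.
  rewrite /L /limn_einf; apply: measurableT_comp => //.
  by apply: measurable_fun_limn_esup => m; exact: measurableT_comp.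
apply: (@le_trans _ _ (\int[mu]_(t in D) ((e t)%:E + L t))%E).
  apply: ae_ge0_le_integral => //.
  - exact: simple_norm_measurable_EFin (proj1 (ss n)).
  - by move=> t Dt; apply: adde_ge0 => //; rewrite lee_fin e0.
  - by apply: emeasurable_funD => //; exact/measurable_EFinP.
  - apply: (ae_imp2 sf fe) => t cf ft Dt.
    have -> : L t = `|s n t - f t|%:E.
      have [] // := @cvg_limn_einf_sup _ (u^~ t) (`|s n t - f t|%:E).
      apply/cvg_EFin; first exact: nearW.
      apply: cvg_norm; apply: cvgB; first exact: cvg_cst.
      by have := cf Dt; rewrite -(cvg_shiftn n0).
    rewrite -EFinD lee_fin; have := ft Dt.
    have : `|s n t| <= `|f t| + `|s n t - f t|.
      by rewrite -{1}(subrK (f t) (s n t)) addrC; exact: ler_normD.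
    lra.
rewrite ge0_integralD//; last exact/measurable_EFinP.
apply: leeD => //; apply: (@le_trans _ _ (limn_einf (fun m => \int[mu]_(t in D) u m t))%E).
  by apply: fatou => // m t _; rewrite lee_fin.
apply: limn_einf_le => m; apply: ltW; apply: H0 => //.
exact: leq_addl.
Unshelve. all: by end_near. Qed.

(** [I - J] is an integral of [f - f], to which [bochner_le] applies with majorant [0]; the two
    approximating sequences are never compared. This makes [bint] well determined on sets of finite
    measure. *)
Lemma bochner_uniq D f I J : measurable D -> (mu D < +oo)%E ->
  bochner_integral D f I -> bochner_integral D f J -> I = J.
Proof.
move=> mD Dfin fI fJ; have fIJ := bochner_sub mD Dfin fI fJ.
have := bochner_le (e := cst 0) mD Dfin fIJ; rewrite integral0 => h.
apply/eqP; rewrite -subr_eq0 -normr_le0 -lee_fin; apply: h => //.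
by apply: aeW => t _; rewrite subrr normr0.
Qed.

Lemma bintE D f I : measurable D -> (mu D < +oo)%E ->
  bochner_integral D f I -> bint D f = I.
Proof.
move=> mD Dfin fI; rewrite /bint; case: xgetP => [J _ fJ|/(_ I)//].
exact: bochner_uniq fJ fI.
Qed.

Lemma bochner_ext D f g I : (forall t, D t -> f t = g t) ->
  bochner_integral D f I -> bochner_integral D g I.
Proof.
move=> fg [s [ss sf sc sI]]; exists s; split => //.
by apply: (ae_imp1 sf) => t cf Dt; rewrite -fg//; exact: cf.
Qed.

Lemma bint_ext D f g : (forall t, D t -> f t = g t) -> bint D f = bint D g.
Proof.
move=> fg; rewrite /bint; congr xget; apply/seteqP; split => I /=.
  exact: bochner_ext.
by apply: bochner_ext => t Dt; rewrite fg.
Qed.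

Lemma bochner_simple D s : measurable D -> (mu D < +oo)%E -> simple_fun s ->
  bochner_integral D s (simple_integral D s).
Proof.
move=> mD Dfin ss; exists (fun=> s); split => //.
- by move=> _; split => //; exact: simple_norm_integrable.
- by apply: aeW => t _; exact: cvg_cst.
- move=> e e0; exists 0%N => _ _ _ _; under eq_integral do rewrite subrr normr0.
  by rewrite integral0 lte_fin.
- exact: cvg_cst.
Qed.

End bochner_theory.

(** * Splitting the domain, and images under bounded operators *)

Section bochner_complete.
Context (R : realType) (V : completeNormedModType R).
Local Notation mR := (measurableTypeR R).
Local Notation mu := (@lebesgue_measure R).
Implicit Types (D : set mR) (f g s : mR -> V).

Lemma simple_integral_setU D1 D2 s : measurable D1 -> measurable D2 ->
  (mu D1 < +oo)%E -> (mu D2 < +oo)%E -> [disjoint D1 & D2] -> simple_fun s ->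
  simple_integral (D1 `|` D2) s = simple_integral D1 s + simple_integral D2 s.
Proof.
move=> mD1 mD2 D1fin D2fin D12 /simple_funP[r rs].
rewrite !(simple_integralE _ rs) -big_split; apply: eq_bigr => v _ /=.
have [_ _ ms] := rs.
rewrite -scalerDl; congr (_ *: _); rewrite /weight setIUl measureU//.
- have F1 : mu (D1 `&` s @^-1` [set v]) \is a fin_num by rewrite (mu_fiber mD1 D1fin v rs).
  have F2 : mu (D2 `&` s @^-1` [set v]) \is a fin_num by rewrite (mu_fiber mD2 D2fin v rs).
  by apply: fineD; [exact: F1|exact: F2].
- exact: measurableI.
- exact: measurableI.
- by rewrite setIACA (eqP D12) set0I.
Qed.

(** The approximants on the union also serve on each piece. Their simple integrals there are Cauchy,
    and completeness of [V] provides the two limits. *)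
Lemma bochner_setU D1 D2 f I : measurable D1 -> measurable D2 ->
  (mu D1 < +oo)%E -> (mu D2 < +oo)%E -> [disjoint D1 & D2] ->
  bochner_integral (D1 `|` D2) f I ->
  exists I1 I2, [/\ bochner_integral D1 f I1, bochner_integral D2 f I2 & I = I1 + I2].
Proof.
move=> mD1 mD2 D1fin D2fin D12 [s [ss sf sc sI]].
have mD : measurable (D1 `|` D2) by exact: measurableU.
have restr D : measurable D -> (mu D < +oo)%E -> D `<=` D1 `|` D2 ->
    exists2 J, bochner_integral D f J & simple_integral D (s n) @[n --> \oo] --> J.
  move=> mD' Dfin DD.
  have sc' (e : R) : 0 < e -> exists n0, forall m n, (n0 <= m)%N -> (n0 <= n)%N ->
      (\int[mu]_(t in D) `|s m t - s n t|%:E < e%:E)%E.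
    move=> e0; have [n0 H0] := sc _ e0; exists n0 => m n n0m n0n.
    apply: le_lt_trans (H0 _ _ n0m n0n); apply: ge0_subset_integral => //.
    apply: (simple_norm_measurable_EFin (s := fun t => s m t - s n t)).
    exact: (simple_sub mD' Dfin (ss m).1 (ss n).1).1.
  have cs : cvg (simple_integral D (s n) @[n --> \oo]).
    apply/cauchy_cvgP/cauchyP => e e0; have [n0 H0] := sc' _ e0.
    exists (simple_integral D (s n0)); exists n0 => // n n0n.
    rewrite /= -ball_normE /= -lte_fin.
    apply: le_lt_trans (H0 _ _ (leqnn _) n0n).
    have [ds <-] := simple_sub mD' Dfin (ss n0).1 (ss n).1.
    exact: norm_simple_integral.
  exists (lim (simple_integral D (s n) @[n --> \oo])) => //.
  exists s; split => //.
  - by move=> n; split; [exact: (ss n).1 | exact: simple_norm_integrable (ss n).1].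
  - by apply: (ae_imp1 sf) => t cf Dt; apply: cf; exact: DD.
have [I1 f1 c1] := restr _ mD1 D1fin (@subsetUl _ _ _).
have [I2 f2 c2] := restr _ mD2 D2fin (@subsetUr _ _ _).
exists I1, I2; split => //.
apply: (cvg_unique _ sI) => //.
rewrite (_ : (fun n => _) = fun n => simple_integral D1 (s n) + simple_integral D2 (s n)).
  exact: cvgD.
by apply/funext => n; exact: simple_integral_setU (ss n).1.
Qed.

Lemma bochner_linear D f I (L : V -> V) (C : R) : measurable D -> (mu D < +oo)%E ->
  linear L -> 0 < C -> (forall x, `|L x| <= C * `|x|) ->
  bochner_integral D f I -> bochner_integral D (L \o f) (L I).
Proof.
move=> mD Dfin linL C0 LC [s [ss sf sc sI]].
pose Lin : {linear V -> V} := HB.pack L (GRing.isLinear.Build _ _ _ _ _ linL).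
have LB x y : L (x - y) = L x - L y by exact: (linearB Lin).
have LZ a x : L (a *: x) = a *: L x by exact: (linearZ_LR Lin).
have Lc (u : nat -> V) x : u n @[n --> \oo] --> x -> L (u n) @[n --> \oo] --> L x.
  move=> /cvgrPdist_lt ux; apply/cvgrPdist_lt => e e0.
  have /ux : 0 < e / C by rewrite divr_gt0.
  apply: filterS => n; rewrite -LB ltr_pdivlMr// mulrC => h.
  exact: le_lt_trans (LC _) h.
have Ls n : simple_fun (L \o s n) /\
    simple_integral D (L \o s n) = L (simple_integral D (s n)).
  have /simple_funP[r rs] := (ss n).1; split.
    by apply/simple_funP; eexists; exact: finite_valued_comp rs.
  rewrite (simple_integral_comp mD Dfin L rs) (simple_integralE D rs).
  rewrite -[L (\sum_(_ <- _) _)]/(Lin (\sum_(v <- r) weight D (s n) v *: v)).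
  by rewrite raddf_sum; apply: eq_bigr => v _; rewrite -LZ.
exists (fun n => L \o s n); split.
- by move=> n; split; [exact: (Ls n).1 | exact: simple_norm_integrable (Ls n).1].
- by apply: (ae_imp1 sf) => t cf Dt; apply: Lc; exact: cf.
- move=> e e0; have eC : 0 < e / C by rewrite divr_gt0.
  have [n0 H0] := sc _ eC; exists n0 => m n n0m n0n.
  have ms : measurable_fun D (fun t => `|s m t - s n t|%:E).
    apply: (simple_norm_measurable_EFin (s := fun t => s m t - s n t)).
    exact: (simple_sub mD Dfin (ss m).1 (ss n).1).1.
  apply: (@le_lt_trans _ _ (\int[mu]_(t in D) (C%:E * `|s m t - s n t|%:E))%E).
    apply: ge0_le_integral => //.
    + apply: (simple_norm_measurable_EFin (s := fun t => L (s m t) - L (s n t))).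
      exact: (simple_sub mD Dfin (Ls m).1 (Ls n).1).1.
    + exact: measurable_funeM.
    + by move=> t _ /=; rewrite -EFinM lee_fin -LB.
  rewrite ge0_integralZl//; last by rewrite lee_fin ltW.
  have := H0 _ _ n0m n0n; rewrite -(@lte_pmul2l _ C%:E)//.
  by rewrite -EFinM mulrCA divff ?gt_eqF// mulr1.
- rewrite (_ : (fun n => _) = fun n => L (simple_integral D (s n))); first exact: Lc.
  by apply/funext => n; exact: (Ls n).2.
Qed.

End bochner_complete.

(** * Exponential families *)

Section exponential_bounds.
Context (R : realType).
Implicit Types (x y t q : R).

Lemma exprn_le_fact_expR (k : nat) y : 0 <= y -> y ^+ k <= k`!%:R * expR y.
Proof.
move=> y0; case: k => [|k]; first by rewrite expr0 fact0 mul1r; have := expR_ge1Dx y; lra.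
rewrite -ler_pdivrMl ?ltr0n ?fact_gt0// mulrC.
by apply: le_trans (expR_ge1Dxn k y0); rewrite lerDr.
Qed.

Lemma sum_geometric_le q N : 0 <= q -> q < 1 -> \sum_(i < N) q ^+ i <= (1 - q)^-1.
Proof.
move=> q0 q1; have q1' : 0 < 1 - q by rewrite subr_gt0.
rewrite -(ler_pM2l q1') divff ?gt_eqF//.
by rewrite -opprB mulNr -subrX1 opprB gerBl exprn_ge0.
Qed.

(** The upper bound comes from [expR x >= 1 + x] through [(1 + x)^-1 = 1 - x + x ^+ 2 / (1 + x)]. *)
Lemma expRN_quadratic x : 0 <= x -> 0 <= expR (- x) - 1 + x <= x ^+ 2.
Proof.
move=> x0; have := expR_ge1Dx (- x); have := expR_ge1Dx x.
rewrite expRN; set e := expR x => ex eNx.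
have e0 : 0 < e by rewrite expR_gt0.
apply/andP; split; first lra.
have : e^-1 <= (1 + x)^-1 by rewrite lef_pV2 ?posrE//; lra.
have -> : (1 + x)^-1 = 1 - x + x ^+ 2 / (1 + x) by field; lra.
have : x ^+ 2 / (1 + x) <= x ^+ 2 by rewrite ler_pdivrMr; nra.
lra.
Qed.

(** For [k >= K] one has [y ^+ k <= 2^-1 ^+ K * (2 * y) ^+ k], so the tail is dominated by the
    series of [expR (2 * y)]. The factor [2^-1 ^+ K] does not depend on [y]; the doubled exponent is
    the price, later absorbed by the decay of the modes. *)
Lemma expRN_taylor (K : nat) y : 0 <= y ->
  `|expR (- y) - \sum_(k < K) (- y) ^+ k / k`!%:R| <= 2^-1 ^+ K * expR (2 * y).
Proof.
move=> y0.
pose P M := \sum_(0 <= k < M) (- y) ^+ k / k`!%:R.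
have cP : `|P M - P K| @[M --> \oo] --> `|expR (- y) - P K|.
  apply: cvg_norm; apply: cvgB; last exact: cvg_cst.
  exact: is_cvg_series_exp_coeff.
rewrite -[\sum_(k < K) _](big_mkord xpredT (fun k => (- y) ^+ k / k`!%:R)) -/(P K).
rewrite -(cvg_lim _ cP)//; apply: limr_le; first by apply/cvg_ex; eexists; exact: cP.
near=> M; have KM : (K <= M)%N by near: M; exact: nbhs_infty_ge.
rewrite (_ : P M - P K = \sum_(K <= k < M) (- y) ^+ k / k`!%:R); last first.
  by rewrite /P (big_cat_nat (leq0n K) KM)/= addrAC subrr add0r.
apply: le_trans (ler_norm_sum _ _ _) _.
apply: (@le_trans _ _ (2^-1 ^+ K * \sum_(0 <= k < M) (2 * y) ^+ k / k`!%:R)).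
  rewrite mulr_sumr [leRHS](big_cat_nat (leq0n K) KM)/= ler_wpDl//.
    by apply: sumr_ge0 => k _; rewrite mulr_ge0 ?exprn_ge0 ?invr_ge0 ?divr_ge0 ?exprn_ge0 ?mulr_ge0.
  rewrite big_nat_cond [leRHS]big_nat_cond; apply: ler_sum => k /andP[/andP[Kk _] _].
  rewrite normrM normrX normrN (ger0_norm y0) normfV ger0_norm//.
  rewrite mulrA ler_wpM2r ?invr_ge0// exprMn mulrA ler_peMl ?exprn_ge0//.
  rewrite -(subnK Kk) exprD mulrCA -exprMn mulVf ?pnatr_eq0// expr1n mulr1.
  by rewrite exprn_ege1// ler1n.
rewrite ler_wpM2l ?exprn_ge0//.
have ce := @is_cvg_series_exp_coeff R (2 * y).
apply: (nondecreasing_cvgn_le _ ce M); apply: nondecreasing_series => n _ _.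
by apply: exp_coeff_ge0; rewrite mulr_ge0.
Unshelve. all: by end_near. Qed.

End exponential_bounds.

(** * Sequences: from exponentials to unit vectors in an [l^1]-closed subspace *)

Section l1_closed.
Context (R : realType) (lam : nat -> R).
Hypothesis lam0 : 0 <= lam 0%N.
Hypothesis lam_gap : forall i j : nat, (i <= j)%N -> (j - i)%:R <= lam j - lam i.
Variable A : (nat -> R) -> Prop.
Hypothesis A0 : A (fun=> 0).
Hypothesis A_comb : forall (a b : R) phi psi, A phi -> A psi ->
  A (fun i => a * phi i + b * psi i).
Hypothesis A_closed : forall phi : nat -> R, (forall e : R, 0 < e -> exists2 psi, A psi &
  forall N, \sum_(i < N) `|phi i - psi i| <= e) -> A phi.

(** Up to the sign [(-1) ^ k], this is the [k]-th derivative in [t] of [expR (- lam i * t)]. *)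
Let E (k : nat) (t : R) (i : nat) : R := lam i ^+ k * expR (- lam i * t).

Let lam_ge i : i%:R <= lam i.
Proof. by have := lam_gap (leq0n i); rewrite subn0; have := lam0; lra. Qed.

Let lam_ge0 i : 0 <= lam i.
Proof. exact: le_trans (ler0n _ i) (lam_ge i). Qed.

Let A_ext phi psi : phi =1 psi -> A phi -> A psi.
Proof. by move=> /funext ->. Qed.

Let A_sum (I : Type) (r : seq I) (a : I -> R) (phi : I -> nat -> R) :
  (forall k, A (phi k)) -> A (fun i => \sum_(k <- r) a k * phi k i).
Proof.
move=> Aphi; elim: r => [|k r IH]; first by apply: A_ext A0 => i; rewrite big_nil.
by apply: A_ext (A_comb (a k) 1 (Aphi k) IH) => i; rewrite big_cons mul1r.
Qed.

(** Half of the exponent absorbs the factor [lam i ^+ k]; since [lam i >= i], the other half leaves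
    a geometric series of ratio [expR (- (t / 2))]. *)
Let summable_E k t : 0 < t -> exists2 C, 0 < C & forall N, \sum_(i < N) E k t i <= C.
Proof.
move=> t0; have t2 : 0 < t / 2 by lra.
pose q := expR (- (t / 2)).
have q1 : q < 1 by rewrite expR_lt1 oppr_lt0.
pose M := k`!%:R * (t / 2) ^- k.
have M0 : 0 < M by rewrite mulr_gt0 ?invr_gt0 ?exprn_gt0 ?ltr0n ?fact_gt0.
exists (M * (1 - q)^-1).
  by rewrite mulr_gt0// invr_gt0 subr_gt0.
move=> N; apply: (@le_trans _ _ (M * \sum_(i < N) q ^+ i)); last first.
  by rewrite ler_wpM2l ?(ltW M0)// sum_geometric_le ?expR_ge0.
rewrite mulr_sumr; apply: ler_sum => i _; rewrite /E.
have le1 : lam i ^+ k <= M * expR (lam i * (t / 2)).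
  have := @exprn_le_fact_expR R k (lam i * (t / 2)).
  rewrite mulr_ge0 ?(ltW t2)// => /(_ isT); rewrite exprMn.
  by rewrite -ler_pdivlMr ?exprn_gt0// mulrAC.
apply: (@le_trans _ _ (M * expR (lam i * (t / 2)) * expR (- lam i * t))).
  by rewrite ler_wpM2r ?expR_ge0.
rewrite -mulrA -expRD ler_wpM2l ?(ltW M0)// /q -expRM_natl ler_expR.
by have := lam_ge i; nra.
Qed.

(* [E k.+1] is the limit of the difference quotients of [E k] in [t]. *)
Let A_deriv tau k : (forall t, 0 < t < tau -> A (E 0 t)) ->
  forall t, 0 < t < tau -> A (E k t).
Proof.
move=> AE; elim: k => [//|k IH] t /andP[t0 ttau].
apply: A_closed => e e0; have [C C0 HC] := summable_E k.+2 t0.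
(* The first bound keeps [t + eta] below [tau]. The second matches the quadratic remainder, which is
   at most [eta * E k.+2 t i] in mode [i]. *)
pose eta := Num.min ((tau - t) / 2) (e / C).
have eta0 : 0 < eta by rewrite lt_min; apply/andP; split; [lra|exact: divr_gt0].
have eta1 : eta <= (tau - t) / 2 by rewrite ge_min lexx.
have eta2 : eta <= e / C by rewrite ge_min lexx orbT.
exists (fun i => eta^-1 * E k t i + (- eta^-1) * E k (t + eta) i).
  by apply: A_comb; apply: IH; lra.
move=> N; apply: (@le_trans _ _ (eta * \sum_(i < N) E k.+2 t i)); last first.
  apply: (@le_trans _ _ (eta * C)); first by rewrite ler_wpM2l ?(ltW eta0).
  by rewrite -ler_pdivlMr.
rewrite mulr_sumr; apply: ler_sum => i _; rewrite /E.
have x0 : 0 <= lam i * eta by rewrite mulr_ge0 ?(ltW eta0).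
have /andP[h1 h2] := expRN_quadratic x0.
rewrite (_ : - lam i * (t + eta) = - lam i * t - lam i * eta); last ring.
rewrite expRD; set X := expR (- lam i * t); set Y := expR (- (lam i * eta)) in h1 h2 *.
rewrite (_ : _ - _ = eta^-1 * (lam i ^+ k * X * (Y - 1 + lam i * eta))); last first.
  by rewrite exprS; field; rewrite gt_eqF.
rewrite ger0_norm; last first.
  by rewrite mulr_ge0 ?invr_ge0 ?(ltW eta0)// mulr_ge0// mulr_ge0 ?expR_ge0 ?exprn_ge0.
rewrite -ler_pdivlMl ?invr_gt0// invrK.
apply: (@le_trans _ _ (lam i ^+ k * X * (lam i * eta) ^+ 2)).
  by rewrite ler_wpM2l// mulr_ge0 ?expR_ge0 ?exprn_ge0.
by rewrite le_eqVlt; apply/orP; left; apply/eqP; rewrite !exprS expr0; ring.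
Qed.

(* [E 0 t] is the sum of its Taylor series at [4 / 5 * t], in l^1. *)
Let A_extend tau : (forall t, 0 < t < tau -> A (E 0 t)) ->
  forall t, 0 < t < 5 / 4 * tau -> A (E 0 t).
Proof.
(* Here [t = t1 + x] and [2 * x = t1 / 2]: the loss [expR (2 * (lam i * x))] of the Taylor bound
   uses up only half of the decay [expR (- lam i * t1)]. *)
move=> AE t /andP[t0 ttau]; pose t1 := 4 / 5 * t; pose x := t / 5.
have t1tau : 0 < t1 < tau by rewrite /t1; lra.
apply: A_closed => e e0; pose q := expR (- (t1 / 2)).
have q1 : q < 1 by rewrite expR_lt1 oppr_lt0; lra.
have q1' : 0 < 1 - q by rewrite subr_gt0.
have [K Ke] : exists K, 2^-1 ^+ K < e * (1 - q) :> R.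
  have /cvgrPdist_lt/(_ (e * (1 - q))) : (2^-1 ^+ k : R) @[k --> \oo] --> (0 : R).
    by apply: cvg_expr; rewrite ger0_norm ?invr_ge0// invf_lt1 ?ltr1n.
  rewrite mulr_gt0// => /(_ isT)[k _ /(_ k (leqnn k))].
  by rewrite sub0r normrN ger0_norm ?exprn_ge0// => ke; exists k.
exists (fun i => \sum_(k <- iota 0 K) ((- x) ^+ k / k`!%:R) * E k t1 i).
  by apply: A_sum => k; exact: A_deriv t1tau.
move=> N; apply: (@le_trans _ _ (2^-1 ^+ K * \sum_(i < N) q ^+ i)); last first.
  apply: (@le_trans _ _ (2^-1 ^+ K * (1 - q)^-1)).
    by rewrite ler_wpM2l ?exprn_ge0// sum_geometric_le ?expR_ge0.
  by rewrite ler_pdivrMr// ltW.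
rewrite mulr_sumr; apply: ler_sum => i _; rewrite /E.
have y0 : 0 <= lam i * x by rewrite mulr_ge0// /x; lra.
have := expRN_taylor K y0; set T := \sum_(k < K) _ => hT.
rewrite (_ : _ - _ = expR (- lam i * t1) * (expR (- (lam i * x)) - T)); last first.
  rewrite expr0 mul1r mulrBr -expRD; congr (expR _ - _).
    by rewrite /t1 /x; lra.
  rewrite /T -[in LHS](subn0 K) -/(index_iota 0 K) big_mkord mulr_sumr.
  by apply: eq_bigr => k _; rewrite (_ : - (lam i * x) = - x * lam i) ?exprMn; ring.
rewrite normrM ger0_norm ?expR_ge0//.
apply: (@le_trans _ _ (expR (- lam i * t1) * (2^-1 ^+ K * expR (2 * (lam i * x))))).
  by rewrite ler_wpM2l ?expR_ge0.
rewrite mulrCA ler_wpM2l ?exprn_ge0// -expRD /q -expRM_natl ler_expR.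
by have := lam_ge i; rewrite /x /t1; nra.
Qed.

(* After the modes below [n] are subtracted, [expR (lam n * t) * E 0 t] tends to the
   unit vector [n] as [t] tends to infinity. *)
Lemma l1_closed_unit (delta : R) : 0 < delta ->
  (forall t, 0 < t < delta -> A (fun i => expR (- lam i * t))) ->
  forall n, A (fun i => (i == n)%:R).
Proof.
move=> delta0 Adelta.
have AE0 n : forall t, 0 < t < (5 / 4) ^+ n * delta -> A (E 0 t).
  elim: n => [|n IH] t.
    rewrite expr0 mul1r => /Adelta; apply: A_ext => i; by rewrite /E expr0 mul1r.
  by rewrite exprS -mulrA; exact: A_extend.
have AE t : 0 < t -> A (E 0 t).
  move=> t0; suff [n tn] : exists n, t < (5 / 4) ^+ n * delta.
    by apply: (AE0 n); rewrite t0.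
  have /cvgrPdist_lt/(_ (delta / t)) : ((4 / 5) ^+ k : R) @[k --> \oo] --> (0 : R).
    by apply: cvg_expr; rewrite ger0_norm; lra.
  rewrite divr_gt0// => /(_ isT)[k _ /(_ k (leqnn k))].
  rewrite sub0r normrN ger0_norm; last by rewrite exprn_ge0//; lra.
  rewrite ltr_pdivlMr// => h; exists k.
  have p0 : 0 < (5 / 4) ^+ k :> R by rewrite exprn_gt0//; lra.
  move: h; rewrite -(ltr_pM2l p0) mulrA -exprMn.
  by rewrite (_ : 5 / 4 * (4 / 5) = 1 :> R) ?expr1n ?mul1r//; field.
move=> n; elim/ltn_ind: n => n IH.
apply: A_closed => e e0.
(* With [t = c^-1], the inequality [expR t >= 1 + t] gives [q <= c]. As [q <= 1 / 2], the remaining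
   tail [q / (1 - q)] is at most [2 * q <= e]. *)
pose c := Num.min (e / 2) (1 / 2); have c0 : 0 < c by rewrite lt_min; lra.
have c1 : c <= e / 2 by rewrite ge_min lexx.
have c2 : c <= 1 / 2 by rewrite ge_min lexx orbT.
pose t := c^-1; have t0 : 0 < t by rewrite invr_gt0.
pose q := expR (- t).
have qc : q <= c.
  rewrite /q expRN /t -[leRHS]invrK lef_pV2 ?posrE ?expR_gt0 ?invr_gt0//.
  by have := expR_ge1Dx c^-1; lra.
have q0 : 0 < q by exact: expR_gt0.
(* [A_sum] asks for membership at every index, whereas the induction hypothesis covers only [m < n];
   the guards put the zero sequence elsewhere. *)
exists (fun i => expR (lam n * t) * E 0 t i + (- expR (lam n * t)) *
    \sum_(m <- iota 0 n) (if (m < n)%N then expR (- lam m * t) else 0) * (if (m < n)%N then (i == m)%:R else 0)).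
  apply: A_comb; first exact: AE.
  by apply: A_sum => m; case: (m < n)%N (IH m) => [/(_ isT)|].
move=> N.
have bound i : `|(i == n)%:R - (expR (lam n * t) * E 0 t i + (- expR (lam n * t)) *
    \sum_(m <- iota 0 n) (if (m < n)%N then expR (- lam m * t) else 0) * (if (m < n)%N then (i == m)%:R else 0))|
    <= (if (n < i)%N then q ^+ (i - n) else 0).
  have -> : \sum_(m <- iota 0 n) (if (m < n)%N then expR (- lam m * t) else 0) *
      (if (m < n)%N then (i == m)%:R else 0) = (if (i < n)%N then expR (- lam i * t) else 0).
    case: ifP => ni.
      rewrite (bigD1_seq i) ?iota_uniq ?mem_iota//= ni eqxx mulr1 big1 ?addr0//.
      by move=> m /negPf; rewrite eq_sym => ->; case: ifP => _; rewrite ?mulr0.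
    apply: big1_seq => m /=; rewrite mem_iota add0n => /= mn; rewrite mn.
    case: eqP => [im|_]; last by rewrite mulr0.
    by rewrite im mn in ni.
  rewrite /E expr0 mul1r; case: (ltngtP i n) => [ni|ni|->].
  - by rewrite [X in _ - X](_ : _ = 0) ?subr0 ?normr0//; ring.
  - rewrite mulr0 addr0 sub0r normrN -expRD ger0_norm ?expR_ge0// /q -expRM_natl ler_expR.
    by have := lam_gap (ltnW ni); nra.
  - rewrite mulr0 addr0 -expRD (_ : lam n * t + - lam n * t = 0); last ring.
    by rewrite expR0 subrr normr0.
apply: (@le_trans _ _ (\sum_(i < N) if (n < i)%N then q ^+ (i - n) else 0)).
  by apply: ler_sum => i _; exact: bound.
rewrite -big_mkcond/=.
(* The modes above [n] start with exponent [1], so one factor [q] comes out of the geometric sum; it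
   is what makes the bound small. *)
apply: (@le_trans _ _ (q * \sum_(i < N) q ^+ i)); last first.
  apply: (@le_trans _ _ (q * (1 - q)^-1)).
    rewrite ler_wpM2l ?(ltW q0)// sum_geometric_le ?(ltW q0)//; lra.
  by rewrite ler_pdivrMr; nra.
rewrite -(big_mkord (fun i => n < i)%N (fun i => q ^+ (i - n))).
rewrite -(big_mkord xpredT (fun i => q ^+ i)).
case: (leqP N n) => [Nn|nN].
  rewrite big_nat_cond big_pred0 ?mulr_ge0 ?sumr_ge0 ?(ltW q0)// => [k _|i]; first by rewrite exprn_ge0 ?(ltW q0).
  apply/negP => /andP[/andP[_ iN] ni].
  by have := leq_trans (ltn_trans ni iN) Nn; rewrite ltnn.
rewrite (big_cat_nat (leq0n n.+1) nN)/= big_nat_cond big_pred0 ?add0r; last first.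
  by move=> i; rewrite ltnS; case: (leqP i n); rewrite ?andbF ?andbT.
rewrite -[X in \sum_(X <= _ < _ | _) _]add0n big_addn mulr_sumr.
apply: (@le_trans _ _ (\sum_(0 <= i < N - n.+1) q * q ^+ i)).
  rewrite big_mkcond /=; apply: ler_sum_nat => i _; case: ifP => _.
    by rewrite addnS -addSn addnK exprS.
  by rewrite mulr_ge0 ?exprn_ge0 ?(ltW q0).
rewrite [leRHS](big_cat_nat (leq0n (N - n.+1)) (leq_subr _ _))/= lerDl.
by apply: sumr_ge0 => i _; rewrite mulr_ge0 ?exprn_ge0 ?ltW.
Qed.

End l1_closed.

Section one_sided.
Context (R : realType).

Lemma near_rightP (a : R) (P : R -> Prop) :
  (\forall t \near a^'+, P t) -> exists2 d : R, 0 < d & forall t, a < t < a + d -> P t.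
Proof.
move=> /nbhs_ballP[d /= d0 H]; exists d => // t /andP[at1 td].
by apply: H => //; rewrite /ball/= ltr0_norm; lra.
Qed.

Lemma near_leftP (a : R) (P : R -> Prop) :
  (\forall t \near a^'-, P t) -> exists2 d : R, 0 < d & forall t, a - d < t < a -> P t.
Proof.
move=> /nbhs_ballP[d /= d0 H]; exists d => // t /andP[at1 td].
by apply: H => //; rewrite /ball/= gtr0_norm; lra.
Qed.

End one_sided.

(** * Strongly continuous semigroups *)

Section semigroup.
Context (R : realType) (V : completeNormedModType R).

Lemma linear_continuous_bound (f : V -> V) : linear f -> continuous f ->
  exists2 C : R, 0 < C & forall x, `|f x| <= C * `|x|.
Proof.
move=> linf cf; pose F : {linear V -> V} := HB.pack f (GRing.isLinear.Build _ _ _ _ _ linf).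
have f0 : f 0 = 0 by exact: (linear0 F).
have fZ a x : f (a *: x) = a *: f x by exact: (linearZ_LR F).
have /cvgrPdist_le/(_ 1 ltr01) := cf 0.
rewrite f0 => /nbhs_normP[d /= d0 H].
exists (2 / d); first by rewrite divr_gt0.
move=> x; have [->|x0] := eqVneq x 0; first by rewrite f0 !normr0 mulr0.
have nx : 0 < `|x| by rewrite normr_gt0.
have [a Ea] : exists a, a = d / (2 * `|x|) by eexists.
have a0 : 0 < a by rewrite Ea divr_gt0// mulr_gt0.
have /= := H (a *: x); rewrite !sub0r !normrN fZ !normrZ gtr0_norm//.
have -> : a * `|x| = d / 2 by rewrite Ea; field; rewrite gt_eqF.
rewrite -ler_pdivlMl// => /(_ _)/le_trans; apply; first lra.
by rewrite Ea mulr1 invf_div mulrAC.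
Qed.

Variable S : R -> V -> V.
Hypothesis S_semigroup : C0_semigroup S.

Lemma semigroup_linear t : 0 <= t -> linear (S t).
Proof. by have [H _ _ _] := S_semigroup; move=> /H[]. Qed.

Lemma semigroup0 x : S 0 x = x.
Proof. by have [_ H _ _] := S_semigroup. Qed.

Lemma semigroupD s t x : 0 <= s -> 0 <= t -> S (s + t) x = S s (S t x).
Proof. by have [_ _ H _] := S_semigroup; exact: H. Qed.

Section pointwise.
Variables (t : R) (t0 : 0 <= t).
Let Lt : {linear V -> V} := HB.pack (S t) (GRing.isLinear.Build _ _ _ _ _ (semigroup_linear t0)).
Lemma semigroupZ a x : S t (a *: x) = a *: S t x. Proof. exact: (linearZ_LR Lt). Qed.
Lemma semigroup_add x y : S t (x + y) = S t x + S t y. Proof. exact: (linearD Lt). Qed.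
Lemma semigroup_sub x y : S t (x - y) = S t x - S t y. Proof. exact: (linearB Lt). Qed.
Lemma semigroup_zero : S t 0 = 0. Proof. exact: (linear0 Lt). Qed.
Lemma semigroup_sum (I : Type) (r : seq I) (P : pred I) (F : I -> V) :
  S t (\sum_(i <- r | P i) F i) = \sum_(i <- r | P i) S t (F i).
Proof. exact: (linear_sum Lt). Qed.
End pointwise.

(** Otherwise there are times [t n <= n.+1%:R^-1] at which the operator norm exceeds [n.+1]. Strong
    continuity at [0] makes these operators pointwise bounded, which contradicts
    Banach-Steinhaus. *)
Lemma semigroup_bound_near0 : exists C d : R, [/\ 1 <= C, 0 < d &
  forall t x, 0 <= t <= d -> `|S t x| <= C * `|x|].
Proof.
apply: contrapT => noC.
have bad (n : nat) : exists tx : R * V, [/\ 0 <= tx.1, tx.1 <= n.+1%:R^-1 &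
    n.+1%:R * `|tx.2| < `|S tx.1 tx.2|].
  apply: contrapT => nobad; apply: noC; exists n.+1%:R, n.+1%:R^-1; split => //.
    by rewrite ler1n.
  move=> t x /andP[t0 t1]; rewrite leNgt; apply/negP => h.
  by apply: nobad; exists (t, x).
have [tx Htx] := choice bad.
have [] := @Banach_Steinhauss R V V [set S (tx n).1 | n in setT] _ _ 1.
- move=> _ [n _ <-]; have [t0 _ _] := Htx n.
  have [H _ _ _] := S_semigroup; have [linS cS] := H _ t0.
  split => // r; have [C C0 HC] := linear_continuous_bound linS cS.
  by exists (C * r) => x xr; apply: le_trans (HC x) _; rewrite ler_wpM2l// ltW.
- move=> x; have [_ _ _ H] := S_semigroup.
  have /cvgrPdist_le/(_ 1 ltr01) := H x; move=> /near_rightP[d d0 Hd].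
  have [N Nd] : exists N : nat, N.+1%:R^-1 < d.
    exists (Num.truncn d^-1); rewrite -[ltRHS]invrK ltf_pV2 ?posrE ?invr_gt0//.
    exact: truncnS_gt.
  (* From index [N] on the times are so small that the orbit of [x] stays within distance [1] of
     [x]; the sum takes care of the finitely many earlier indices. *)
  exists (`|x| + 1 + \sum_(i < N) `|S (tx i).1 x|) => _ [n _ <-].
  have [nN|Nn] := ltnP n N.
    rewrite (bigD1 (Ordinal nN))//=.
    have : 0 <= \sum_(i < N | i != Ordinal nN) `|S (tx i).1 x| by exact: sumr_ge0.
    have := normr_ge0 x; lra.
  have [t0 t1 _] := Htx n.
  have : 0 <= \sum_(i < N) `|S (tx i).1 x| by exact: sumr_ge0.
  move: t0; rewrite le_eqVlt => /predU1P[<-|t0]; first by rewrite semigroup0; lra.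
  have : `|x - S (tx n).1 x| <= 1.
    apply: Hd; rewrite t0 add0r; apply: le_lt_trans t1 _; apply: le_lt_trans Nd.
    by rewrite lef_pV2 ?posrE ?ltr0n// ler_nat.
  have : `|S (tx n).1 x| <= `|x| + `|x - S (tx n).1 x|.
    by rewrite -{1}(subKr x (S (tx n).1 x)); exact: ler_normB.
  lra.
move=> M HM; pose n := Num.truncn M.
have Mn : M < n.+1%:R by exact: truncnS_gt.
have [t0 _] := Htx n; set x := (tx n).2.
have [->|x0] := eqVneq x 0.
  by rewrite semigroup_zero// normr0 mulr0 ltxx.
have nx : 0 < `|x| by rewrite normr_gt0.
have := HM (S (tx n).1); move=> /(_ (ex_intro2 _ _ n I erefl) (`|x|^-1 *: x)).
rewrite normrZ normfV normr_id mulVf ?gt_eqF// lexx => /(_ isT).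
rewrite semigroupZ// normrZ normfV normr_id ler_pdivrMl// => h1 h2.
by have := lt_le_trans h2 h1; rewrite mulrC ltr_pM2l// => /(lt_trans Mn); rewrite ltxx.
Qed.

Lemma semigroup_bound (T : R) : exists2 C : R, 1 <= C &
  forall t x, 0 <= t <= T -> `|S t x| <= C * `|x|.
Proof.
have [C [d [C1 d0 HC]]] := semigroup_bound_near0.
have C0 : 0 < C by lra.
have H (n : nat) t x : 0 <= t <= n%:R * d -> `|S t x| <= C ^+ n * `|x|.
  elim: n t x => [|n IH] t x.
    rewrite mul0r expr0 mul1r => tt; have -> : t = 0 by lra.
    by rewrite semigroup0.
  rewrite -natr1 mulrDl mul1r => /andP[t0 td].
  have [tn|tn] := leP t (n%:R * d).
    apply: le_trans (IH _ _ _) _; first by rewrite t0.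
    by rewrite ler_wpM2r// exprS ler_peMl// exprn_ge0// ltW.
  have nd : 0 <= n%:R * d by rewrite mulr_ge0// ltW.
  rewrite -(subrK (n%:R * d) t) semigroupD//; last by lra.
  apply: le_trans (HC _ _ _) _; first by lra.
  rewrite exprS -mulrA ler_wpM2l ?(ltW C0)//; apply: IH; rewrite nd lexx//.
pose n := Num.truncn (T / d); exists (C ^+ n.+1); first exact: exprn_ege1.
move=> t x /andP[t0 tT]; apply: H; rewrite t0 /=; apply: le_trans tT _.
by rewrite -ler_pdivrMr// ltW// truncnS_gt.
Qed.

(** For [a < b] the semigroup law gives [S b x - S a x = S a (S (b - a) x - x)]. Taking the smaller
    of the two times as [a] reduces continuity on both sides to right continuity at [0]. *)
Lemma semigroup_continuous x t (e : R) : 0 <= t -> 0 < e ->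
  exists2 d : R, 0 < d & forall t', 0 <= t' -> `|t' - t| < d -> `|S t' x - S t x| < e.
Proof.
move=> t0 e0; have [C C1 HC] := semigroup_bound (t + 1).
have C0 : 0 < C by lra.
have [_ _ _ H] := S_semigroup.
have eC : 0 < e / C by rewrite divr_gt0.
have /cvgrPdist_lt/(_ _ eC) := H x; move=> /near_rightP[d d0 Hd].
have main a b : 0 <= a -> a < b -> b < a + d -> a <= t + 1 -> `|S b x - S a x| < e.
  move=> a0 ab bd at1; have -> : S b x = S a (S (b - a) x).
    rewrite -semigroupD//; last by lra.
    by congr (S _ x); ring.
  rewrite -semigroup_sub//; apply: le_lt_trans (HC _ _ _) _; first by rewrite a0.
  rewrite mulrC -ltr_pdivlMr// distrC; apply: Hd; lra.
exists (Num.min d 1); first by rewrite lt_min d0 ltr01.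
move=> t' t'0; rewrite lt_min => /andP[td t1].
case: (ltgtP t' t) => [tt|tt|->]; last by rewrite subrr normr0.
  rewrite distrC; move: td; rewrite ltr0_norm ?subr_lt0// => td.
  by apply: main => //; lra.
move: td; rewrite gtr0_norm ?subr_gt0// => td.
by apply: main => //; lra.
Qed.

(** Only a right derivative at [0] is given. It makes [expR (lam * h) *: S h x] differ from [x] by
    [o(h)]; adding up [n] such errors along steps of length [t / n] shows that
    [expR (lam * t) *: S t x] equals [x]. *)
Lemma semigroup_eigenvector (lam : R) x : 0 <= lam -> generator S x (- (lam *: x)) ->
  forall t, 0 <= t -> S t x = expR (- lam * t) *: x.
Proof.
move=> lam0 gen t; rewrite le_eqVlt => /predU1P[<-|t0].
  by rewrite semigroup0 mulr0 expR0 scale1r.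
have [C C1 HC] := semigroup_bound t.
pose M := expR (lam * t) * C; have M0 : 0 < M by rewrite mulr_gt0 ?expR_gt0//; lra.
suff H : expR (lam * t) *: S t x = x.
  by rewrite -[in RHS]H scalerA -expRD mulNr addNr expR0 scale1r.
have step (e : R) : 0 < e -> exists2 d : R, 0 < d & forall h, 0 < h < d ->
    `|expR (lam * h) *: S h x - x| <= e * h.
  move=> e0; pose K := expR lam; have K0 : 0 < K by exact: expR_gt0.
  have eK : 0 < e / (2 * K) by rewrite divr_gt0// mulr_gt0.
  have /cvgrPdist_le/(_ _ eK)/near_rightP[d d0 Hd] := gen.
  pose L := K * lam ^+ 2 * `|x| + 1.
  have L0 : 0 < L by rewrite ltr_wpDl// !mulr_ge0// ?exprn_ge0 ?(ltW K0).
  exists (Num.min d (Num.min 1 (e / (2 * L)))).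
    by rewrite !lt_min d0 ltr01 divr_gt0// mulr_gt0.
  move=> h /andP[h0]; rewrite !lt_min => /andP[hd /andP[h1 he]].
  have eh : expR (lam * h) <= K by rewrite ler_expR; nra.
  have y0 : 0 <= lam * h by rewrite mulr_ge0// ltW.
  have /andP[q0 q1] := expRN_quadratic y0.
  have eE : expR (lam * h) * expR (- (lam * h)) = 1 by rewrite -expRD subrr expR0.
  set a := expR (lam * h) in eh eE *; set E := expR (- (lam * h)) in q0 q1 eE *.
  have a0 : 0 <= a by exact: expR_ge0.
  (* Uses [a * E = 1]. The first term is controlled by the generator, the second is the quadratic
     remainder of the exponential. *)
  rewrite (_ : _ - x = a *: ((S h x - x) + (lam * h) *: x) -
      (a * (E - 1 + lam * h)) *: x); last first.
    rewrite scalerDr scalerBr scalerA -!addrA; congr (_ + _).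
    rewrite -!scaleNr -!scalerDl -[LHS]scaleN1r; congr (_ *: _).
    by rewrite -[in LHS]eE -[X in _ + (_ + X)]mulr_algl scaler1; ring.
  apply: le_trans (ler_normB _ _) _; rewrite !normrZ !ger0_norm ?mulr_ge0//.
  have b1 : `|(S h x - x) + (lam * h) *: x| <= e / (2 * K) * h.
    have hh : 0 < h < 0 + d by rewrite h0 add0r.
    have := Hd _ hh; rewrite -(ler_pM2r h0); apply: le_trans.
    have nh (w : V) : `|w| * h = `|h *: w| by rewrite normrZ gtr0_norm// mulrC.
    rewrite nh scalerBr scalerA divff ?gt_eqF// scale1r.
    by rewrite -[leRHS]normrN opprB scalerN opprK scalerA (mulrC lam).
  have b2 : a * `|(S h x - x) + (lam * h) *: x| <= e / 2 * h.
    apply: (@le_trans _ _ (K * (e / (2 * K) * h))); first exact: ler_pM.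
    by rewrite le_eqVlt; apply/orP; left; apply/eqP; field; rewrite gt_eqF.
  have b3 : a * (E - 1 + lam * h) * `|x| <= L * h ^+ 2.
    apply: (@le_trans _ _ (K * (lam * h) ^+ 2 * `|x|)).
      by rewrite ler_wpM2r// ler_pM.
    rewrite exprMn /L mulrDl mul1r mulrA -[X in X <= _]mulrAC lerDl.
    by rewrite exprn_ge0// ltW.
  have b4 : L * h ^+ 2 <= e / 2 * h.
    rewrite expr2 mulrA ler_pM2r//; move: he; rewrite ltr_pdivlMr ?mulr_gt0// => he.
    by lra.
  lra.
apply/eqP; rewrite -subr_eq0 -normr_le0; apply/ler_addgt0Pl => e e0.
rewrite addr0.
(* Each of the [n] steps costs at most [M * (e / (M * t)) * h = e / n%:R]. *)
have et : 0 < e / (M * t) by rewrite divr_gt0// mulr_gt0.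
have [d d0 Hd] := step _ et.
pose n := (Num.truncn (t / d)).+1; pose h := t / n%:R.
have n0 : 0 < n%:R :> R by rewrite ltr0n.
have h0 : 0 < h by rewrite divr_gt0.
have hd : h < d.
  by rewrite ltr_pdivrMr// mulrC -ltr_pdivrMr// truncnS_gt.
have bound (j : nat) : (j <= n)%N ->
    `|expR (lam * (j%:R * h)) *: S (j%:R * h) x - x| <= j%:R * (e / n%:R).
  elim: j => [_|j IH jn].
    by rewrite !mul0r mulr0 expR0 scale1r semigroup0 subrr normr0.
  have jh0 : 0 <= j%:R * h by rewrite mulr_ge0// ltW.
  have jht : j%:R * h <= t.
    by rewrite /h mulrA ler_pdivrMr// mulrC ler_wpM2l ?(ltW t0)// ler_nat ltnW.
  rewrite -natr1 mulrDl mul1r semigroupD ?(ltW h0)//.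
  rewrite (_ : _ - x = expR (lam * (j%:R * h)) *: S (j%:R * h) (expR (lam * h) *: S h x - x) +
     (expR (lam * (j%:R * h)) *: S (j%:R * h) x - x)); last first.
    rewrite semigroup_sub// semigroupZ// scalerBr scalerA addrA subrK.
    by rewrite mulrDr expRD.
  rewrite [leRHS]mulrDl mul1r [leRHS]addrC.
  apply: le_trans (ler_normD _ _) _; apply: lerD; last by apply: IH; exact: ltnW.
  rewrite normrZ ger0_norm ?expR_ge0//.
  apply: (@le_trans _ _ (expR (lam * t) * (C * (e / (M * t) * h)))).
    apply: ler_pM => //.
      by rewrite ler_expR ler_wpM2l.
    apply: le_trans (HC _ _ _) _; first by rewrite jh0.
    by rewrite ler_wpM2l ?Hd ?h0//; lra.
  rewrite mulrA -/M /h le_eqVlt; apply/orP; left; apply/eqP.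
  by field; rewrite !gt_eqF.
have := bound n (leqnn n); rewrite (_ : n%:R * h = t); last first.
  by rewrite /h mulrC divfK// gt_eqF.
by move/le_trans; apply; rewrite mulrC divfK ?gt_eqF.
Qed.

End semigroup.

(** * Totality of the sines *)

Section threshold.
Context (R : realType).

Lemma bernoulli_ineq (x : R) m : -1 <= x -> 1 + m%:R * x <= (1 + x) ^+ m.
Proof.
move=> x1; elim: m => [|m IH]; first by rewrite mul0r addr0 expr0.
have x0 : 0 <= 1 + x by lra.
rewrite exprS; apply: le_trans (ler_wpM2l x0 IH).
have := ler0n R m; rewrite -natr1; set k := m%:R => k0; nra.
Qed.

Lemma cvg_geometric0 (q : R) : 0 <= q -> q < 1 -> q ^+ n @[n --> \oo] --> (0 : R).
Proof. by move=> q0 q1; apply: cvg_expr; rewrite ger0_norm. Qed.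

(* [1 - u^n] raised to the power [theta^-n] tends to the indicator of [u < theta]. *)
Lemma indicator_polynomials (theta : R) : 0 < theta -> theta < 1 ->
  exists m : nat -> nat, forall u : R, 0 <= u <= 1 ->
  (u < theta -> (1 - u ^+ n) ^+ m n @[n --> \oo] --> (1 : R)) /\
  (theta < u -> (1 - u ^+ n) ^+ m n @[n --> \oo] --> (0 : R)).
Proof.
move=> t0 t1; exists (fun n => (Num.truncn (theta ^- n)).+1) => u /andP[u0 u1].
have tn n : 0 < theta ^- n by rewrite invr_gt0 exprn_gt0.
set m := fun n => (Num.truncn (theta ^- n)).+1.
have m_gt n : theta ^- n < (m n)%:R by exact: truncnS_gt.
have m_le n : (m n)%:R <= theta ^- n + 1.
  by rewrite -natr1 lerD2r truncn_le// ltW.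
have un1 n : u ^+ n <= 1 by rewrite exprn_ile1.
have un0 n : 0 <= u ^+ n by rewrite exprn_ge0.
split => [ut|tu].
  have ut1 : u / theta < 1 by rewrite ltr_pdivrMr// mul1r.
  have ut0 : 0 <= u / theta by rewrite divr_ge0// ltW.
  (* Bernoulli bounds the power below by [1 - m n * u ^+ n], and [m n <= theta ^- n + 1]. *)
  apply: (@squeeze_cvgr _ _ _ _ (fun n => 1 - ((u / theta) ^+ n + u ^+ n)) (cst 1)).
  - apply: nearW => n /=; apply/andP; split; last by rewrite exprn_ile1// ?subr_ge0// gerBl.
    apply: le_trans (@bernoulli_ineq (- u ^+ n) (m n) _); last by have := un1 n; lra.
    rewrite lerD2l mulrN lerN2; apply: le_trans (ler_wpM2r (un0 n) (m_le n)) _.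
    by rewrite expr_div_n mulrDl mul1r mulrC.
  - rewrite -[X in _ --> X]subr0; apply: cvgB; first exact: cvg_cst.
    rewrite -[X in _ --> X]addr0; apply: cvgD; apply: cvg_geometric0 => //.
    exact: lt_trans ut t1.
  - exact: cvg_cst.
have u_gt0 : 0 < u by exact: lt_trans tu.
apply: (@squeeze_cvgr _ _ _ _ (cst 0) (fun n => (theta / u) ^+ n)).
- apply: nearW => n /=; rewrite exprn_ge0 ?subr_ge0//=.
  have u'0 : 0 < 1 + u ^+ n by have := un0 n; lra.
  (* Above the threshold Bernoulli applies to the other factor: [(1 + u ^+ n) ^+ m n >= m n * u ^+ n
     >= (u / theta) ^+ n]. *)
  have : (1 - u ^+ n) ^+ m n * (1 + u ^+ n) ^+ m n <= 1.
    by rewrite -exprMn exprn_ile1//; have := un0 n; have := un1 n; nra.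
  rewrite -ler_pdivlMr ?exprn_gt0// mul1r => /le_trans; apply.
  rewrite expr_div_n -[leRHS]invrK invf_div lef_pV2 ?posrE ?exprn_gt0//; last first.
    by rewrite divr_gt0 ?exprn_gt0.
  apply: le_trans (@bernoulli_ineq (u ^+ n) (m n) _); last by have := un0 n; lra.
  apply: (@le_trans _ _ ((m n)%:R * u ^+ n)); last by rewrite lerDr.
  by rewrite mulrC ler_wpM2r// ltW.
- exact: cvg_cst.
- by apply: cvg_geometric0; [rewrite divr_ge0// ltW | rewrite ltr_pdivrMr// mul1r].
Qed.

End threshold.

Section sines_total.
Context (R : realType).
Local Notation mu := (leb_0pi R).
Local Notation mR := (measurableTypeR R).

(** The frequency is [n + 1], so every index is a nonzero Dirichlet eigenfunction. *)
Definition sine (n : nat) (x : R) : R := sin (n.+1%:R * x).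

Lemma sine_measurable n : measurable_fun [set: mR] (sine n).
Proof.
apply: (measurableT_comp (f := @sin R)).
  by apply: continuous_measurable_fun; exact: continuous_sin.
exact: measurable_funM.
Qed.

Lemma cos_measurable : measurable_fun [set: mR] (@cos R).
Proof. by apply: continuous_measurable_fun; exact: continuous_cos. Qed.

Lemma sine_le1 n x : `|sine n x| <= 1. Proof. exact: sin_max. Qed.

Lemma sine_in_L2 n : in_L2 (sine n).
Proof. exact: (in_L2_bounded (sine_measurable n) (sine_le1 n)). Qed.

Definition sine_L2 n : L2 R := to_L2 (sine n).

Lemma ae_interior : {ae mu, forall x : R, 0 < x < pi}.
Proof.
exists (~` `]0, pi[%classic); split.
- exact: measurableC.
- rewrite /leb_0pi /= /mrestr.
  have -> : ~` `]0%R, pi[ `&` `[0, pi] = [set 0] `|` [set pi] :> set R.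
    apply/seteqP; split => x /=; rewrite !in_itv /=.
      move=> [nx /andP[x0 x1]]; move/negP: nx; rewrite negb_and -!leNgt => /orP[h|h].
        by left; apply/eqP; rewrite eq_le h x0.
      by right; apply/eqP; rewrite eq_le h x1.
    by have p0 := ltW (pi_gt0 R); move=> [->|->]; rewrite ?lexx ?ltxx ?andbF /= ?p0; split.
  by apply: etrans (measureU0 _ _ _) _ => //; exact: lebesgue_measure_set1.
- by move=> x /=; rewrite in_itv.
Qed.

Lemma ae_neq (a : R) : {ae mu, forall x : R, x != a}.
Proof.
exists [set a]; split => //.
- rewrite /leb_0pi /= /mrestr; apply/eqP; rewrite eq_le measure_ge0 andbT.
  rewrite -[leRHS](lebesgue_measure_set1 a); apply: le_measure; rewrite ?inE //.
  exact: measurableI.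
- by move=> x /= /negP; rewrite negbK => /eqP.
Qed.

End sines_total.

Lemma L2_ae_comb (R : realType) (a b : R) (x y : L2 R) :
  {ae leb_0pi R, forall t, (a *: x + b *: y : L2 R) t = a * x t + b * y t}.
Proof.
apply: (ae_imp3 (L2_aeD (a *: x) (b *: y)) (L2_aeZ a x) (L2_aeZ b y)).
by move=> t -> -> ->.
Qed.


Section closed_subspace.
Import HBNNSimple.
Context (R : realType).
Local Notation mu := (leb_0pi R).
Local Notation mR := (measurableTypeR R).
Variable K : L2 R -> Prop.
Hypothesis K_comb : forall (a b : R) x y, K x -> K y -> K (a *: x + b *: y).
Hypothesis K_closed : forall x, (forall e : R, 0 < e -> exists2 y, K y & `|x - y| < e) -> K x.
Hypothesis K_sine : forall n, K (sine_L2 R n).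

Let KF (f : R -> R) := in_L2 f /\ K (to_L2 f).

Let KF_ae (f g : R -> R) : {ae mu, forall x, f x = g x} -> KF f -> KF g.
Proof.
move=> fg [fL Kf]; have fE : {ae mu, forall x, to_L2 f x = g x}.
  by apply: (ae_imp2 (to_L2E fL) fg) => x -> ->.
by split; [exists (to_L2 f) | rewrite (to_L2_eq fE)].
Qed.

Let KF_comb a b (f g : R -> R) : KF f -> KF g -> KF (fun x => a * f x + b * g x).
Proof.
move=> [fL Kf] [gL Kg].
have fE : {ae mu, forall x, (a *: to_L2 f + b *: to_L2 g : L2 R) x = a * f x + b * g x}.
  apply: (ae_imp3 (L2_ae_comb a b (to_L2 f) (to_L2 g)) (to_L2E fL) (to_L2E gL)).
  by move=> x -> -> ->.
split; first by eexists; exact: fE.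
by rewrite (to_L2_eq fE); exact: K_comb.
Qed.

Let KF_lim (f : nat -> R -> R) (g G : R -> R) : (forall n, measurable_fun [set: mR] (f n)) ->
  measurable_fun [set: mR] g -> in_L2 G ->
  {ae mu, forall x, f n x @[n --> \oo] --> g x} ->
  {ae mu, forall x, forall n, `|f n x| <= G x} -> (forall n, KF (f n)) -> KF g.
Proof.
move=> mf mg GL fg fG Kf; have [_ [gL cf]] := to_L2_dominated mf mg GL fg fG.
split => //; apply: K_closed => e e0.
move/cvgrPdist_lt : cf => /(_ _ e0)[n _ /(_ n (leqnn n)) h].
by exists (to_L2 (f n)) => //; have [] := Kf n.
Qed.

(* The product formula for sines makes this class stable under multiplication by
   [cos]; the polynomials of [indicator_polynomials] in [(1 - cos x) / 2] then give
   the indicators of rays, hence of all measurable sets. *)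
Let KC (g : R -> R) := [/\ measurable_fun [set: mR] g,
  exists M, forall x, `|g x| <= M & forall n, KF (fun x => sine n x * g x)].

Let KC_ext f g : f =1 g -> KC f -> KC g.
Proof. by move=> /funext ->. Qed.

Let KC_comb a b f g : KC f -> KC g -> KC (fun x => a * f x + b * g x).
Proof.
move=> [mf [M fM] Kf] [mg [N gN] Kg]; split.
- by apply: measurable_funD; apply: measurable_funM.
- exists (`|a| * M + `|b| * N) => x; apply: le_trans (ler_normD _ _) _.
  by rewrite !normrM lerD// ler_wpM2l.
- by move=> n; apply: KF_ae (KF_comb a b (Kf n) (Kg n)); apply: aeW => x; ring.
Qed.

Let KC_cos f : KC f -> KC (fun x => cos x * f x).
Proof.
move=> [mf [M fM] Kf]; split.
- by apply: measurable_funM => //; exact: cos_measurable.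
- exists M => x; rewrite normrM; apply: le_trans (fM x).
  by rewrite ler_piMl// cos_max.
move=> [|n].
  (* At the lowest frequency the product formula produces [sin 0], which is not of the form
     [sine n]; only the term of frequency [2] remains. *)
  apply: KF_ae (KF_comb (1 / 2) 0 (Kf 1%N) (Kf 1%N)); apply: aeW => x.
  rewrite /sine; have -> : 1%:R * x = x by rewrite mul1r.
  have -> : 2%:R * x = x + x by ring.
  by rewrite sinD; field.
apply: KF_ae (KF_comb (1 / 2) (1 / 2) (Kf n.+2) (Kf n)); apply: aeW => x.
rewrite /sine; have -> : n.+3%:R * x = n.+2%:R * x + x by rewrite -[n.+3%:R]natr1; ring.
have -> : n.+1%:R * x = n.+2%:R * x - x by rewrite -[n.+2%:R]natr1; ring.
by rewrite sinD sinB; field.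
Qed.

Let KC_one : KC (cst 1).
Proof.
split; [exact: measurable_cst | by exists 1 => x; rewrite normr1|].
move=> n; apply: KF_ae (conj (sine_in_L2 R n) (K_sine n)).
by apply: aeW => x; rewrite mulr1.
Qed.

(** Increases from [0] to [1] on [[0, pi]], so that inside this interval [x < a] becomes
    [u x < u a]. *)
Let u (x : R) := (1 - cos x) / 2.

Let u01 x : 0 <= u x <= 1.
Proof. by rewrite /u; have := cos_geN1 x; have := cos_le1 x; lra. Qed.

Let KC_u f n : KC f -> KC (fun x => u x ^+ n * f x).
Proof.
move=> Kf; elim: n => [|n IH].
  by apply: KC_ext Kf => x; rewrite expr0 mul1r.
apply: KC_ext (KC_comb (1 / 2) (- (1 / 2)) IH (KC_cos IH)) => x.
by rewrite exprS /u; field.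
Qed.

Let KC_poly f n m : KC f -> KC (fun x => (1 - u x ^+ n) ^+ m * f x).
Proof.
move=> Kf; elim: m => [|m IH].
  by apply: KC_ext Kf => x; rewrite expr0 mul1r.
apply: KC_ext (KC_comb 1 (- 1) IH (KC_u n IH)) => x.
by rewrite exprS; ring.
Qed.

Let KC_lim (f : nat -> R -> R) (g : R -> R) M : (forall n, KC (f n)) -> (forall n x, `|f n x| <= M) ->
  measurable_fun [set: mR] g -> (forall x, `|g x| <= M) ->
  {ae mu, forall x, f n x @[n --> \oo] --> g x} -> KC g.
Proof.
move=> Kf fM mg gM fg; split => //; first by exists M.
move=> k; apply: (@KF_lim (fun n x => sine k x * f n x) _ (cst M)).
- by move=> n; apply: measurable_funM; [exact: sine_measurable | have [] := Kf n].
- by apply: measurable_funM => //; exact: sine_measurable.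
- by apply: (@in_L2_bounded _ _ `|M|) => // x.
- by apply: (ae_imp1 fg) => x h; apply: cvgM => //; exact: cvg_cst.
- apply: aeW => x n; rewrite normrM; apply: le_trans (fM n x).
  by rewrite ler_piMl// sine_le1.
- by move=> n; have [] := Kf n.
Qed.

Let KE (E : set mR) := measurable E /\ forall f, KC f -> KC (fun x => \1_E x * f x).

Let indicM (E : set mR) (f : R -> R) : measurable E -> measurable_fun [set: mR] f ->
  measurable_fun [set: mR] (fun x => \1_E x * f x).
Proof. by move=> mE mf; apply: measurable_funM. Qed.

Let indic_le (E : set mR) (f : R -> R) M : (forall x, `|f x| <= M) -> forall x, `|\1_E x * f x| <= M.
Proof.
move=> fM x; rewrite normrM indicE; apply: le_trans (fM x).
by rewrite ler_piMl//; case: (x \in E); rewrite ?normr1 ?normr0.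
Qed.

(** A ray whose endpoint lies outside []0, pi[] has indicator [0] or [1] almost everywhere.
    Otherwise the polynomials with threshold [u a] converge to the indicator except at [a], a null
    set. *)
Let KE_ray a : KE `]-oo, a[%classic.
Proof.
split; first exact: measurable_itv.
move=> f Kf; have [mf [M fM] _] := Kf.
have [a0|a0] := leP a 0.
  have [_ _ Kz] := KC_comb 0 0 Kf Kf; split; first exact: indicM.
    by exists M; exact: indic_le.
  move=> n; apply: KF_ae (Kz n); apply: (ae_imp1 (@ae_interior R)) => x /andP[x0 _].
  rewrite indicE memNset ?mul0r ?addr0//= in_itv/=; apply/negP; rewrite -leNgt.
  exact/ltW/(le_lt_trans a0 x0).
have [pia|api] := leP pi a.
  have [_ _ Kz] := KC_comb 1 0 Kf Kf; split; first exact: indicM.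
    by exists M; exact: indic_le.
  move=> n; apply: KF_ae (Kz n); apply: (ae_imp1 (@ae_interior R)) => x /andP[_ x1].
  by rewrite indicE mem_set ?mul1r ?mul0r ?addr0//= in_itv/=; exact: lt_le_trans pia.
have a_itv : a \in `[0, pi] by rewrite in_itv/= !ltW.
have pi0 := pi_gt0 R.
have ca : cos a < 1 by rewrite -cos0 ltr_cos// in_itv/= lexx ltW.
have ca' : -1 < cos a by rewrite -cospi ltr_cos// in_itv/= lexx ltW.
have [m Hm] : exists m : nat -> nat, forall v : R, 0 <= v <= 1 ->
  (v < u a -> (1 - v ^+ n) ^+ m n @[n --> \oo] --> (1 : R)) /\
  (u a < v -> (1 - v ^+ n) ^+ m n @[n --> \oo] --> (0 : R)).
  by apply: indicator_polynomials; rewrite /u; lra.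
apply: (@KC_lim (fun n x => (1 - u x ^+ n) ^+ m n * f x) _ M).
- by move=> n; exact: KC_poly.
- move=> n x; rewrite normrM; apply: le_trans (fM x); rewrite ler_piMl//.
  have /andP[u0 u1] := u01 x; have un := exprn_ile1 n u0 u1; have un0 := exprn_ge0 n u0.
  by rewrite ger0_norm ?exprn_ge0 ?exprn_ile1 ?subr_ge0// gerBl.
- exact: indicM.
- exact: indic_le.
- apply: (ae_imp2 (@ae_interior R) (ae_neq a)) => x /andP[x0 x1] xa.
  have x_itv : x \in `[0, pi] by rewrite in_itv/= !ltW.
  have [H1 H0] := Hm (u x) (u01 x).
  apply: cvgM; last exact: cvg_cst.
  have [lt_xa|lt_ax|e] := ltgtP x a; last by rewrite e eqxx in xa.
    rewrite indicE mem_set/= ?in_itv//; apply: H1.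
    by have : cos a < cos x; [rewrite ltr_cos | rewrite /u; lra].
  rewrite indicE memNset/= ?in_itv/= ?ltNge; last by rewrite (ltW lt_ax).
  apply: H0.
  by have : cos x < cos a; [rewrite ltr_cos | rewrite /u; lra].
Qed.

(** The sets of [KE] form a sigma-algebra containing the rays. Intersections are available because
    [KE] asks for stability under multiplication of all of [KC]; countable unions are limits of
    finite ones. *)
Let KE_measurable (E : set mR) : measurable E -> KE E.
Proof.
have KE_I A B : KE A -> KE B -> KE (A `&` B).
  move=> [mA KA] [mB KB]; split; first exact: measurableI.
  move=> f Kf; apply: KC_ext (KA _ (KB _ Kf)) => x.
  by rewrite indicI/= mulrA.
have KE_C A : KE A -> KE (~` A).
  move=> [mA KA]; split; first exact: measurableC.
  move=> f Kf; apply: KC_ext (KC_comb 1 (-1) Kf (KA _ Kf)) => x.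
  by rewrite !indicE in_setC; case: (x \in A) => /=; ring.
rewrite -[measurable E]/(((R.-ocitv).-measurable).-sigma.-measurable E).
rewrite RGenInftyO.measurableE; apply: smallest_sub => [|_ [a ->]]; last exact: KE_ray.
have KE_0 : KE set0.
  have [m0 _] := KE_ray 0; split; first exact: measurable0.
  move=> f Kf; apply: KC_ext (KC_comb 0 0 Kf Kf) => x.
  by rewrite indic0 !mul0r addr0.
split => //; first by move=> A; rewrite setTD; exact: KE_C.
move=> A KA.
have KEn n : KE (\bigcup_(k in `I_n) A k).
  elim: n => [|n IH]; first by rewrite II0 bigcup_set0.
  rewrite IIS bigcup_setU bigcup_set1 -[_ `|` _]setCK setCU.
  by apply: (KE_C); apply: KE_I; exact: KE_C.
have mA : measurable (\bigcup_k A k : set mR).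
  by apply: bigcup_measurable => k _; have [] := KA k.
split => // f Kf; have [mf [M fM] _] := Kf.
apply: (@KC_lim (fun n x => \1_(\bigcup_(k in `I_n) A k) x * f x) _ M).
- by move=> n; have [_] := KEn n; exact.
- by move=> n; exact: indic_le.
- exact: indicM.
- exact: indic_le.
- apply: aeW => x; apply: cvgM; last exact: cvg_cst.
  have [[k _ Akx]|nA] := pselect ((\bigcup_k A k) x).
    rewrite indicE mem_set; last by exists k.
    apply: cvg_near_cst; near=> n; rewrite indicE mem_set//; exists k => //=.
    by near: n; exact: nbhs_infty_gt.
  rewrite indicE memNset//; apply: cvg_near_cst; apply: nearW => n.
  by rewrite indicE memNset// => -[k _ Ak]; apply: nA; exists k.
Unshelve. all: by end_near. Qed.

Let KC_simple (g : {nnsfun mR >-> R}) : KC g.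
Proof.
have KC_indic (E : set mR) : measurable E -> KC (\1_E : mR -> R).
  move=> mE; apply: KC_ext ((KE_measurable mE).2 _ KC_one) => x.
  by rewrite mulr1.
have KC_sum (s : seq R) : KC (fun x => \sum_(y <- s) y * \1_(g @^-1` [set y]) x).
  elim: s => [|y s IH].
    apply: KC_ext (KC_comb 0 0 KC_one KC_one) => x.
    by rewrite big_nil !mul0r addr0.
  have Ky := KC_indic _ (measurable_sfunP g (measurable_set1 y)).
  by apply: KC_ext (KC_comb y 1 Ky IH) => x; rewrite big_cons mul1r.
apply: KC_ext (KC_sum (finmap.enum_fset (fset_set (range g)))) => x.
by rewrite [RHS]fimfunE fsbig_finite//; exact: fimfunP.
Qed.

(** On []0, pi[] the quotient of [w] by [sin] is an increasing limit of simple functions [g k]. Each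
    [sin x * g k x] is of the form handled by [KC], and [w <= |z|] dominates the sequence even where
    the quotient blows up near the endpoints. *)
Let KF_nonneg (z : L2 R) (w : R -> R) : measurable_fun [set: mR] w ->
  (forall x, 0 <= w x <= `|z x|) -> KF w.
Proof.
move=> mw wz; pose f x := if 0 < sin x then w x * (sin x)^-1 else 0.
have csin : continuous (@sin R) by exact: continuous_sin.
have mf : measurable_fun [set: mR] (EFin \o f).
  apply/measurable_EFinP; apply: measurable_fun_if => //.
  - apply: measurable_fun_ltr => //.
    exact: continuous_measurable_fun.
  - apply: measurable_funM; first exact: measurable_funS mw.
    rewrite setTI; apply: open_continuous_measurable_fun.
      rewrite (_ : _ @^-1` _ = sin @^-1` [set x | 0 < x]) //.
      by apply: open_comp; [move=> x _; exact: csin | exact: open_gt].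
    move=> x; rewrite inE /= => s0.
    by apply: continuousV; [rewrite gt_eqF | exact: csin].
have f0 x : [set: mR] x -> (0 <= (f x)%:E)%E.
  move=> _; rewrite lee_fin /f; case: ifPn => // s0.
  by have /andP[w0 _] := wz x; rewrite divr_ge0// ltW.
have [g [g_nd gf]] := approximation measurableT mf f0.
have gR x : g k x @[k --> \oo] --> f x.
  exact: (fine_cvg (gf x I)).
have g_le k x : g k x <= f x.
  have gnd : {homo (fun k => g k x) : n m / (n <= m)%N >-> n <= m}.
    by move=> n m /g_nd /lefP; exact.
  rewrite -(cvg_lim _ (gR x))//; apply: nondecreasing_cvgn_le => //.
  by apply/cvg_ex; exists (f x).
have zL : in_L2 (fun x => `|z x|).
  apply: in_L2I; first by apply: measurableT_comp => //; exact: L2_measurable.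
  by under eq_integral do rewrite real_normK ?num_real//; rewrite -L2_normE ltry.
apply: (@KF_lim (fun k x => sine 0 x * g k x) w _ _ _ zL) => //.
- by move=> n; apply: measurable_funM => //; exact: sine_measurable.
- apply: (ae_imp1 (@ae_interior R)) => x x0pi; have s0 := sin_gt0_pi x0pi.
  have -> : w x = sine 0 x * f x.
    by rewrite /sine mul1r /f s0 mulrCA divff ?mulr1// gt_eqF.
  by apply: cvgM => //; exact: cvg_cst.
- apply: (ae_imp1 (@ae_interior R)) => x x0pi n; have s0 := sin_gt0_pi x0pi.
  rewrite /sine mul1r normrM (gtr0_norm s0) ger0_norm ?fun_ge0//.
  apply: (@le_trans _ _ (sin x * f x)); first by rewrite ler_wpM2l// ltW.
  rewrite /f s0 mulrCA divff ?mulr1 ?gt_eqF//.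
  by have /andP[] := wz x.
- by move=> k; have [_ _] := KC_simple (g k); exact.
Qed.

Lemma sines_total z : K z.
Proof.
have mz : measurable_fun [set: mR] (z : R -> R) := L2_measurable z.
have Kp : KF (fun x => Num.max (z x) 0).
  apply: (@KF_nonneg z); first exact: measurable_maxr.
  by move=> x; rewrite le_max lexx orbT ge_max ler_norm normr_ge0.
have Kn : KF (fun x => Num.max (- z x) 0).
  apply: (@KF_nonneg z); first by apply: measurable_maxr => //; exact: measurable_funN.
  by move=> x; rewrite le_max lexx orbT ge_max normr_ge0 andbT -normrN ler_norm.
have [_] := KF_comb 1 (-1) Kp Kn.
rewrite (@to_L2_eq _ _ z)//; apply: aeW => x.
by case: (leP (z x) 0) => h1; case: (leP (- z x) 0) => h2; lra.
Qed.

End closed_subspace.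

(** * Sine coefficients and the heat semigroup *)

Section sine_calculus.
Context (R : realType).

Lemma is_derive_sin_scale (c x : R) :
  is_derive x (1 : R) (fun y => sin (c * y)) (c * cos (c * x)).
Proof.
have d : is_derive x (1 : R) (fun y : R => c * y) c.
  have h : is_derive x (1 : R) (c \*: (id : R -> R)) (c *: (1 : R)) by exact: is_deriveZ.
  by rewrite -[X in is_derive _ _ _ X]mulr1.
rewrite mulrC; exact: (is_derive1_comp (f := @sin R) (g := fun y => c * y)).
Qed.

Lemma is_derive_cos_scale (c x : R) :
  is_derive x (1 : R) (fun y => cos (c * y)) (- (c * sin (c * x))).
Proof.
have d : is_derive x (1 : R) (fun y : R => c * y) c.
  have h : is_derive x (1 : R) (c \*: (id : R -> R)) (c *: (1 : R)) by exact: is_deriveZ.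
  by rewrite -[X in is_derive _ _ _ X]mulr1.
rewrite mulrC -mulNr; exact: (is_derive1_comp (f := @cos R) (g := fun y => c * y)).
Qed.

Lemma sin_natpi (k : nat) : sin (k%:R * pi) = 0 :> R.
Proof.
elim: k => [|k IH]; first by rewrite mul0r sin0.
by rewrite -natr1 mulrDl mul1r sinD sinpi IH mul0r mulr0 addr0.
Qed.

Lemma lipschitz_derive (p p' : R -> R) (C : R) :
  (forall x, is_derive x (1 : R) p (p' x)) -> (forall x, `|p' x| <= C) ->
  forall x y, `|p y - p x| <= C * `|y - x|.
Proof.
move=> dp pC.
have cp : continuous p.
  by move=> x; apply/differentiable_continuous/derivable1_diffP; have [] := dp x.
have main x y : x <= y -> `|p y - p x| <= C * `|y - x|.
  move=> xy; have [c _ ->] := MVT_segment xy (fun x _ => dp x) (continuous_subspaceT cp).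
  by rewrite normrM ler_wpM2r.
move=> x y; have [xy|yx] := leP x y; first exact: main.
by rewrite distrC (distrC y); apply: main; exact: ltW.
Qed.

Lemma lipschitz_abs_cont (a b C : R) (p : R -> R) : 0 < C ->
  (forall x y, `|p y - p x| <= C * `|y - x|) -> abs_cont a b p.
Proof.
move=> C0 pC e e0; exists (e / C); first exact: divr_gt0.
move=> n x y xy _ sd; apply: (@le_lt_trans _ _ (\sum_(i < n) C * (y i - x i))).
  apply: ler_sum => i _; apply: le_trans (pC _ _) _.
  by have [_ [h _]] := xy i; rewrite ger0_norm// subr_ge0.
by rewrite -mulr_sumr mulrC -ltr_pdivlMr.
Qed.

Lemma heat_op_sine (n : nat) :
  heat_op (sine_L2 R n) (n.+1%:R ^+ 2 *: sine_L2 R n).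
Proof.
set c : R := n.+1%:R.
have c0 : 0 < c by rewrite ltr0n.
exists (fun x => sin (c * x)), (fun x => c * cos (c * x)); split.
- exact: (to_L2E (sine_in_L2 R n)).
- split; last by apply: aeW => x; exact: is_derive_sin_scale.
  apply: (@lipschitz_abs_cont _ _ c) => //.
  apply: (lipschitz_derive (is_derive_sin_scale c)) => x.
  by rewrite normrM gtr0_norm// ler_piMr ?(ltW c0)// cos_max.
- have dq x : is_derive x (1 : R) (fun y => c * cos (c * y)) (- (c ^+ 2 * sin (c * x))).
    have h : is_derive x (1 : R) (c \*: (fun y : R => cos (c * y))) (c *: (- (c * sin (c * x)))).
      exact: is_deriveZ (is_derive_cos_scale c x).
    by rewrite expr2 -mulrA -mulrN.
  split.
    apply: (@lipschitz_abs_cont _ _ (c ^+ 2)); first exact: exprn_gt0.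
    apply: (lipschitz_derive dq) => x.
    rewrite normrN normrM ger0_norm ?exprn_ge0 ?(ltW c0)//.
    by rewrite ler_piMr ?exprn_ge0 ?(ltW c0)// sin_max.
  apply: (ae_imp2 (L2_aeZ (c ^+ 2) (sine_L2 R n)) (to_L2E (sine_in_L2 R n))).
  by move=> x -> ->; exact: dq.
- by rewrite mulr0 sin0; split => //; exact: sin_natpi.
Qed.

Lemma integral_cos_scale (k : nat) :
  (\int[@lebesgue_measure R]_(x in `[0%R, pi]) (cos (k%:R * x))%:E =
   (if k == 0%N then pi else 0)%:E)%E.
Proof.
case: k => [|k] /=.
  under eq_integral do rewrite mul0r cos0.
  by rewrite integral_cst//= lebesgue_measure_itv /= lte_fin pi_gt0 -EFinB subr0 mul1e.
set c : R := k.+1%:R; have c0 : c != 0 by rewrite pnatr_eq0.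
have dF x : is_derive x (1 : R) (fun y => c^-1 * sin (c * y)) (cos (c * x)).
  have h : is_derive x (1 : R) (c^-1 \*: (fun y : R => sin (c * y))) (c^-1 *: (c * cos (c * x))).
    exact: is_deriveZ (is_derive_sin_scale c x).
  by rewrite -[X in is_derive _ _ _ X](mulKf c0).
have cF : continuous (fun y => c^-1 * sin (c * y)).
  by move=> x; apply/differentiable_continuous/derivable1_diffP; have [] := dF x.
rewrite (@continuous_FTC2 _ _ (fun y => c^-1 * sin (c * y)) _ _ (pi_gt0 R)).
- by rewrite mulr0 sin0 (sin_natpi k.+1) -EFinB subrr.
- apply: continuous_subspaceT => x.
  by apply: differentiable_continuous; apply/derivable1_diffP; have [] := is_derive_cos_scale c x.
- split; first by move=> x _; have [] := dF x.
    by apply: cvg_at_right_filter; exact: cF.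
  by apply: cvg_at_left_filter; exact: cF.
- by move=> x _; rewrite derive1E; have [_ ->] := dF x.
Qed.

End sine_calculus.

(** * Sine coefficients and orthogonality *)

Section sine_coefficients.
Context (R : realType).
Local Notation mu := (leb_0pi R).
Local Notation mR := (measurableTypeR R).

Definition sine_coef (n : nat) (z : L2 R) : R := (\int[mu]_x (z x * sine n x))%R.

Lemma sine_product_measurable n z : 
  measurable_fun [set: mR] (fun x => (z : L2 R) x * sine n x).
Proof. by apply: measurable_funM; [exact: L2_measurable | exact: sine_measurable]. Qed.

(** From [|z x| <= z x ^+ 2 + 1]. This crude bound suffices: [sine_coef_le] makes it homogeneous by
    applying it to unit vectors. *)
Lemma le_integral_sine_product n (z : L2 R) :
  (\int[mu]_x `|(z x * sine n x)%:E| <= (`|z| ^+ 2 + pi)%:E)%E.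
Proof.
have -> : ((`|z| ^+ 2 + pi)%:E = \int[mu]_x ((z x ^+ 2)%:E + 1%:E))%E.
  rewrite ge0_integralD//.
  - by rewrite integral_cst//= mu_setT mul1e -L2_normE.
  - by move=> x _; rewrite lee_fin sqr_ge0.
  - exact: L2_measurable_sqr.
apply: ge0_le_integral => //.
- apply: measurableT_comp => //; apply/measurable_EFinP.
  exact: sine_product_measurable.
- by apply: emeasurable_funD => //; exact: L2_measurable_sqr.
- move=> x _; rewrite -EFinD lee_fin normrM.
  apply: (@le_trans _ _ `|z x|); first by rewrite ler_piMr// sine_le1.
  by have := real_normK (num_real (z x)); have := normr_ge0 (z x); nra.
Qed.

Lemma sine_product_integrable n (z : L2 R) :
  mu.-integrable setT (EFin \o (fun x => z x * sine n x)).
Proof.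
apply/integrableP; split; first by apply/measurable_EFinP; exact: sine_product_measurable.
exact: le_lt_trans (le_integral_sine_product n z) (ltry _).
Qed.

Lemma sine_coef_ae n (z : L2 R) (f : R -> R) : measurable_fun [set: mR] f ->
  {ae mu, forall x, z x = f x} -> sine_coef n z = (\int[mu]_x (f x * sine n x))%R.
Proof.
move=> mf zf; congr fine; apply: ae_eq_integral => //.
- by apply/measurable_EFinP; exact: sine_product_measurable.
- by apply/measurable_EFinP; apply: measurable_funM => //; exact: sine_measurable.
- by apply: (ae_imp1 zf) => x -> .
Qed.

Lemma sine_coef_comb n (a b : R) (x y : L2 R) :
  sine_coef n (a *: x + b *: y) = a * sine_coef n x + b * sine_coef n y.
Proof.
have iP z := sine_product_integrable n z.
have iZ c z : mu.-integrable setT (EFin \o (fun t => c * ((z : L2 R) t * sine n t))).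
  exact: (integrableZl measurableT c (iP z)).
rewrite (@sine_coef_ae _ _ (fun t => a * x t + b * y t)); last 2 first.
- by apply: measurable_funD; apply: measurable_funM => //; exact: L2_measurable.
- exact: L2_ae_comb.
rewrite /sine_coef -(RintegralZl a measurableT (iP x)) -(RintegralZl b measurableT (iP y)).
rewrite -(RintegralD measurableT (iZ a x) (iZ b y)).
by apply: eq_Rintegral => t _; rewrite mulrDl !mulrA.
Qed.

Lemma sine_coefZ n a z : sine_coef n (a *: z) = a * sine_coef n z.
Proof. by have := sine_coef_comb n a 0 z z; rewrite scale0r addr0 mul0r addr0. Qed.

Lemma sine_coef_le n z : `|sine_coef n z| <= (1 + pi) * `|z|.
Proof.
have unit (w : L2 R) : `|w| = 1 -> `|sine_coef n w| <= 1 + pi.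
  move=> w1; apply: le_trans (le_normr_Rintegral _ (sine_product_integrable n w)) _ => //.
  rewrite -lee_fin fineK; last first.
    rewrite ge0_fin_numE; last exact: integral_ge0.
    exact: le_lt_trans (le_integral_sine_product n w) (ltry _).
  by apply: le_trans (le_integral_sine_product n w) _; rewrite w1 expr1n.
have [->|z0] := eqVneq z 0.
  by rewrite -(scale0r (0 : L2 R)) sine_coefZ mul0r normr0 scale0r normr0 mulr0.
have nz : 0 < `|z| by rewrite normr_gt0.
have := unit (`|z|^-1 *: z); rewrite normrZ normfV normr_id mulVf ?gt_eqF// => /(_ erefl).
by rewrite sine_coefZ normrM normfV normr_id mulrC ler_pdivrMr.
Qed.

Lemma sine_orthogonal m n :
  sine_coef n (sine_L2 R m) = if m == n then pi / 2 else 0.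
Proof.
rewrite (sine_coef_ae n (@sine_measurable R m) (to_L2E (sine_in_L2 R m))).
rewrite /Rintegral integral_leb_0pi; last first.
  by apply/measurable_EFinP; apply: measurable_funM; exact: sine_measurable.
(* [d] is the distance of [m] and [n]. The sum frequency [m + n + 2] never vanishes, so only [d = 0]
   contributes to the integral. *)
pose d := (maxn m n - minn m n)%N.
have E x : sine m x * sine n x = 2^-1 * cos (d%:R * x) - 2^-1 * cos ((m + n).+2%:R * x).
  have -> : cos (d%:R * x) = cos (m.+1%:R * x - n.+1%:R * x).
    rewrite -mulrBl; case: (leqP m n) => mn.
      have -> : d = (n - m)%N by rewrite /d; lia.
      rewrite natrB// -cosN -mulNr opprB; congr (cos (_ * _)).
      by rewrite -[m.+1%:R]natr1 -[n.+1%:R]natr1; ring.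
    have -> : d = (m - n)%N by rewrite /d; lia.
    rewrite natrB ?(ltnW mn)//; congr (cos (_ * _)).
    by rewrite -[m.+1%:R]natr1 -[n.+1%:R]natr1; ring.
  have -> : (m + n).+2%:R * x = m.+1%:R * x + n.+1%:R * x.
    by rewrite -mulrDl -natrD addSn addnS.
  by rewrite cosB cosD /sine; field.
have ic (k : nat) : lebesgue_measure.-integrable `[0%R, pi] (fun x => (cos (k%:R * x))%:E).
  apply: continuous_compact_integrable; first exact: segment_compact.
  apply: continuous_subspaceT => x; apply: differentiable_continuous.
  by apply/derivable1_diffP; have [] := is_derive_cos_scale k%:R x.
under eq_integral do rewrite E EFinB !EFinM.
rewrite integralB//; try by apply: integrableZl => //; exact: ic.
rewrite !integralZl//; try exact: ic.
rewrite !integral_cos_scale mule0 sube0.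
have -> : (d == 0)%N = (m == n).
  rewrite /d; case: (ltngtP m n) => mn; rewrite ?subnn//; last by apply/eqP; lia.
  by apply/eqP; lia.
by case: ifP => _ /=; rewrite ?mulr0// mulrC.
Qed.

End sine_coefficients.

(** * From coefficient sequences to vectors *)

Section spectral_projection.
Context (R : realType) (V : completeNormedModType R).
Variables (lam : nat -> R) (v : nat -> V) (B : R).
Hypothesis lam0 : 0 <= lam 0%N.
Hypothesis lam_gap : forall i j : nat, (i <= j)%N -> (j - i)%:R <= lam j - lam i.
Hypothesis vB : forall i, `|v i| <= B.
Variable K : V -> Prop.
Hypothesis K_comb : forall (a b : R) x y, K x -> K y -> K (a *: x + b *: y).
Hypothesis K_closed : forall x, (forall e : R, 0 < e -> exists2 y, K y & `|x - y| < e) -> K x.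

(** Transports [K] to coefficient sequences. As the [v i] are bounded, summation against them is
    continuous for the [l^1] distance, and so [l1_closed_unit] applies. *)
Let A (phi : nat -> R) := exists2 x, K x & \sum_(i < N) phi i *: v i @[N --> \oo] --> x.

Let B_ge0 : 0 <= B. Proof. exact: le_trans (vB 0%N). Qed.

Let A_comb (a b : R) phi psi : A phi -> A psi -> A (fun i => a * phi i + b * psi i).
Proof.
move=> [x Kx cx] [y Ky cy]; exists (a *: x + b *: y); first exact: K_comb.
rewrite (_ : (fun N => _) = fun N => a *: (\sum_(i < N) phi i *: v i) + b *: (\sum_(i < N) psi i *: v i)).
  by apply: cvgD; apply: cvgZl_tmp.
apply/funext => N; rewrite !scaler_sumr -big_split; apply: eq_bigr => i _ /=.
by rewrite scalerDl !scalerA.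
Qed.

Let partial_le N (phi psi : nat -> R) (e : R) : (forall N, \sum_(i < N) `|phi i - psi i| <= e) ->
  `|\sum_(i < N) phi i *: v i - \sum_(i < N) psi i *: v i| <= B * e.
Proof.
move=> h; rewrite -sumrB; apply: le_trans (ler_norm_sum _ _ _) _.
apply: (@le_trans _ _ (B * \sum_(i < N) `|phi i - psi i|)); last by rewrite ler_wpM2l.
rewrite mulr_sumr; apply: ler_sum => i _.
by rewrite -scalerBl normrZ mulrC ler_wpM2r.
Qed.

Let A_closed (phi : nat -> R) : (forall e : R, 0 < e -> exists2 psi, A psi &
  forall N, \sum_(i < N) `|phi i - psi i| <= e) -> A phi.
Proof.
move=> H; have B1 : 0 < B + 1 by have := B_ge0; lra.
have approx (e : R) : 0 < e -> exists x : V, exists psi : nat -> R, [/\ K x,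
    \sum_(i < N) psi i *: v i @[N --> \oo] --> x &
    forall N, `|\sum_(i < N) phi i *: v i - \sum_(i < N) psi i *: v i| <= e].
  move=> e0; have eB : 0 < e / (B + 1) by exact: divr_gt0.
  have [psi [x Kx cx] h] := H _ eB; exists x, psi; split => // N.
  apply: le_trans (partial_le N h) _; rewrite mulrA ler_pdivrMr// mulrC ler_wpM2l//; lra.
have /cvg_ex[x cx] : cvg (\sum_(i < N) phi i *: v i @[N --> \oo]).
  apply/cauchy_cvgP/cauchyP => e e0; have e2 : 0 < e / 2 by lra.
  have [y [psi [_ cy h]]] := approx _ e2; exists y.
  move/cvgrPdist_lt : cy => /(_ _ e2); apply: filterS => N yN.
  rewrite /= -ball_normE /=.
  rewrite (_ : y - _ = (y - \sum_(i < N) psi i *: v i) -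
     (\sum_(i < N) phi i *: v i - \sum_(i < N) psi i *: v i)); last first.
    by rewrite opprB addrA subrK.
  apply: le_lt_trans (ler_normB _ _) _; have := h N; lra.
exists x => //; apply: K_closed => e e0; have e2 : 0 < e / 2 by lra.
have [y [psi [Ky cy h]]] := approx _ e2; exists y => //.
have cxy : `|\sum_(i < N) phi i *: v i - \sum_(i < N) psi i *: v i| @[N --> \oo] --> `|x - y|.
  by apply: cvg_norm; apply: cvgB.
apply: (@le_lt_trans _ _ (e / 2)); last lra.
rewrite -(cvg_lim _ cxy)//; apply: limr_le; last exact: nearW.
by apply/cvg_ex; eexists; exact: cxy.
Qed.

Lemma spectral_projection (delta : R) (h : R -> V) : 0 < delta ->
  (forall t, 0 < t < delta -> K (h t) /\
     \sum_(i < N) expR (- lam i * t) *: v i @[N --> \oo] --> h t) ->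
  forall n, K (v n).
Proof.
move=> d0 H n.
have Ah t : 0 < t < delta -> A (fun i => expR (- lam i * t)).
  by move=> /H[Kh ch]; exists (h t).
have A0 : A (fun=> 0).
  have hd : 0 < delta / 2 < delta by lra.
  have A2 := A_comb 0 0 (Ah _ hd) (Ah _ hd).
  by rewrite (_ : (fun=> 0) = fun i => 0 * expR (- lam i * (delta / 2)) + 0 * expR (- lam i * (delta / 2)))//;
    apply/funext => i; rewrite !mul0r addr0.
have [x Kx cx] := l1_closed_unit lam0 lam_gap A0 A_comb A_closed d0 Ah n.
suff -> : v n = x by [].
have cn : \sum_(i < N) (i == n :> nat)%:R *: v i @[N --> \oo] --> v n.
  apply: cvg_near_cst; near=> N.
  have nN : (n < N)%N by near: N; exact: nbhs_infty_gt.
  rewrite (bigD1 (Ordinal nN))//= eqxx scale1r big1 ?addr0// => i.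
  by rewrite -val_eqE /= => /negPf ->; rewrite scale0r.
exact: cvg_unique cn cx.
Unshelve. all: by end_near. Qed.

End spectral_projection.

(** * Sine expansion of the heat semigroup *)

Section heat_semigroup.
Context (R : realType) (S : R -> L2 R -> L2 R).
Hypothesis S_semigroup : C0_semigroup S.
Hypothesis S_generator : forall z w : L2 R, generator S z w <-> heat_op z (- w).

Definition freq (i : nat) : R := i.+1%:R ^+ 2.

Lemma freq_gap i j : (i <= j)%N -> (j - i)%:R <= freq j - freq i.
Proof.
move=> ij; rewrite natrB// /freq -!natr1; have : i%:R <= j%:R :> R by rewrite ler_nat.
have := ler0n R i; nra.
Qed.

Lemma semigroup_sine n t : 0 <= t -> S t (sine_L2 R n) = expR (- freq n * t) *: sine_L2 R n.
Proof.
apply: (semigroup_eigenvector S_semigroup); first by rewrite exprn_ge0.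
by apply/S_generator; rewrite opprK; exact: heat_op_sine.
Qed.

Lemma norm_sine_L2 n : `|sine_L2 R n| <= 1 + pi.
Proof.
have pi0 := pi_gt0 R; apply: L2_norm_le; first lra.
rewrite -L2_normE (L2_norm_ae (@sine_measurable R n) (to_L2E (sine_in_L2 R n))).
apply: (@le_trans _ _ (\int[leb_0pi R]_x 1%:E)%E).
  apply: ge0_le_integral => //.
  - by move=> x _; rewrite lee_fin sqr_ge0.
  - by apply: measurable_sqr_EFin; exact: sine_measurable.
  - move=> x _; rewrite lee_fin -(real_normK (num_real (sine n x))).
    by rewrite exprn_ile1// sine_le1.
by rewrite integral_cst//= mul1e mu_setT lee_fin; nra.
Qed.

(** The orthogonal projection of [y] on the line of [sine_L2 R i], whose squared norm is
    [pi / 2]. *)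
Definition sine_term (y : L2 R) (i : nat) : L2 R := (2 / pi * sine_coef i y) *: sine_L2 R i.

Lemma norm_sine_term y i : `|sine_term y i| <= 2 / pi * (1 + pi) ^+ 2 * `|y|.
Proof.
have pi0 := pi_gt0 R; rewrite /sine_term normrZ normrM ger0_norm; last by rewrite divr_ge0// ltW.
rewrite -[leLHS](mulrA (2 / pi)) -[leRHS](mulrA (2 / pi)) ler_wpM2l ?divr_ge0 ?(ltW pi0)//.
apply: (@le_trans _ _ (((1 + pi) * `|y|) * (1 + pi))).
  by apply: ler_pM => //; [exact: sine_coef_le | exact: norm_sine_L2].
by rewrite expr2 mulrAC.
Qed.

(** For fixed [t > 0] the partial sums are operators bounded uniformly in [N], because the
    exponentials are summable. Hence the vectors with a convergent expansion form a closed subspace;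
    it contains the sines, so [sines_total] applies without any Parseval identity. *)
Lemma heat_expansion (y : L2 R) t : 0 < t ->
  \sum_(i < N) expR (- freq i * t) *: sine_term y i @[N --> \oo] --> S t y.
Proof.
move=> t0; have t_ge0 := ltW t0; have pi0 := pi_gt0 R.
pose P N (w : L2 R) := \sum_(i < N) expR (- freq i * t) *: sine_term w i.
have P_comb N a b x z : P N (a *: x + b *: z) = a *: P N x + b *: P N z.
  rewrite /P !scaler_sumr -big_split; apply: eq_bigr => i _ /=.
  rewrite /sine_term sine_coef_comb !scalerA -scalerDl; congr (_ *: _); ring.
pose q := expR (- t).
have q0 : 0 <= q by exact: expR_ge0.
have q1 : q < 1 by rewrite expR_lt1 oppr_lt0.
pose D := (1 - q)^-1 * (2 / pi * (1 + pi) ^+ 2).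
have P_le N w : `|P N w| <= D * `|w|.
  apply: le_trans (ler_norm_sum _ _ _) _.
  apply: (@le_trans _ _ (\sum_(i < N) q ^+ i * (2 / pi * (1 + pi) ^+ 2 * `|w|))).
    apply: ler_sum => i _; rewrite normrZ ger0_norm ?expR_ge0//.
    apply: ler_pM => //; last exact: norm_sine_term.
    rewrite /q -expRM_natl ler_expR /freq -natr1; have := ler0n R i; nra.
  have c0 : 0 <= 2 / pi * (1 + pi) ^+ 2 * `|w|.
    by rewrite !mulr_ge0 ?invr_ge0 ?(ltW pi0) ?exprn_ge0//; lra.
  by rewrite -mulr_suml /D -[leRHS]mulrA ler_wpM2r// sum_geometric_le.
have [C C1 HC] := semigroup_bound S_semigroup t.
have CS w : `|S t w| <= C * `|w| by apply: HC; rewrite t_ge0 lexx.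
apply: (@sines_total _ (fun w => P N w @[N --> \oo] --> S t w)).
- move=> a b x z cx cz.
  rewrite (_ : (fun N => _) = fun N => a *: P N x + b *: P N z); last by apply/funext => N.
  rewrite semigroup_add// !semigroupZ//.
  by apply: cvgD; apply: cvgZl_tmp.
- move=> x H; apply/cvgrPdist_lt => e e0.
  have D0 : 0 <= D by rewrite !mulr_ge0 ?invr_ge0 ?(ltW pi0) ?exprn_ge0//; lra.
  have CD : 0 < C + D + 1 by lra.
  have e1 : 0 < e / (2 * (C + D + 1)) by rewrite divr_gt0// mulr_gt0.
  have [z cz xz] := H _ e1; have e2 : 0 < e / 2 by lra.
  move/cvgrPdist_lt : cz => /(_ _ e2); apply: filterS => N hN.
  have -> : S t x - P N x = S t (x - z) + (S t z - P N z) - P N (x - z).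
    have -> : P N (x - z) = P N x - P N z.
      by have := P_comb N 1 (-1) x z; rewrite !scale1r !scaleN1r.
    by rewrite semigroup_sub// addrA subrK opprB addrA subrK.
  apply: le_lt_trans (ler_normB _ _) _.
  have h1 := ler_normD (S t (x - z)) (S t z - P N z).
  have h2 := CS (x - z); have h3 := P_le N (x - z).
  have h4 : (C + D) * `|x - z| <= e / 2.
    apply: (@le_trans _ _ ((C + D + 1) * (e / (2 * (C + D + 1))))).
      by apply: ler_pM => //; [lra | lra | exact: ltW].
    by rewrite le_eqVlt; apply/orP; left; apply/eqP; field; rewrite gt_eqF.
  nra.
- move=> n; rewrite semigroup_sine//; apply: cvg_near_cst; near=> N.
  have nN : (n < N)%N by near: N; exact: nbhs_infty_gt.
  rewrite /P (bigD1 (Ordinal nN))//= big1 ?addr0; last first.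
    move=> i; rewrite -val_eqE /= eq_sym => /negPf ni.
    by rewrite /sine_term sine_orthogonal ni mulr0 scale0r scaler0.
  rewrite /sine_term sine_orthogonal eqxx (_ : 2 / pi * (pi / 2) = 1) ?scale1r//.
  by rewrite mulrA divfK ?divff ?gt_eqF.
Unshelve. all: by end_near. Qed.

Lemma sine_term_in_closed_subspace (K : L2 R -> Prop) (delta : R) (y : L2 R) :
  (forall (a b : R) x z, K x -> K z -> K (a *: x + b *: z)) ->
  (forall x, (forall e : R, 0 < e -> exists2 z, K z & `|x - z| < e) -> K x) ->
  0 < delta -> (forall t, 0 < t < delta -> K (S t y)) -> forall n, K (sine_term y n).
Proof.
move=> Kcomb Kclosed d0 KS.
apply: (@spectral_projection _ _ freq _ _ _ freq_gap (norm_sine_term y) K Kcomb Kclosed delta (S ^~ y)) => //.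
  by rewrite exprn_ge0.
move=> t td; split; first exact: KS.
by apply: heat_expansion; case/andP : td.
Qed.

End heat_semigroup.

(** * Density of the reachable vectors *)

Section control_operator.
Context (R : realType) (P : heat_system R).
Local Notation mu := (leb_0pi R).
Local Notation mR := (measurableTypeR R).
Local Notation B := (control_op P).
Hypothesis theta_open : open_region P.

Lemma theta_measurable : measurable (hs_theta P : set mR).
Proof.
have [_ [U [oU ->]]] := theta_open.
apply: measurableI; first exact: measurable_itv.
exact: open_measurable.
Qed.

Lemma control_op_in_L2 (v : L2 R) : in_L2 (fun x => \1_(hs_theta P) x * v x).
Proof.
apply: in_L2I.
  apply: measurable_funM; last exact: L2_measurable.
  by apply: measurable_indic; exact: theta_measurable.
apply: (@le_lt_trans _ _ (\int[mu]_x (v x ^+ 2)%:E)%E); last by rewrite -L2_normE ltry.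
apply: le_integral_sqr_ae.
- apply: measurable_funM; last exact: L2_measurable.
  by apply: measurable_indic; exact: theta_measurable.
- exact: L2_measurable.
- apply: aeW => x; rewrite normrM ler_piMl// indicE.
  by case: (x \in _); rewrite ?normr1 ?normr0.
Qed.

Lemma control_opE (v : L2 R) : {ae mu, forall x, B v x = \1_(hs_theta P) x * v x}.
Proof. exact: (to_L2E (control_op_in_L2 v)). Qed.

Lemma control_op_comb (a b : R) (v w : L2 R) : B (a *: v + b *: w) = a *: B v + b *: B w.
Proof.
have lhs : {ae mu, forall x, B (a *: v + b *: w) x =
    \1_(hs_theta P) x * (a * v x + b * w x)}.
  by apply: (ae_imp2 (control_opE (a *: v + b *: w)) (L2_ae_comb a b v w)) => x -> ->.
have rhs : {ae mu, forall x, (a *: B v + b *: B w : L2 R) x =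
    \1_(hs_theta P) x * (a * v x + b * w x)}.
  apply: (ae_imp3 (L2_ae_comb a b (B v) (B w)) (control_opE v) (control_opE w)) => x.
  by move=> -> -> ->; ring.
by apply: L2_eq; apply: (ae_imp2 lhs rhs) => x -> ->.
Qed.

Lemma control_opZ a v : B (a *: v) = a *: B v.
Proof. by have := control_op_comb a 0 v v; rewrite !scale0r !addr0. Qed.

Lemma control_op0 : B 0 = 0.
Proof. by rewrite -[0 in LHS](scale0r 0) control_opZ scale0r. Qed.

Lemma control_opD v w : B (v + w) = B v + B w.
Proof. by have := control_op_comb 1 1 v w; rewrite !scale1r. Qed.

Lemma control_op_sum (I : Type) (s : seq I) (F : I -> L2 R) :
  B (\sum_(i <- s) F i) = \sum_(i <- s) B (F i).
Proof.
elim: s => [|i s IH]; first by rewrite !big_nil control_op0.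
by rewrite !big_cons control_opD IH.
Qed.

Lemma control_op_le v : `|B v| <= `|v|.
Proof.
apply: L2_norm_mono; apply: (ae_imp1 (control_opE v)) => x ->.
rewrite normrM ler_piMl// indicE.
by case: (x \in _); rewrite ?normr1 ?normr0.
Qed.

Lemma ae_interval (Q : R -> Prop) (a b : R) : {ae mu, forall x, Q x} ->
  0 <= a -> a < b -> b <= pi -> exists2 x, a < x < b & Q x.
Proof.
move=> [N [mN muN QN]] a0 ab bpi; apply: contrapT => noQ.
have sub : `]a, b[ `<=` N.
  move=> x /=; rewrite in_itv/= => xab; apply: QN => /= Qx.
  by apply: noQ; exists x.
have : (lebesgue_measure (`]a, b[ : set mR) <= mu N)%E.
  rewrite /leb_0pi /= /mrestr; apply: le_measure; rewrite ?inE//.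
    exact: measurableI.
  move=> x /= xab; split; first exact: sub.
  by move: xab; rewrite /= !in_itv/= => /andP[ax xb]; apply/andP; split; apply: ltW;
    [exact: le_lt_trans ax | exact: lt_le_trans bpi].
rewrite lebesgue_measure_itv/= lte_fin ab muN -EFinB lee_fin subr_le0.
by rewrite leNgt ab.
Qed.

(* [sine n] cannot vanish at both [x] and [x + h] when [0 < (n + 1) h < pi]. *)
Lemma sine_neq0_interval (n : nat) (a b : R) : a < b ->
  exists2 x, a < x < b & sine n x != 0.
Proof.
move=> ab; pose c : R := n.+1%:R; have c0 : 0 < c by rewrite ltr0n.
have pi0 := pi_gt0 R.
pose x := (a + b) / 2; have [s0|s0] := eqVneq (sine n x) 0; last by exists x => //; rewrite /x; lra.
pose h := Num.min ((b - a) / 4) (pi / (2 * c)).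
have h0 : 0 < h by rewrite lt_min divr_gt0 ?subr_gt0//= divr_gt0// mulr_gt0.
have h1 : h <= (b - a) / 4 by rewrite ge_min lexx.
have h2 : h <= pi / (2 * c) by rewrite ge_min lexx orbT.
exists (x + h); first by rewrite /x; lra.
have ch : 0 < c * h < pi.
  rewrite mulr_gt0//=; apply: (@le_lt_trans _ _ (pi / 2)); last by lra.
  rewrite mulrC -ler_pdivlMr//; apply: le_trans h2 _.
  by rewrite invfM mulrA.
rewrite /sine mulrDr sinD -/(sine n x) s0 mul0r add0r mulf_neq0//; last first.
  by rewrite gt_eqF// sin_gt0_pi.
apply/eqP => c_eq0; have := cos2Dsin2 (c * x).
by rewrite c_eq0 -[sin _]/(sine n x) s0 expr0n addr0 => /eqP; rewrite eq_sym oner_eq0.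
Qed.

(** The coefficient is the integral of the squared sine over [theta]. If it vanished, so would the
    integrand almost everywhere, although [theta] contains an interval on which the sine has no
    zero. *)
Lemma sine_coef_control_op n : sine_coef n (B (sine_L2 R n)) != 0.
Proof.
have mth := theta_measurable; have ms := @sine_measurable R n.
have mi : measurable_fun [set: mR] (\1_(hs_theta P) : R -> R) by exact: measurable_indic.
pose f (x : R) := \1_(hs_theta P) x * sine n x * sine n x.
have fE : sine_coef n (B (sine_L2 R n)) = (\int[mu]_x f x)%R.
  apply: sine_coef_ae; first exact: measurable_funM.
  by apply: (ae_imp2 (control_opE (sine_L2 R n)) (to_L2E (sine_in_L2 R n))) => x -> ->.
have mf : measurable_fun [set: mR] (EFin \o f).
  by apply/measurable_EFinP; apply: measurable_funM => //; exact: measurable_funM.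
have f0 x : 0 <= f x by rewrite /f -mulrA mulr_ge0// -expr2 sqr_ge0.
have If : mu.-integrable setT (EFin \o f).
  have := sine_product_integrable n (B (sine_L2 R n)).
  move/integrableP => [_ h]; apply/integrableP; split => //.
  apply: le_lt_trans h; rewrite le_eqVlt; apply/orP; left; apply/eqP.
  apply: ae_eq_integral => //.
  - exact: measurableT_comp.
  - apply: measurableT_comp => //; apply/measurable_EFinP; exact: sine_product_measurable.
  apply: (ae_imp2 (control_opE (sine_L2 R n)) (to_L2E (sine_in_L2 R n))) => x h1 h2 _.
  by rewrite /= h1 h2.
apply/eqP; rewrite fE => int0.
have int0' : (\int[mu]_x `|(f x)%:E| = 0)%E.
  under eq_integral do rewrite gee0_abs ?lee_fin//.
  by rewrite -[LHS]fineK ?[fine _]int0//; exact: integrable_fin_num If.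
move/(ae_eq_integral_abs mu measurableT mf) : int0' => f_ae0.
have [[x0 thx0] [U [oU thU]]] := theta_open.
move: thx0; rewrite thU => -[/= x0pi Ux0].
have /nbhs_ballP[d /= d0 Hd] : nbhs x0 U by exact: open_nbhs_nbhs.
move: x0pi; rewrite in_itv/= => /andP[x0_ge0 x0_le].
have pi0 := pi_gt0 R.
(* [theta] is open only relatively to [[0, pi]] and [x0] may be an endpoint, hence the
   truncation. *)
have [a [b [a0 ab bpi abU]]] : exists a b, [/\ 0 <= a, a < b, b <= pi &
    forall x, a < x < b -> U x].
  exists (Num.max 0 (x0 - d)), (Num.min pi (x0 + d)).
  split; [by rewrite le_max lexx | | by rewrite ge_min lexx |].
    by rewrite gt_max !lt_min; apply/andP; split; apply/andP; split; lra.
  move=> x; rewrite gt_max lt_min => /andP[/andP[_ h1] /andP[_ h2]].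
  by apply: Hd; rewrite /ball/= ltr_norml; lra.
have [x1 /andP[ax1 x1b] sx1] := sine_neq0_interval n ab.
have cs : continuous (sine n : R -> R).
  by move=> x; apply: differentiable_continuous; apply/derivable1_diffP;
    have [] := is_derive_sin_scale (n.+1%:R : R) x.
have /nbhs_ballP[d' /= d'0 Hd'] : \forall x \near x1, sine n x != 0.
  exact: (cvgr_neq0 _ (cs x1) sx1).
pose a' := Num.max a (x1 - d'); pose b' := Num.min b (x1 + d').
have a'b' : a' < b' by rewrite /a' /b' gt_max !lt_min; apply/andP; split; apply/andP; split; lra.
have a'0 : 0 <= a' by rewrite le_max a0.
have b'pi : b' <= pi by rewrite ge_min bpi.
have [x /andP[] + +] := ae_interval f_ae0 a'0 a'b' b'pi.
rewrite gt_max lt_min => /andP[ax d'x] /andP[xb xd'] /(_ I) [].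
rewrite /f indicE mem_set; last first.
  rewrite thU; split; last by apply: abU; rewrite ax xb.
  by rewrite /= in_itv/=; apply/andP; split; lra.
rewrite mul1r => /eqP; rewrite mulf_eq0 orbb; apply/negP.
by apply: Hd'; rewrite /ball/= ltr_norml; lra.
Qed.

End control_operator.

Section approximate_reachability.
Context (R : realType) (P : heat_system R) (S : R -> L2 R -> L2 R).
Local Notation B := (control_op P).
Hypothesis theta_open : open_region P.
Hypothesis S_semigroup : C0_semigroup S.
Hypothesis S_generator : forall z w : L2 R, generator S z w <-> heat_op z (- w).

(** The sums carry no coefficients: by linearity scalars are absorbed into the vectors [p.2], so the
    approximable vectors form a closed subspace. It contains the mode [n] of [B (sine_L2 R n)], a
    nonzero multiple of [sine_L2 R n]. *)
Lemma reachable_dense (delta : R) (y : L2 R) (e : R) : 0 < delta -> 0 < e ->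
  exists2 l : seq (R * L2 R), {in l, forall p, 0 < p.1 < delta} &
    `|y - \sum_(p <- l) S p.1 (B p.2)| < e.
Proof.
move=> d0; move: y e.
pose K y := forall e : R, 0 < e -> exists2 l : seq (R * L2 R),
  {in l, forall p, 0 < p.1 < delta} & `|y - \sum_(p <- l) S p.1 (B p.2)| < e.
suff : forall y, K y by move=> H y e; exact: H.
have Kcomb (a b : R) x z : K x -> K z -> K (a *: x + b *: z).
  move=> Kx Kz e e0; pose c := `|a| + `|b| + 1.
  have c0 : 0 < c by have := normr_ge0 a; have := normr_ge0 b; rewrite /c; lra.
  have ec : 0 < e / c by exact: divr_gt0.
  have [l Hl xl] := Kx _ ec; have [k Hk zk] := Kz _ ec.
  exists ([seq (p.1, a *: p.2) | p <- l] ++ [seq (p.1, b *: p.2) | p <- k]).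
    by move=> p; rewrite mem_cat => /orP[] /mapP[q ql ->]; [exact: (Hl q ql) | exact: (Hk q ql)].
  have scal d' (s : seq (R * L2 R)) : {in s, forall p, 0 < p.1 < delta} ->
      \sum_(p <- [seq (p.1, d' *: p.2) | p <- s]) S p.1 (B p.2) = d' *: \sum_(p <- s) S p.1 (B p.2).
    move=> Hs; rewrite big_map scaler_sumr big_seq [RHS]big_seq; apply: eq_bigr => p ps /=.
    by rewrite control_opZ// semigroupZ//; have /andP[/ltW] := Hs _ ps.
  rewrite big_cat /= !scal// opprD addrACA -!scalerBr.
  apply: le_lt_trans (ler_normD _ _) _; rewrite !normrZ.
  have h1 : `|a| * `|x - \sum_(p <- l) S p.1 (B p.2)| <= `|a| * (e / c) by rewrite ler_wpM2l// ltW.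
  have h2 : `|b| * `|z - \sum_(p <- k) S p.1 (B p.2)| <= `|b| * (e / c) by rewrite ler_wpM2l// ltW.
  have h3 : e = (`|a| + `|b|) * (e / c) + e / c by rewrite /c; field; rewrite gt_eqF.
  lra.
have Kclosed x : (forall e : R, 0 < e -> exists2 z, K z & `|x - z| < e) -> K x.
  move=> H e e0; have e2 : 0 < e / 2 by lra.
  have [z Kz xz] := H _ e2; have [l Hl zl] := Kz _ e2; exists l => //.
  rewrite -(subrK z x) -addrA; apply: le_lt_trans (ler_normD _ _) _; lra.
apply: (sines_total Kcomb Kclosed) => n.
have Kt : K (sine_term (B (sine_L2 R n)) n).
  apply: (sine_term_in_closed_subspace S_semigroup S_generator Kcomb Kclosed d0).
  move=> t td e e0; exists [:: (t, sine_L2 R n)].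
    by move=> p; rewrite inE => /eqP ->.
  by rewrite big_seq1 subrr normr0.
have a0 : 2 / pi * sine_coef n (B (sine_L2 R n)) != 0.
  rewrite mulf_neq0 ?sine_coef_control_op//.
  by rewrite mulf_neq0 ?invr_eq0 ?gt_eqF ?pi_gt0.
have := Kcomb (2 / pi * sine_coef n (B (sine_L2 R n)))^-1 0 _ _ Kt Kt.
by rewrite /sine_term scale0r addr0 scalerA mulVf// scale1r.
Qed.

End approximate_reachability.

(** * Changing the control near the final time *)

Section step_functions.
Context (R : realType) (V : completeNormedModType R).
Local Notation mR := (measurableTypeR R).
Local Notation mu := (@lebesgue_measure R).

(** The sets may overlap or coincide, so pulses need no ordering in time. *)
Definition step_fun (l : seq (set mR * V)) (t : R) : V := \sum_(p <- l) \1_p.1 t *: p.2.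

Lemma simple_indic (A : set mR) (w : V) : measurable A ->
  simple_fun (fun t : mR => \1_A t *: w) /\
  forall D : set mR, measurable D -> (mu D < +oo)%E ->
    simple_integral D (fun t => \1_A t *: w) = fine (mu (D `&` A)) *: w.
Proof.
move=> mA.
have fv : @finite_valued R bool [:: true; false] (fun t => t \in A).
  split => //; first by move=> t; rewrite !inE; case: (t \in A).
  case.
    rewrite (_ : _ @^-1` _ = A)//.
    by apply/seteqP; split => t /=; [move/set_mem | move/mem_set].
  rewrite (_ : _ @^-1` _ = ~` A); first exact: measurableC.
  by apply/seteqP; split => t /=; [move/negbT/negP => h /mem_set | move=> h; apply/negbTE/negP => /set_mem].
have E : (fun t : mR => \1_A t *: w) = (fun b : bool => b%:R *: w) \o (fun t => t \in A).
  by apply/funext => t /=; rewrite indicE.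
split; first by apply/simple_funP; eexists; rewrite E; exact: finite_valued_comp fv.
move=> D mD Dfin; rewrite E (simple_integral_comp mD Dfin _ fv).
rewrite big_cons big_seq1 scale1r scale0r scaler0 addr0; congr (fine (mu (D `&` _)) *: _).
by apply/seteqP; split => t /=; [move/set_mem | move/mem_set].
Qed.

Lemma simple_addition (s1 s2 : mR -> V) : simple_fun s1 -> simple_fun s2 ->
  simple_fun (fun t => s1 t + s2 t).
Proof.
move=> /simple_funP[r1 rs1] /simple_funP[r2 rs2]; apply/simple_funP; eexists.
exact: (finite_valued_comp (fun p : V * V => p.1 + p.2) (finite_valued_pair rs1 rs2)).
Qed.

Lemma simple_cst0 : simple_fun (fun _ : mR => 0 : V).
Proof.
have [h _] := @simple_indic set0 0 measurable0.
by rewrite (_ : (fun=> 0) = fun t : mR => \1_set0 t *: (0 : V))//; apply/funext => t; rewrite scaler0.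
Qed.

Lemma simple_step (l : seq (set mR * V)) : {in l, forall p, measurable p.1} ->
  simple_fun (step_fun l).
Proof.
elim: l => [|p l IH] ml.
  rewrite (_ : step_fun [::] = fun _ => 0); first exact: simple_cst0.
  by apply/funext => t; rewrite /step_fun big_nil.
rewrite (_ : step_fun (p :: l) = fun t => \1_p.1 t *: p.2 + step_fun l t); last first.
  by apply/funext => t; rewrite /step_fun big_cons.
apply: simple_addition; first by apply: (simple_indic _ _).1; apply: ml; rewrite inE eqxx.
by apply: IH => q ql; apply: ml; rewrite inE ql orbT.
Qed.

Lemma bochner_step (D : set mR) (l : seq (set mR * V)) : measurable D -> (mu D < +oo)%E ->
  {in l, forall p, measurable p.1} ->
  bochner_integral D (step_fun l) (\sum_(p <- l) fine (mu (D `&` p.1)) *: p.2).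
Proof.
move=> mD Dfin; elim: l => [|p l IH] ml.
  have h := bochner_simple mD Dfin simple_cst0.
  have := bochner_sub mD Dfin h h; rewrite [X in bochner_integral _ _ X]subrr big_nil.
  by move=> h1; apply: bochner_ext h1 => t _; rewrite /step_fun big_nil subrr.
have mp : measurable p.1 by apply: ml; rewrite inE eqxx.
have {}IH : bochner_integral D (step_fun l) (\sum_(p <- l) fine (mu (D `&` p.1)) *: p.2).
  by apply: IH => q ql; apply: ml; rewrite inE ql orbT.
have [sp Ip] := simple_indic p.2 mp.
have hp := bochner_simple mD Dfin sp; rewrite (Ip D mD Dfin) in hp.
(* Addition is obtained from subtraction, as [a + b = a - ((a - a) - b)]. *)
have h0 := bochner_sub mD Dfin hp hp.
have h1 := bochner_sub mD Dfin h0 IH.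
have := bochner_sub mD Dfin hp h1.
rewrite big_cons [X in bochner_integral _ _ (_ - (X - _))]subrr [X in bochner_integral _ _ (_ - X)]sub0r [X in bochner_integral _ _ (_ + X)]opprK.
by move=> h2; apply: bochner_ext h2 => t _; rewrite /step_fun big_cons subrr sub0r opprK.
Qed.

Lemma simple_L2_in_time (D : set mR) (s : mR -> V) : measurable D -> (mu D < +oo)%E ->
  simple_fun s -> L2_in_time D s.
Proof.
move=> mD Dfin ss; split.
  by exists (fun=> s); split => //; apply: aeW => t _; exact: cvg_cst.
have /simple_funP[r rs] := ss.
by rewrite (integral_finite_valued mD Dfin (fun v => `|v| ^+ 2) rs) ltry.
Qed.

End step_functions.

Lemma subr_detour (V : zmodType) (a b c d : V) : a - d = (a - b) - (c - b) - (d - c).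
Proof. by rewrite !opprB !addrA !subrK. Qed.

Lemma addr_exchange (V : zmodType) (a b c : V) : a + b + (c - b) = a + c.
Proof. by rewrite -addrA [b + _]addrC subrK. Qed.

Section limits.
Context (R : realType) (V : normedModType R).
Implicit Types (f g : R -> V).

Lemma near_eq_cvg_to (F : set_system R) f g (l : V) : Filter F ->
  (\forall x \near F, f x = g x) -> f @ F --> l -> g @ F --> l.
Proof.
move=> FF fg; apply: cvg_trans; apply: near_eq_cvg.
by apply: filterS fg => x ->.
Qed.

Lemma within_cvg_at_left (D : set R) f (t : R) (l : V) :
  (\forall x \near t^'-, D x) -> f @ within D (nbhs t) --> l -> f @ t^'- --> l.
Proof.
move=> Dt; apply: cvg_trans => A /= fA.
have fA' : \forall x \near t^'-, D x -> A (f x) by apply: filterS (fA : nbhs t (fun x => D x -> A (f x))) => x h _.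
by apply: filterS2 Dt fA' => x Dx; apply.
Qed.

Lemma nbhs_within (D A : set R) (t : R) : nbhs t A -> within D (nbhs t) A.
Proof. by move=> nA; apply: filterS nA => x Ax _. Qed.

Lemma near_lt_nbhs (t c : R) : t < c -> \forall x \near t, x < c.
Proof. by move=> tc; apply: (@open_nbhs_nbhs _ t [set x | x < c]); split; [exact: open_lt|]. Qed.

End limits.

(** * The explicit mild solution for a control supported near [T] *)

Section patch.
Context (R : realType) (P : heat_system R) (S : R -> L2 R -> L2 R).
Local Notation X := (L2 R).
Local Notation mu := (@lebesgue_measure R).
Local Notation T := (hs_T P).
Local Notation r := (hs_r P).
Local Notation N := (hs_N P).
Local Notation B := (control_op P).
Local Notation sN := (hs_s P (hs_N P)).
Hypothesis T_gt0 : 0 < T.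
Hypothesis r_gt0 : 0 < r.
Hypothesis grid : time_grid P.
Hypothesis theta_open : open_region P.
Hypothesis S_semigroup : C0_semigroup S.
Hypothesis meaningful : integrals_meaningful P S.

Lemma grid_t_le i : (1 <= i <= N)%N -> hs_t P i <= sN.
Proof.
have [_ ts st _] := grid.
move=> /andP[i1 iN]; apply: le_trans (ts i _) _; first by rewrite i1.
have [k] := ubnP (N - i); elim: k i i1 iN => // k IH i i1 iN Ni.
have [->//|iN'] := eqVneq i N.
have lt_iN : (i < N)%N by rewrite ltn_neqAle iN'.
have h1 := st i iN; have h2 := ts i.+1; rewrite lt_iN /= in h2.
apply: le_trans (ltW h1) _; apply: le_trans (h2 isT) _.
by apply: IH => //; rewrite subnS; move: Ni; rewrite ltnS -subn_gt0 in lt_iN *; case: (N - i)%N lt_iN.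
Qed.

Lemma grid_sN_ge0 : 0 <= sN.
Proof.
have [[_ s0] ts st _] := grid; case: (posnP N) => [->|N0]; first by rewrite s0.
apply: le_trans (grid_t_le (i := 1) _); last by rewrite N0.
by have := st 0%N (leq0n _); rewrite s0 => /ltW.
Qed.

Lemma grid_sN_lt : sN < T.
Proof. by have [_ _ st <-] := grid; exact: st. Qed.

Variables (h u w0 : R -> X) (tau M : R).
Hypothesis h_PW : PW S r h.
Hypothesis u_control : control P u.
Hypothesis zero_control : control P (fun=> 0).
Hypothesis w0_mild : mild_solution P S h (fun=> 0) w0.
Hypotheses (sN_tau : sN < tau) (tau_T : tau < T) (Tr_tau : T - r < tau).
Hypothesis u_zero : forall s, s <= tau -> u s = 0.

(** Difference of the forcings for [u] and for [0] along the same state [w0]; the memory integral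
    cancels. *)
Definition forcing_gap (s : R) : X :=
  B (u s) + (f1 P s (w0 (s - r)) (u s) - f1 P s (w0 (s - r)) 0).

Hypothesis gap_le : forall s, tau < s <= T -> `|forcing_gap s| <= M.

(** Kept as a difference of integrals, so that adding it to [w0 t] exchanges one integral for the
    other algebraically; [gap_integralP] identifies it as a single Bochner integral. *)
Definition gap_integral (t : R) : X :=
  bint `[sN, t]%classic (integrand P S w0 u t) -
  bint `[sN, t]%classic (integrand P S w0 (fun=> 0) t).

(* The mild solution for [u]: the integrands defining [gap_integral] involve the state
   only at times before [tau], where it is still [w0]. *)
Definition patched (t : R) : X := if t <= tau then w0 t else w0 t + gap_integral t.

Let tau_gt0 : 0 < tau. Proof. exact: le_lt_trans grid_sN_ge0 sN_tau. Qed.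

Let M_ge0 : 0 <= M.
Proof. by apply: le_trans (gap_le (s := T) _); rewrite ?tau_T ?lexx. Qed.

Lemma forcing_gap0 s : s <= tau -> forcing_gap s = 0.
Proof. by move=> st; rewrite /forcing_gap u_zero// subrr addr0 control_op0. Qed.

Lemma forcing_gap_le s : s <= T -> `|forcing_gap s| <= M.
Proof.
move=> sT; have [st|ts] := leP s tau; first by rewrite forcing_gap0// normr0.
by apply: gap_le; rewrite ts.
Qed.

Lemma integrand_gap t s : s <= t ->
  integrand P S w0 u t s - integrand P S w0 (fun=> 0) t s = S (t - s) (forcing_gap s).
Proof.
move=> st; rewrite /integrand -(semigroup_sub S_semigroup); last by rewrite subr_ge0.
congr (S _ _); rewrite /forcing_gap /forcing control_op0//; rewrite add0r -addrA; congr (_ + _).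
by rewrite opprD addrACA subrr add0r.
Qed.

Let mI (a b : R) : measurable (`[a, b]%classic : set (measurableTypeR R)).
Proof. exact: measurable_itv. Qed.

Let fI (a b : R) : (mu `[a, b]%classic < +oo)%E.
Proof. by rewrite lebesgue_measure_itv /=; case: ifP => _; rewrite -?EFinB ltry. Qed.

(** [integrals_meaningful] concerns every [PC] state with history [h], not only solutions, so it
    also covers [w0] paired with the control [u]. *)
Lemma gap_integralP t : sN < t <= T ->
  bochner_integral `[sN, t]%classic (fun s => S (t - s) (forcing_gap s)) (gap_integral t).
Proof.
move=> /andP[st tT].
have [w0PC w0h _ _ _] := w0_mild.
have tN : t \in `]sN, hs_t P N.+1] by have [_ _ _ ->] := grid; rewrite in_itv/= st.
have [_ /(_ N t (leqnn N) tN) [I HI]] := meaningful h_PW u_control w0PC w0h.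
have [_ /(_ N t (leqnn N) tN) [J HJ]] := meaningful h_PW zero_control w0PC w0h.
have := bochner_sub (mI _ _) (fI _ _) HI HJ.
rewrite /gap_integral (bintE (mI _ _) (fI _ _) HI) (bintE (mI _ _) (fI _ _) HJ).
move=> H; apply: bochner_ext H => s /=; rewrite in_itv/= => /andP[_ s_t].
exact: integrand_gap.
Qed.

Let C_bound := semigroup_bound S_semigroup T.

(** The integral is split at [a]: by the semigroup law the part up to [a] is
    [S (t - a) (gap_integral a)], and the integrand on the rest is bounded by [C * M]. *)
Lemma gap_integral_step C a t : 1 <= C ->
  (forall t x, 0 <= t <= T -> `|S t x| <= C * `|x|) ->
  sN < a -> a <= t -> t <= T ->
  `|gap_integral t - S (t - a) (gap_integral a)| <= C * M * (t - a).
Proof.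
move=> C1 HC sa at_ tT.
have C0 : 0 < C by lra.
have ta0 : 0 <= t - a by rewrite subr_ge0.
have sN0 := grid_sN_ge0.
have taT : 0 <= t - a <= T by lra.
have Ht : bochner_integral (`[sN, a]%classic `|` `]a, t]%classic)
    (fun s => S (t - s) (forcing_gap s)) (gap_integral t).
  rewrite (_ : _ `|` _ = `[sN, t]%classic); first by apply: gap_integralP; rewrite (lt_le_trans sa at_).
  apply/seteqP; split => x /=; rewrite !in_itv/=; first by lra.
  move=> /andP[h1 h2]; have [xa|ax] := leP x a; [left|right]; lra.
have mo : measurable (`]a, t]%classic : set (measurableTypeR R)) by exact: measurable_itv.
have fo : (mu `]a, t]%classic < +oo)%E.
  by rewrite lebesgue_measure_itv /=; case: ifP => _; rewrite -?EFinB ltry.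
have dis : [disjoint `[sN, a]%classic & `]a, t]%classic].
  apply/eqP; rewrite -subset0 => x /= []; rewrite !in_itv/=; lra.
have [I1 [I2 [H1 H2 ->]]] := bochner_setU (mI _ _) mo (fI _ _) fo dis Ht.
clear dis.
have Ha := gap_integralP (t := a); rewrite sa (le_trans at_ tT) in Ha.
have SI : bochner_integral `[sN, a]%classic (fun s => S (t - s) (forcing_gap s))
    (S (t - a) (gap_integral a)).
  have Sta x : `|S (t - a) x| <= C * `|x| by exact: HC.
  have H := bochner_linear (mI _ _) (fI _ _) (semigroup_linear S_semigroup ta0) C0 Sta (Ha isT).
  apply: bochner_ext H => s /=; rewrite in_itv/= => /andP[h1 h2].
  rewrite -(semigroupD S_semigroup)//; last by rewrite subr_ge0.
  by congr (S _ _); ring.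
rewrite (bochner_uniq (mI _ _) (fI _ _) H1 SI) addrAC subrr add0r.
have := bochner_le (e := cst (C * M)) mo fo H2.
move=> /(_ (measurable_cst _)) H.
have {}H : (`|I2|%:E <= \int[mu]_(x in `]a, t]) (C * M)%:E)%E.
  apply: H; first by move=> x _ /=; rewrite mulr_ge0// ltW.
  apply: aeW => s /=; rewrite in_itv/= => /andP[h1 h2].
  have tsT : 0 <= t - s <= T.
    rewrite subr_ge0 h2 /=; apply: le_trans tT; rewrite gerBl.
    exact/ltW/(le_lt_trans sN0)/(lt_trans sa).
  apply: le_trans (HC _ _ tsT) _.
  by rewrite ler_wpM2l ?(ltW C0)// forcing_gap_le// (le_trans h2 tT).
rewrite -lee_fin; apply: le_trans H _.
rewrite integral_cst//= lebesgue_measure_itv/= lte_fin.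
case: ifPn; first by rewrite -EFinB -EFinM.
by rewrite -leNgt => ta; rewrite mule0 lee_fin mulr_ge0// mulr_ge0// ltW.
Qed.

Lemma gap_integral0 t : sN < t <= tau -> gap_integral t = 0.
Proof.
move=> /andP[st tt]; have tT := ltW (le_lt_trans tt tau_T).
have H := gap_integralP (t := t); rewrite st tT in H.
have := bochner_le (e := cst 0) (mI _ _) (fI _ _) (H isT).
move=> /(_ (measurable_cst _)); rewrite integral0 => {}H.
apply/eqP; rewrite -normr_le0 -lee_fin; apply: H => //.
apply: aeW => s /=; rewrite in_itv/= => /andP[h1 h2].
by rewrite forcing_gap0 ?(le_trans h2 tt)// semigroup_zero ?normr0// subr_ge0.
Qed.

Lemma gap_integral_continuous t : sN < t <= T ->
  gap_integral @ within `[0, T]%classic (nbhs t) --> gap_integral t.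
Proof.
move=> /andP[st tT]; have [C C1 HC] := C_bound.
have sN0 := grid_sN_ge0.
apply/cvgrPdist_lt => e e0.
pose D := C * M + 1; have D0 : 0 < D by rewrite ltr_wpDl// mulr_ge0//; lra.
pose eta := Num.min ((t - sN) / 2) (e / (4 * D)).
have eta0 : 0 < eta by rewrite lt_min; apply/andP; split; [lra | rewrite divr_gt0// mulr_gt0].
have eta1 : eta <= (t - sN) / 2 by rewrite ge_min lexx.
have eta2 : eta <= e / (4 * D) by rewrite ge_min lexx orbT.
have De : D * eta <= e / 4.
  apply: (@le_trans _ _ (D * (e / (4 * D)))); first by rewrite ler_wpM2l// ltW.
  by rewrite le_eqVlt; apply/orP; left; apply/eqP; field; rewrite gt_eqF.
(* Both [t] and the nearby [t'] lie after [a], so [gap_integral_step] treats the two sides of [t]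
   alike. The errors are [e / 4], [2 * (e / 4)] and, by strong continuity, less than [e / 4]. *)
pose a := t - eta.
have e4 : 0 < e / 4 by lra.
have [d d0 Hd] := semigroup_continuous S_semigroup (gap_integral a) (ltW eta0) e4.
apply/nbhs_ballP; exists (Num.min d eta) => /=; first by rewrite lt_min d0 eta0.
move=> t'; rewrite /ball/= lt_min => /andP[td te] /=; rewrite in_itv/= => /andP[t'0 t'T].
move: te; rewrite ltr_norml => /andP[te1 te2].
have sa : sN < a by rewrite /a; lra.
have h1 := @gap_integral_step C a t C1 HC sa _ tT.
have h2 := @gap_integral_step C a t' C1 HC sa _ t'T.
have at_ : a <= t by rewrite /a; lra.
have at' : a <= t' by rewrite /a; lra.
have {}h1 := h1 at_; have {}h2 := h2 at'.
have h3 : `|S (t' - a) (gap_integral a) - S eta (gap_integral a)| < e / 4.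
  apply: Hd; first by rewrite subr_ge0.
  by rewrite /a (_ : _ - _ - _ = t' - t); [rewrite distrC | ring].
have ta : t - a = eta by rewrite /a; ring.
rewrite ta in h1.
have b1 : C * M * eta <= e / 4 by apply: le_trans De; rewrite ler_wpM2r ?(ltW eta0)// /D lerDl.
have b2 : C * M * (t' - a) <= 2 * (e / 4).
  apply: (@le_trans _ _ (C * M * (2 * eta))); last by lra.
  by rewrite ler_wpM2l ?mulr_ge0//; rewrite /a; lra.
rewrite (_ : _ - _ = (gap_integral t - S eta (gap_integral a)) -
    (S (t' - a) (gap_integral a) - S eta (gap_integral a)) -
    (gap_integral t' - S (t' - a) (gap_integral a))); last first.
  exact: subr_detour.
apply: le_lt_trans (ler_normB _ _) _.
have := ler_normB (gap_integral t - S eta (gap_integral a)) (S (t' - a) (gap_integral a) - S eta (gap_integral a)).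
lra.
Qed.


Lemma patched_le t : t <= tau -> patched t = w0 t.
Proof. by rewrite /patched => ->. Qed.

Lemma patched_gt t : sN < t <= T -> patched t = w0 t + gap_integral t.
Proof.
move=> /andP[st tT]; rewrite /patched; case: ifPn => // tt.
by rewrite gap_integral0 ?addr0// st.
Qed.

Lemma integrand_patched t s : 0 <= s <= T ->
  integrand P S patched u t s = integrand P S w0 u t s.
Proof.
move=> /andP[s0 sT]; have le_tau v : v <= s -> v - r <= tau.
  move=> vs; apply: le_trans (ltW Tr_tau); rewrite lerD2r; exact: le_trans vs sT.
have E : bint `[0, s]%classic (memory_term P patched s) =
    bint `[0, s]%classic (memory_term P w0 s).
  apply: bint_ext => v /=; rewrite in_itv/= => /andP[v0 vs].
  by rewrite /memory_term (patched_le (le_tau _ vs)).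
by rewrite /integrand /forcing E (patched_le (le_tau _ (lexx s))).
Qed.

Lemma integrand_patched_le t s : 0 <= s <= tau ->
  integrand P S patched u t s = integrand P S w0 (fun=> 0) t s.
Proof.
move=> /andP[s0 st]; rewrite integrand_patched; last by rewrite s0 (le_trans st (ltW tau_T)).
by rewrite /integrand /forcing u_zero.
Qed.

Let near_patched (F : set_system R) (t : R) (l : X) : Filter F -> t < tau ->
  (forall A, nbhs t A -> F A) -> w0 @ F --> l -> patched @ F --> l.
Proof.
move=> FF tt sub; apply: near_eq_cvg_to; apply: sub.
by apply: filterS (near_lt_nbhs tt) => x /ltW xt; rewrite patched_le.
Qed.

Lemma patched_PC : PC P patched.
Proof.
have [[w0pw w0c w0g] w0h _ _ _] := w0_mild; have sN0 := grid_sN_ge0.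
split.
- have [d Hd] := w0pw; exists d => t tr; have [h1 h2 h3] := Hd t tr.
  have tt : t < tau by move: tr; rewrite in_itv/= => /andP[_ /le_lt_trans]; apply.
  split.
  + move=> td; rewrite patched_le ?(ltW tt)//; apply: (near_patched _ tt) (h1 td).
    by move=> A; exact: nbhs_within.
  + move=> /h2/cvg_ex[l hl]; apply/cvg_ex; exists l; apply: (near_patched _ tt) hl.
    by move=> A; exact: nbhs_within.
  + move=> /h3/cvg_ex[l hl]; apply/cvg_ex; exists l; apply: (near_patched _ tt) hl.
    by move=> A; exact: nbhs_within.
- move=> t tT nt; have hw := w0c t tT nt.
  have [tt|tt] := ltP t tau.
    rewrite patched_le ?(ltW tt)//; apply: (near_patched _ tt) hw.
    by move=> A; exact: nbhs_within.
  have stT : sN < t <= T by move: tT; rewrite in_itv/= => /andP[_ ->]; rewrite (lt_le_trans sN_tau tt).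
  rewrite patched_gt//.
  apply: (@near_eq_cvg_to _ _ _ (fun t => w0 t + gap_integral t)).
    have sNt : \forall x \near t, sN < x.
      by apply: (@open_nbhs_nbhs _ t [set x | sN < x]); split; [exact: open_gt | case/andP : stT].
    apply: filterS sNt => x sx; rewrite /= in_itv/= => /andP[_ xT].
    by rewrite patched_gt// sx.
  by apply: cvgD => //; exact: gap_integral_continuous.
- move=> i iN; have [h1 h2] := w0g i iN.
  have tt : hs_t P i < tau by exact: le_lt_trans (grid_t_le iN) sN_tau.
  split.
    rewrite patched_le ?(ltW tt)//; apply: (near_patched _ tt) h1.
    by move=> A; exact: nbhs_within.
  move/cvg_ex : h2 => [l hl]; apply/cvg_ex; exists l; apply: (near_patched _ tt) hl.
  by move=> A; exact: nbhs_within.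
Qed.

Let patched_main (a t : R) (g : X) : a = sN -> sN < t <= T ->
  w0 t = g + bint `[a, t]%classic (integrand P S w0 (fun=> 0) t) ->
  patched t = g + bint `[a, t]%classic (integrand P S patched u t).
Proof.
move=> -> stT w0t.
have E : bint `[sN, t]%classic (integrand P S patched u t) =
    bint `[sN, t]%classic (integrand P S w0 u t).
  apply: bint_ext => s /=; rewrite in_itv/= => /andP[h1 h2].
  rewrite integrand_patched//; rewrite (le_trans grid_sN_ge0 h1)/=.
  by case/andP : stT => _; exact: le_trans.
by rewrite E patched_gt// w0t; exact: addr_exchange.
Qed.

Let patched_early (a t : R) (g : X) : 0 <= a -> t <= tau ->
  w0 t = g + bint `[a, t]%classic (integrand P S w0 (fun=> 0) t) ->
  patched t = g + bint `[a, t]%classic (integrand P S patched u t).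
Proof.
move=> a0 tt w0t.
have E : bint `[a, t]%classic (integrand P S patched u t) =
    bint `[a, t]%classic (integrand P S w0 (fun=> 0) t).
  apply: bint_ext => s /=; rewrite in_itv/= => /andP[h1 h2].
  by rewrite integrand_patched_le// (le_trans a0 h1) (le_trans h2 tt).
by rewrite E patched_le.
Qed.

Lemma patched_mild : mild_solution P S h u patched.
Proof.
have [_ w0h w01 w0G w0s] := w0_mild; have sN0 := grid_sN_ge0; have tau0 := tau_gt0.
have [[t0 s0] ts st tN] := grid.
split.
- exact: patched_PC.
- move=> t tr; rewrite patched_le ?w0h//.
  by move: tr; rewrite in_itv/= => /andP[_ h1]; exact: le_trans h1 (ltW tau0).
- move=> t tt1; have w0t := w01 t tt1; move: tt1; rewrite in_itv/= => /andP[t_ge0 tt1].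
  have [tt|tt] := leP t tau; first exact: patched_early.
  (* The first interval extends beyond [tau], hence beyond [s_N], only if it is also the last
     one. *)
  have N0 : N = 0%N.
    apply/eqP; rewrite -leqn0 leqNgt; apply/negP => N1.
    have : hs_t P 1 <= sN by apply: grid_t_le; rewrite N1.
    by move/(le_trans tt1)/(le_lt_trans)/(_ sN_tau); rewrite ltNge (ltW tt).
  have sN00 : sN = 0 by rewrite N0.
  have stT : sN < t <= T by rewrite (lt_trans sN_tau tt) -tN N0.
  exact: patched_main w0t.
- move=> i t iN tt; have h1 := w0G i t iN tt.
  have t_tau : t <= tau.
    have [_ ts' _ _] := grid.
    move: tt; rewrite in_itv/= => /andP[_ tsi]; apply: le_trans tsi _.
    case/andP : iN => i1; rewrite leq_eqVlt => /predU1P[->|iN]; first exact: ltW.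
    apply: le_trans (ltW (st i (ltnW iN))) _; apply: le_trans (ltW sN_tau).
    by apply: grid_t_le; rewrite iN.
  by rewrite patched_le// u_zero.
- move=> i t iN tt; have h1 := w0s i t iN tt.
  have si_tau : hs_s P i <= sN.
    case/andP : iN => i1; rewrite leq_eqVlt => /predU1P[->//|iN].
    by apply: le_trans (ltW (st i (ltnW iN))) _; apply: grid_t_le; rewrite iN.
  have si0 : 0 <= hs_s P i.
    case/andP : (iN) => i1 iN'; have [i' ei] : exists i', i = i'.+1 by case: (i) i1 => // k _; exists k.
    have : hs_s P 0 < hs_t P 1 by exact: st.
    rewrite s0 => /ltW /le_trans; apply.
    have mono k : (1 <= k <= N)%N -> hs_t P 1 <= hs_s P k.
      elim: k => // k IH /andP[_ kN]; have [k0|k0] := posnP k.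
        by move: kN; rewrite k0 => kN; exact: ts.
      apply: le_trans (IH _) _; first by rewrite k0 ltnW.
      by apply: le_trans (ltW (st k (ltnW kN))) _; apply: ts.
    exact: mono.
  have sitau : hs_s P i <= tau by exact: le_trans si_tau (ltW sN_tau).
  rewrite (u_zero sitau) (patched_le sitau).
  move: tt; rewrite in_itv/= => /andP[ht1 ht2].
  have [tt|tt] := leP t tau; first exact: patched_early.
  have iN0 : i = N.
    apply/eqP; case/andP : iN => i1; rewrite leq_eqVlt => /predU1P[->//|iN].
    have : hs_t P i.+1 <= sN by apply: grid_t_le; rewrite iN.
    by move/(le_trans ht2)/(le_lt_trans)/(_ sN_tau); rewrite ltNge (ltW tt).
  apply: patched_main => //; first by rewrite iN0.
  by rewrite (lt_trans sN_tau tt) -tN -iN0.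
Qed.

End patch.

Section preparation.
Context (R : realType).
Local Notation mR := (measurableTypeR R).
Local Notation mu := (@lebesgue_measure R).

Definition real_step (L : seq (set mR * R)) (t : R) : R := \sum_(p <- L) p.2 * \1_p.1 t.

Lemma real_step_measurable (L : seq (set mR * R)) : {in L, forall p, measurable p.1} ->
  measurable_fun [set: mR] (real_step L).
Proof.
(* The guard makes every summand measurable, also for pairs outside the list, as [measurable_sum]
   asks. *)
move=> mL; rewrite (_ : real_step L = fun t => \sum_(p <- L) (if p \in L then p.2 * \1_p.1 t else 0)).
  apply: measurable_sum => p; case: (boolP (p \in L)) => pL; last exact: measurable_cst.
  apply: measurable_funM => //; apply: measurable_indic; exact: mL.
by apply/funext => t; rewrite /real_step big_seq [RHS]big_seq; apply: eq_bigr => p ->.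
Qed.

Lemma real_step_ge0 (L : seq (set mR * R)) t : {in L, forall p, 0 <= p.2} -> 0 <= real_step L t.
Proof.
move=> pos; rewrite /real_step big_seq; apply: sumr_ge0 => p pL.
by rewrite mulr_ge0// pos.
Qed.

Lemma integral_real_step (D : set mR) (L : seq (set mR * R)) : measurable D ->
  (mu D < +oo)%E -> {in L, forall p, measurable p.1} -> {in L, forall p, 0 <= p.2} ->
  (\int[mu]_(t in D) (real_step L t)%:E = (\sum_(p <- L) p.2 * fine (mu (D `&` p.1)))%:E)%E.
Proof.
move=> mD Dfin; elim: L => [|p L IH] mL pos.
  rewrite big_nil; under eq_integral do rewrite /real_step big_nil.
  by rewrite integral0.
have mp : measurable p.1 by apply: mL; rewrite inE eqxx.
have p0 : 0 <= p.2 by apply: pos; rewrite inE eqxx.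
have mL' : {in L, forall q, measurable q.1} by move=> q qL; apply: mL; rewrite inE qL orbT.
have pos' : {in L, forall q, 0 <= q.2} by move=> q qL; apply: pos; rewrite inE qL orbT.
have -> : (\int[mu]_(t in D) (real_step (p :: L) t)%:E =
    \int[mu]_(t in D) (p.2%:E * (\1_p.1 t)%:E + (real_step L t)%:E))%E.
  by apply: eq_integral => t _; rewrite /real_step big_cons EFinD EFinM.
have mI : measurable_fun D (fun t => (\1_p.1 t)%:E : \bar R).
  by apply/measurable_EFinP; apply: measurable_funS measurableT _ _ => //; exact: measurable_indic.
rewrite ge0_integralD//; last 4 first.
- by move=> t _; rewrite mule_ge0// lee_fin.
- exact: measurable_funeM.
- by move=> t _; rewrite lee_fin real_step_ge0.
- apply/measurable_EFinP; apply: measurable_funS measurableT _ _ => //.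
  exact: real_step_measurable.
rewrite ge0_integralZl//.
rewrite integral_indic// setIC (IH mL' pos') big_cons EFinD EFinM; congr (_ * _ + _)%E.
have Dp : (mu (D `&` p.1) < +oo)%E.
  by apply: le_lt_trans Dfin; apply: le_measure; rewrite ?inE//; exact: measurableI.
by apply/esym; apply: fineK; rewrite ge0_fin_numE.
Qed.

Lemma finite_min_pos (T : eqType) (l : seq T) (Q : T -> R -> Prop) :
  (forall p d d', Q p d -> 0 < d' -> d' <= d -> Q p d') ->
  {in l, forall p, exists2 d, 0 < d & Q p d} ->
  exists2 d : R, 0 < d & {in l, forall p, Q p d}.
Proof.
move=> Qdown; elim: l => [|p l IH] H; first by exists 1.
have [d1 d1_gt0 Q1] : exists2 d, 0 < d & Q p d by apply: H; rewrite inE eqxx.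
have [d2 d2_gt0 Q2] : exists2 d : R, 0 < d & {in l, forall p, Q p d}.
  by apply: IH => q ql; apply: H; rewrite inE ql orbT.
have m0 : 0 < Num.min d1 d2 by rewrite lt_min d1_gt0.
exists (Num.min d1 d2) => // q; rewrite inE => /predU1P[->|ql].
  by apply: Qdown Q1 m0 _; rewrite ge_min lexx.
by apply: Qdown (Q2 q ql) m0 _; rewrite ge_min lexx orbT.
Qed.

(** Near [a] on the left, [|w t|] is close to [|x|], where [rho] is bounded by continuity. Applied
    at [a = T - r], it bounds [rho] along the delayed state before the control is chosen. *)
Lemma composition_bounded_left (V : normedModType R) (rho : R -> R) (w : R -> V) (a : R) (x : V) :
  {within `[0, +oo[, continuous rho} -> w @ a^'- --> x ->
  exists K : R, exists2 d : R, 0 < d & forall t, a - d < t <= a -> rho `|w t| <= K.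
Proof.
move=> rho_c wx; pose l := `|x|.
have l0 : 0 <= l by exact: normr_ge0.
have [d d0 Hd] : exists2 d : R, 0 < d & forall v, 0 <= v -> `|l - v| < d -> rho v <= rho l + 1.
  have /cvgrPdist_le/(_ 1 ltr01) := rho_c l.
  have lI : `[0, +oo[%classic l by rewrite /= in_itv/= l0.
  move=> near_l.
  have : within `[0, +oo[%classic (nbhs l) (fun v => `|rho l - rho v| <= 1).
    by rewrite (nbhs_subspace_in lI); exact: near_l.
  move=> /nbhs_ballP[d /= d0 H]; exists d => // v v0 lv.
  have := H v lv; rewrite /= in_itv/= v0 => /(_ isT); rewrite ler_norml; lra.
have : w t @[t --> a^'-] --> x by exact: wx.
move/cvgrPdist_lt => /(_ _ d0)/near_leftP[d' d'0 Hd'].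
(* [w] may jump at [a], so its value there is accounted for separately. *)
exists (Num.max (rho `|w a|) (rho l + 1)), d' => // t /andP[t1].
rewrite le_eqVlt => /predU1P[->|ta]; first by rewrite le_max lexx.
rewrite le_max; apply/orP; right; apply: Hd => //.
by apply: le_lt_trans (ler_dist_dist _ _) _; apply: Hd'; rewrite t1.
Qed.

End preparation.

Lemma pulse_time_bounds (R : realType) (T a s eta : R) : eta <= a ->
  T - a < s <= T - a + eta -> 0 <= T - s /\ `|T - s - a| <= eta.
Proof. by move=> ha /andP[h1 h2]; split; [lra | rewrite ler_norml; lra]. Qed.

Lemma pulse_in_horizon (R : realType) (T a s eta delta b : R) : eta <= a -> a < delta ->
  b <= T - delta -> T - a < s <= T - a + eta -> b <= s <= T.
Proof. by move=> ha ad bT /andP[h1 h2]; apply/andP; split; lra. Qed.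

(** * Pulse controls and their response *)

Section step_control.
Context (R : realType) (P : heat_system R) (S : R -> L2 R -> L2 R).
Local Notation T := (hs_T P).
Local Notation B := (control_op P).
Local Notation mR := (measurableTypeR R).
Local Notation mu := (@lebesgue_measure R).
Hypothesis theta_open : open_region P.
Hypothesis S_semigroup : C0_semigroup S.
Variables (l : seq (R * L2 R)) (delta eta eps : R).
Hypothesis l_delta : {in l, forall p, 0 < p.1 < delta}.
Hypothesis eta_gt0 : 0 < eta.
Hypothesis eps_ge0 : 0 <= eps.
Hypothesis l_eta : {in l, forall p, eta <= p.1 /\
  forall t, 0 <= t -> `|t - p.1| <= eta -> `|S t (B p.2) - S p.1 (B p.2)| <= eps}.

(** The pulse starts at [T - p.1] and so stays after [T - delta]; [eta <= p.1] makes it end by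
    [T]. *)
Definition pulse (p : R * L2 R) : set mR := `]T - p.1, T - p.1 + eta]%classic.

Definition step_control : R -> L2 R :=
  step_fun [seq (pulse p, eta^-1 *: p.2) | p <- l].

(** The response with the semigroup frozen at time [p.1] on each pulse. As the pulse length cancels
    [eta^-1], its integral is exactly the target sum. *)
Definition step_response : R -> L2 R :=
  step_fun [seq (pulse p, eta^-1 *: S p.1 (B p.2)) | p <- l].

(** With this height each pulse contributes [eps] to the integral, whatever [eta] is. *)
Definition response_error : seq (set mR * R) := [seq (pulse p, eta^-1 * eps) | p <- l].

Lemma pulse_measurable p : measurable (pulse p). Proof. exact: measurable_itv. Qed.

Lemma step_controlE s : step_control s = \sum_(p <- l) \1_(pulse p) s *: (eta^-1 *: p.2).
Proof. by rewrite /step_control /step_fun big_map. Qed.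

Lemma pulse_early p s : p \in l -> s <= T - delta -> \1_(pulse p) s = 0 :> R.
Proof.
move=> /l_delta/andP[_ pd] sT; rewrite indicE memNset// /pulse /= in_itv/=.
by apply/negP; rewrite negb_and -leNgt; apply/orP; left; lra.
Qed.

Lemma step_control_zero s : s <= T - delta -> step_control s = 0.
Proof.
move=> sT; rewrite step_controlE big_seq big1// => p pl.
by rewrite pulse_early// scale0r.
Qed.

Lemma step_control_control : control P step_control.
Proof.
have mI : measurable (`[0, T]%classic : set mR) by exact: measurable_itv.
apply: (@simple_L2_in_time R (L2 R) _ _ mI).
  by rewrite lebesgue_measure_itv /=; case: ifP => _; rewrite -?EFinB ltry.
by apply: simple_step => _ /mapP[p _ ->]; exact: pulse_measurable.
Qed.

Lemma indic01 (A : set R) s : 0 <= (\1_A s : R) <= 1.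
Proof. by rewrite indicE; case: (s \in A); rewrite ?lexx ler01. Qed.

Lemma step_control_le s : `|step_control s| <= \sum_(p <- l) `|eta^-1 *: p.2|.
Proof.
rewrite step_controlE; apply: le_trans (ler_norm_sum _ _ _) _; apply: ler_sum => p _.
by have /andP[i0 i1] := indic01 (pulse p) s; rewrite normrZ ger0_norm// ler_piMl.
Qed.

Lemma pulse_late p s : p \in l -> s \in pulse p -> 0 <= T - s /\ `|T - s - p.1| <= eta.
Proof.
move=> pl; have [ep _] := l_eta pl; rewrite inE /pulse /= in_itv/=.
exact: pulse_time_bounds.
Qed.

Lemma step_response_error s : s <= T ->
  `|S (T - s) (B (step_control s)) - step_response s| <= real_step response_error s.
Proof.
move=> sT; have Ts0 : 0 <= T - s by rewrite subr_ge0.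
rewrite step_controlE (control_op_sum theta_open) (semigroup_sum S_semigroup Ts0).
rewrite /step_response /step_fun big_map -sumrB /real_step big_map.
apply: le_trans (ler_norm_sum _ _ _) _; rewrite big_seq [leRHS]big_seq.
apply: ler_sum => p pl /=.
rewrite !(control_opZ theta_open) !(semigroupZ S_semigroup Ts0) -scalerBr -scalerBr.
have eV : 0 <= eta^-1 by rewrite invr_ge0 ltW.
have /andP[i0 i1] := indic01 (pulse p) s.
rewrite !normrZ (ger0_norm i0) (ger0_norm eV) mulrC -!mulrA.
rewrite ler_wpM2l// indicE; case: (boolP (s \in pulse p)) => sp; last by rewrite !mulr0.
have [h1 h2] := pulse_late pl sp; have [_ h3] := l_eta pl.
by rewrite !mulr1; exact: h3.
Qed.

Lemma mu_pulse (a : R) p : p \in l -> a <= T - delta ->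
  mu (`[a, T]%classic `&` pulse p) = eta%:E.
Proof.
move=> pl aT; have /andP[p0 pd] := l_delta pl; have [ep _] := l_eta pl.
rewrite (_ : _ `&` _ = `]T - p.1, T - p.1 + eta]%classic).
  by rewrite lebesgue_measure_itv/= lte_fin ltrDl eta_gt0 -EFinB addrAC subrr add0r.
apply/seteqP; split => x /=; first by case.
move=> xp; split => //; move: xp; rewrite /= !in_itv/=.
exact: pulse_in_horizon ep pd aT.
Qed.

Lemma step_response_integral (a : R) : a <= T - delta ->
  bochner_integral `[a, T]%classic step_response (\sum_(p <- l) S p.1 (B p.2)).
Proof.
move=> aT; have mI : measurable (`[a, T]%classic : set mR) by exact: measurable_itv.
have fI : (mu `[a, T]%classic < +oo)%E.
  by rewrite lebesgue_measure_itv /=; case: ifP => _; rewrite -?EFinB ltry.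
have := bochner_step (l := [seq (pulse p, eta^-1 *: S p.1 (B p.2)) | p <- l]) mI fI.
rewrite big_map /= -/step_response => H.
have E : \sum_(p <- l) fine (mu (`[a, T]%classic `&` pulse p)) *: (eta^-1 *: S p.1 (B p.2)) =
    \sum_(p <- l) S p.1 (B p.2).
  rewrite big_seq [RHS]big_seq; apply: eq_bigr => p pl.
  by rewrite (mu_pulse pl aT) /= scalerA divff ?scale1r// gt_eqF.
by rewrite -E; apply: H => _ /mapP[p _ ->]; exact: pulse_measurable.
Qed.

End step_control.

Lemma pw_continuous_left_limit (R : realType) (V : normedModType R) (a b t : R) (f : R -> V) :
  pw_continuous a b f -> a < t <= b -> cvg (f @ t^'-).
Proof.
move=> [d H] /andP[at_ tb]; have [|_ h _] := H t; last exact: h.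
by rewrite in_itv/= tb ltW.
Qed.

(** The time [T - r] may fall in the history, at an impulse or at a point of continuity; [PC] yields
    a left limit in each case. *)
Lemma mild_left_limit (R : realType) (P : heat_system R) (w : R -> L2 R) (t : R) :
  PC P w -> - hs_r P < t -> t < hs_T P -> cvg (w @ t^'-).
Proof.
move=> [wpw wc wg] rt tT; have [t0|t0] := leP t 0.
  by apply: (pw_continuous_left_limit wpw); rewrite rt t0.
have [[i /andP[iN /eqP ti]]|noti] := pselect (exists i, (1 <= i <= hs_N P)%N && (t == hs_t P i)).
  by rewrite ti; have [h _] := wg i iN; apply/cvg_ex; eexists; exact: h.
have tI : t \in `[0, hs_T P] by rewrite in_itv/= (ltW t0) (ltW tT).
apply/cvg_ex; exists (w t).
apply: (@within_cvg_at_left _ _ `[0, hs_T P]%classic).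
  apply/nbhs_ballP; exists t => //= x; rewrite /ball/= ltr_norml => /andP[h1 h2] xt.
  by rewrite in_itv/=; apply/andP; split; lra.
apply: wc => // i iN ti; apply: noti; exists i; rewrite iN ti eqxx//.
Qed.

Lemma final_estimate (R : realType) (V : normedModType R) (wT g y x w1 : V) (e : R) :
  y = w1 - wT -> `|g - x| <= 2 * (e / 3) -> `|y - x| < e / 3 -> `|wT + g - w1| < e.
Proof.
move=> ye gx yx; rewrite (_ : wT + g - w1 = (g - x) - (y - x)); last first.
  by rewrite opprB addrA subrK ye opprB addrA [g + wT]addrC.
apply: le_lt_trans (ler_normB _ _) _; lra.
Qed.

Lemma exists_short_horizon (R : realType) (a b c D e : R) :
  0 < a -> 0 < b -> 0 < c -> 0 <= D -> 0 < e ->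
  exists delta, [/\ 0 < delta, delta < a, delta < b, delta <= c & D * delta <= e].
Proof.
move=> a0 b0 c0 D0 e0; have D1 : 0 < D + 1 by lra.
pose m := Num.min (Num.min (a / 2) (b / 2)) (Num.min c (e / (D + 1))).
have eD : 0 < e / (D + 1) by exact: divr_gt0.
have m0 : 0 < m by rewrite !lt_min c0 eD; lra.
have ma : m <= a / 2 by rewrite !ge_min lexx.
have mb : m <= b / 2 by rewrite !ge_min lexx orbT.
have mc : m <= c by rewrite !ge_min lexx !orbT.
have me : m <= e / (D + 1) by rewrite !ge_min lexx !orbT.
exists m; split => //; try lra.
apply: (@le_trans _ _ ((D + 1) * m)); first by rewrite ler_wpM2r ?(ltW m0)// lerDl.
by rewrite mulrC -ler_pdivlMr.
Qed.

Theorem theorem4p1 (R : realType) (P : heat_system R)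
    (T_gt0 : 0 < hs_T P) (r_gt0 : 0 < hs_r P)
    (grid : time_grid P) (theta_open : open_region P) (M_bounded : kernel_Linfty P)
    (S : R -> L2 R -> L2 R) (S_semigroup : C0_semigroup S)
    (S_generator : forall z w : L2 R, generator S z w <-> heat_op z (- w))
    (subst_L2 : substitution_in_L2 P)
    (meaningful : integrals_meaningful P S)
    (well_posed : unique_mild_solutions P S)
    (rho : R -> R)
    (rho_cont : {within `[0, +oo[, continuous rho})
    (rho_ge0 : forall x, 0 <= x -> 0 <= rho x)
    (f1_bound : forall (t : R) (z v : L2 R), t \in `[0, hs_T P] ->
      `|f1 P t z v| <= rho `|z|) :
  approximately_controllable P S.
Proof.
move=> h w1 e h_PW e0.
set T := hs_T P; set r := hs_r P; set sN := hs_s P (hs_N P).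
have sN_T : sN < T := grid_sN_lt grid.
have sN0 : 0 <= sN := grid_sN_ge0 grid.
have mI (a b : R) : measurable (`[a, b]%classic : set (measurableTypeR R)) by exact: measurable_itv.
have fI (a b : R) : (lebesgue_measure `[a, b]%classic < +oo :> \bar R)%E.
  by rewrite lebesgue_measure_itv /=; case: ifP => _; rewrite -?EFinB ltry.
have zero_control : control P (fun=> 0).
  by apply: (@simple_L2_in_time R (L2 R) _ _ (mI _ _) (fI _ _)); exact: simple_cst0.
have [w0 [w0_mild _]] := well_posed h (fun=> 0) h_PW zero_control.
have [w0PC _ _ _ _] := w0_mild.
have /cvg_ex[x0 w0x0] : cvg (w0 @ (T - r)^'-).
  by apply: (mild_left_limit w0PC); rewrite /T /r; lra.
have [K [d d0 Kd]] := composition_bounded_left rho_cont w0x0.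
have [C C1 HC] := semigroup_bound S_semigroup T.
have K0 : 0 <= K.
  by apply: le_trans (Kd (T - r) _); [exact: rho_ge0 | rewrite lexx ltrBlDr ltrDl d0].
(* In turn: the delayed states precede the control, no impulse meets its support, [K] bounds [rho]
   along the delayed states, and the nonlinear contribution at time [T] is at most [e / 3]. *)
have [delta [delta0 delta_r delta_s delta_d delta_e]] : exists delta, [/\ 0 < delta, delta < r,
    delta < T - sN, delta <= d & C * (2 * K) * delta <= e / 3].
  apply: exists_short_horizon => //; first by rewrite subr_gt0.
    by rewrite !mulr_ge0// (le_trans ler01 C1).
  by rewrite divr_gt0.
pose tau := T - delta.
pose y := w1 - w0 T.
have e3 : 0 < e / 3 by rewrite divr_gt0.
have [l l_delta yl] := reachable_dense theta_open S_semigroup S_generator y delta0 e3.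
(* The successor keeps the division meaningful for an empty list. *)
pose eps := e / 3 / (size l).+1%:R.
have eps0 : 0 < eps by rewrite divr_gt0.
have [eta eta0 Heta] : exists2 eta : R, 0 < eta & {in l, forall p, eta <= p.1 /\
    forall t, 0 <= t -> `|t - p.1| <= eta ->
      `|S t (control_op P p.2) - S p.1 (control_op P p.2)| <= eps}.
  apply: (@finite_min_pos _ _ l (fun p eta => eta <= p.1 /\
    forall t, 0 <= t -> `|t - p.1| <= eta ->
      `|S t (control_op P p.2) - S p.1 (control_op P p.2)| <= eps)).
    move=> p d1 d2 [h1 h2] d2_gt0 d21; split; first exact: le_trans h1.
    by move=> t t0 /le_trans tp; apply: h2 => //; exact: tp.
  move=> p pl; have /andP[p0 _] := l_delta p pl.
  have [d1 d1_gt0 Hd1] := semigroup_continuous S_semigroup (control_op P p.2) (ltW p0) eps0.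
  exists (Num.min p.1 (d1 / 2)); first by rewrite lt_min p0 divr_gt0.
  split; first by rewrite ge_min lexx.
  move=> t t0 tp; apply: ltW; apply: Hd1 => //; apply: le_lt_trans tp _.
  by rewrite gt_min; apply/orP; right; rewrite gtr_pMr// invf_lt1// ltr1n.
pose u := step_control P l eta.
have u_control : control P u := step_control_control P l eta.
have u_zero s : s <= tau -> u s = 0 by exact: (step_control_zero eta l_delta).
(* [U] grows like [eta^-1]. It only supplies the bound needed for the continuity of the patched
   solution and does not enter the final estimate. *)
pose U := \sum_(p <- l) `|eta^-1 *: p.2|.
have uU s : `|u s| <= U by exact: step_control_le.
have sN_tau : sN < tau by rewrite /tau ltrBrDl -ltrBrDr.
have tau_T : tau < T by rewrite /tau ltrBlDr ltrDl.
have Tr_tau : T - r < tau by rewrite /tau ltrD2l ltrN2.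
have f1_K s v : tau < s <= T -> `|f1 P s (w0 (s - r)) v| <= K.
  move=> /andP[s1 s2]; apply: le_trans (f1_bound _ _ _ _) _.
    by rewrite in_itv/= s2 andbT ltW// (lt_trans _ s1)// (le_lt_trans sN0 sN_tau).
  apply: Kd; rewrite lerD2r s2 andbT addrAC ltrD2r.
  by apply: le_lt_trans s1; rewrite /tau lerD2l lerN2.
have gap_le s : tau < s <= T -> `|forcing_gap P u w0 s| <= U + 2 * K.
  move=> sT; apply: le_trans (ler_normD _ _) _; apply: lerD.
    exact: le_trans (control_op_le theta_open _) (uU s).
  apply: le_trans (ler_normB _ _) _.
  by rewrite mulr_natl mulr2n lerD//; exact: f1_K.
exists u, (patched P S u w0 tau); split => //.
  exact: (patched_mild grid theta_open S_semigroup meaningful h_PW u_control zero_control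
    w0_mild sN_tau tau_T Tr_tau u_zero gap_le).
have sTT : sN < T <= T by rewrite sN_T lexx.
rewrite (patched_gt grid theta_open S_semigroup meaningful h_PW u_control zero_control
    w0_mild tau_T u_zero sTT).
apply: (@final_estimate _ _ _ _ y (\sum_(p <- l) S p.1 (control_op P p.2))) => //.
have gapP := gap_integralP grid theta_open S_semigroup meaningful h_PW u_control zero_control w0_mild sTT.
have resp := step_response_integral l_delta eta0 Heta (ltW sN_tau).
have dif := bochner_sub (mI _ _) (fI _ _) gapP resp.
pose late : set (measurableTypeR R) := `]tau, T]%classic.
have CK0 : 0 <= C * (2 * K) by rewrite !mulr_ge0// (le_trans ler01 C1).
(* Majorant of the error: the nonlinear part costs at most [C * (2 * K)] on the late window, and
   freezing the semigroup costs [response_error]. The two integrals are at most [e / 3] each. *)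
pose L := (late, C * (2 * K)) :: response_error P l eta eps.
have L_meas : {in L, forall p, measurable p.1}.
  move=> p; rewrite inE => /predU1P[->|/mapP[q _ ->]]; first exact: measurable_itv.
  exact: pulse_measurable.
have L_pos : {in L, forall p, 0 <= p.2}.
  move=> p; rewrite inE => /predU1P[->//|/mapP[q _ ->]] /=.
  by rewrite mulr_ge0 ?invr_ge0 ?(ltW eta0) ?(ltW eps0).
have late_fun s : s <= T ->
    `|S (T - s) (forcing_gap P u w0 s) - step_response P S l eta s| <= real_step L s.
  move=> sT; have Ts : 0 <= T - s by rewrite subr_ge0.
  have base : real_step L s = C * (2 * K) * \1_late s + real_step (response_error P l eta eps) s.
    by rewrite /real_step big_cons.
  rewrite base /forcing_gap (semigroup_add S_semigroup Ts) [X in X - _]addrC -addrA.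
  apply: le_trans (ler_normD _ _) _; apply: lerD; last first.
    by apply: step_response_error => //; exact: ltW.
  have [st|ts] := leP s tau.
    by rewrite u_zero// subrr (semigroup_zero S_semigroup Ts) normr0 mulr_ge0.
  have late_s : late s by rewrite /late /= in_itv/= ts.
  rewrite indicE (mem_set late_s) mulr1.
  have TsT : 0 <= T - s <= T.
    by rewrite Ts gerBl (le_trans sN0)// ltW// (lt_trans sN_tau).
  apply: le_trans (HC _ _ TsT) _; rewrite ler_wpM2l ?(le_trans ler01 C1)//.
  apply: le_trans (ler_normB _ _) _.
  by rewrite mulr_natl mulr2n; apply: lerD; apply: f1_K; rewrite ts.
have mL : measurable_fun `[sN, T]%classic (real_step L).
  by apply: measurable_funS measurableT _ _ => //; exact: real_step_measurable.
have late_ae : {ae @lebesgue_measure R, forall s, `[sN, T]%classic s ->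
    `|S (T - s) (forcing_gap P u w0 s) - step_response P S l eta s| <= real_step L s}.
  by apply: aeW => s /=; rewrite in_itv/= => /andP[_]; exact: late_fun.
have := bochner_le (mI _ _) (fI _ _) dif mL (fun s _ => real_step_ge0 s L_pos) late_ae.
rewrite (integral_real_step (mI _ _) (fI _ _) L_meas L_pos) lee_fin => /le_trans; apply.
have mu_late : lebesgue_measure (`[sN, T]%classic `&` late) = delta%:E.
  rewrite (_ : _ `&` _ = `]tau, T]%classic).
    by rewrite lebesgue_measure_itv/= lte_fin tau_T -EFinB /tau opprB addrCA subrr addr0.
  apply/seteqP; split => x /=; first by case.
  move=> xl; split => //; move: xl; rewrite /late /= !in_itv/= => /andP[h1 ->].
  by rewrite (ltW (lt_trans sN_tau h1)).
rewrite big_cons /= mu_late [X in _ <= X](_ : _ = e / 3 + e / 3); last by rewrite mulr_natl mulr2n.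
apply: lerD => //.
rewrite big_map /= big_seq.
rewrite (eq_bigr (fun=> eps)); last first.
  move=> p pl; rewrite (mu_pulse l_delta eta0 Heta pl (ltW sN_tau)) /=.
  by rewrite mulrAC mulVf ?mul1r// gt_eqF.
rewrite -big_seq big_const_seq count_predT iter_addr_0 -[leLHS]mulr_natr /eps.
by rewrite [leLHS]mulrAC ler_pdivrMr// ler_wpM2l ?(ltW e3)// ler_nat.
Qed.
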